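(* Let $D$ be a non-empty, bounded, connected $C^{1,1}$ open set in $\mathbb{R}^d$ with $d\ge2$ with characteristic radius $R$. Let $X=(X_t)_{t\in[0,1]}=(X^1_t,\ldots,X^d_t)_{t\in[0,1]}$ be a stochastic process in $\mathbb{R}^d$ whose components are zero-mean Gaussian processes (not assumed independent or identically distributed) with càdlàg paths starting at $0$, with expected running supremums $\mu_{1,t},\ldots,\mu_{d,t}$ and supremums $\sigma^2_{1,t},\ldots,\sigma^2_{d,t}$ of the variance functions under the probability measure $\mathbb{P}=\mathbb{P}_0$, such that for each $j$ and each $t\in(0,1]$, $\sup_{s\in[0,t]}X^j_s<\infty$ $\mathbb{P}$-a.s. and $X^j_t$ is non-degenerate. Then for any $t\in(0,1]$ and $a\in(0,R/2]$ with $\max_{1\le j\le d}\mu_{j,t}<a/\sqrt d$, $$|D|-Q^X_D(t)\le d^{3/2}2^d|\partial D|\,\overline{\mu}_t+4d|D_a|\sum_{j=1}^d\exp\left(-\frac{\left(\frac{a}{\sqrt d}-\mu_{j,t}\right)^2}{2\sigma_{j,t}^2}\right),$$ where $\overline{\mu}_t=\frac1d\sum_{j=1}^d\mu_{j,t}$. Consequently, $$\limsup_{t\downarrow0}\frac{|D|-Q^X_D(t)}{\overline{\mu}_t}\le d^{3/2}2^d|\partial D|.$$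
   Context: A real-valued process is a Gaussian process if all its finite-dimensional distributions are (multivariate) Gaussian. The process $X$ is the coordinate process on the space $\mathbb{D}[0,1]$ of $\mathbb{R}^d$-valued càdlàg functions on $[0,1]$, equipped with the Borel $\sigma$-algebra of the Skorokhod $J_1$ topology (equivalently, the $\sigma$-algebra generated by coordinate projections), under a probability measure $\mathbb{P}=\mathbb{P}_0$ with $\mathbb{P}(X_0=0)=1$. A real random variable $\xi$ is non-degenerate if $\mathbb{P}(\xi\ne0)>0$. Notation: $\mu_{j,t}=\mathbb{E}[\sup_{s\in[0,t]}X^j_s]$ and $\sigma^2_{j,t}=\sup_{s\in[0,t]}\mathbb{E}[(X^j_s)^2]$. For $x\in D$, $\mathbb{P}_x(F):=\mathbb{P}(F-x)$ with $F-x=\{\omega:\omega(\cdot)+x\in F\}$; that is, $X$ under $\mathbb{P}_x$ has the law of $x+X$ under $\mathbb{P}$. The first exit time is $\tau^X_D=\inf\{t>0:X_t\in D^c\}$, and the spectral heat content is $Q^X_D(t):=\int_D\mathbb{P}_x(\tau^X_D>t)\,dx$, $t\in(0,1]$. An open set $D\subset\mathbb{R}^d$ is $C^{1,1}$ if there exist $R_1>0$ and $\Lambda>0$ such that for every $z\in\partial D$ there exist a $C^{1,1}$ function $\phi=\phi_z:\mathbb{R}^{d-1}\to\mathbb{R}$ and an orthonormal coordinate system $CS_z$: $y=(\tilde y,y^d)$ with origin at $z$ such that $\phi(0)=0$, $\nabla\phi(0)=0$, $\|\nabla\phi\|_\infty\le\Lambda$, $|\nabla\phi(x_1)-\nabla\phi(x_2)|\le\Lambda|x_1-x_2|$,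 and $B(z,R_1)\cap D=B(z,R_1)\cap\{y\text{ in }CS_z:y^d>\phi(\tilde y)\}$. Equivalently, $D$ satisfies the uniform interior and exterior ball condition: there is $R>0$ such that for every $z\in\partial D$ there are open balls $B_1,B_2$ of radius $R$ with $B_1\subset D$, $B_2\subset\mathbb{R}^d\setminus\overline D$, $\partial B_1\cap\partial B_2=\{z\}$. Such an $R$ is called the characteristic radius of $D$. $\delta_D(x)=\inf\{|x-y|:y\in\partial D\}$ and $D_a=\{x\in D:\delta_D(x)>a\}$. $|D|$, $|D_a|$ denote $d$-dimensional Lebesgue measure and $|\partial D|$ denotes the $(d-1)$-dimensional Lebesgue (surface) measure of $\partial D$. *)

(* Defs.v *)
From HB Require Import structures.
From mathcomp Require Import all_boot all_order all_algebra.
From mathcomp Require Import all_classical all_reals all_analysis.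
Set Implicit Arguments.
Unset Strict Implicit.
Unset Printing Implicit Defensive.
Import Order.TTheory GRing.Theory Num.Theory.
Import numFieldNormedType.Exports.
Local Open Scope classical_set_scope.
Local Open Scope ring_scope.

Section lebesgue_Rn.
Context {R : realType}.

(* The sigma-algebra generated by the coordinates, that is, the Borel
   sigma-algebra of R^n. *)
Definition coordinate_sets n : set (set 'rV[R]_n) :=
  [set A | exists (i : 'I_n) (B : set (measurableTypeR R)),
     measurable B /\ A = (fun x : 'rV[R]_n => x 0 i) @^-1` B].

Definition borel_rV n := g_sigma_algebraType (@coordinate_sets n).

Definition cons_rV n (p : measurableTypeR R * borel_rV n) : borel_rV n.+1 :=
  row_mx (p.1)%:M p.2.

Definition uncons_rV n (x : borel_rV n.+1) : measurableTypeR R * borel_rV n :=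
  (x 0 0, rsubmx (x : 'rV[R]_(1 + n))).

Lemma cons_rVK n : cancel (@cons_rV n) (@uncons_rV n).
Proof.
case=> a y; rewrite /uncons_rV /cons_rV /= row_mxKr; congr pair.
rewrite (_ : 0 = lshift n (0 : 'I_1)); last exact/val_inj.
by rewrite (@row_mxEl _ 1 1 n) mxE eqxx.
Qed.

Lemma uncons_rVK n : cancel (@uncons_rV n) (@cons_rV n).
Proof.
move=> x; rewrite /uncons_rV /cons_rV /=.
rewrite (_ : (x 0 0)%:M = lsubmx (x : 'rV_(1 + n))) ?hsubmxK//.
apply/rowP => i; rewrite !ord1 !mxE eqxx mulr1n.
by congr (x _ _); apply/val_inj.
Qed.

Lemma measurable_coord n (i : 'I_n) :
  measurable_fun setT (fun x : borel_rV n => x 0 i : measurableTypeR R).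
Proof.
move=> _ B mB; rewrite setTI; apply: sub_sigma_algebra.
by exists i, B.
Qed.

Lemma measurable_to_rV d (T : measurableType d) n (f : T -> borel_rV n) :
  (forall i, measurable_fun setT (fun t => f t 0 i : measurableTypeR R)) ->
  measurable_fun setT f.
Proof.
move=> mf; apply: (@measurability _ _ T (borel_rV n) setT f
  (@coordinate_sets n)) => // _ [_ [i [B [mB ->]]] <-].
by have := mf i measurableT B mB.
Qed.

Lemma measurable_cons_rV n : measurable_fun setT (@cons_rV n).
Proof.
apply: measurable_to_rV => i.
have := splitP (i : 'I_(1 + n)); case=> j ij.
- have -> : i = lshift n j by apply/val_inj.
  rewrite (_ : (fun _ => _) = fst); last first.
    by apply/funext => p; rewrite /cons_rV (@row_mxEl _ 1 1 n) ord1 mxE eqxx.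
  exact: measurable_fst.
- have -> : i = rshift 1 j by apply/val_inj.
  rewrite (_ : (fun _ => _) = (fun x : borel_rV n => x 0 j) \o snd); last first.
    by apply/funext => p; rewrite /cons_rV (@row_mxEr _ 1 1 n).
  by apply: measurableT_comp; [exact: measurable_coord|exact: measurable_snd].
Qed.

Lemma measurable_uncons_rV n : measurable_fun setT (@uncons_rV n).
Proof.
apply/measurable_fun_pairP; split; first exact: measurable_coord.
apply: measurable_to_rV => i.
rewrite (_ : (fun _ => _) = (fun x : borel_rV n.+1 => x 0 (rshift 1 i))).
  exact: measurable_coord.
by apply/funext => x /=; rewrite mxE.
Qed.

(* n-dimensional Lebesgue measure, as an iterated product measure *)
Fixpoint lebesgue_rV n : set (borel_rV n) -> \bar R :=
  match n with
  | 0 => dirac ((0 : 'rV[R]_0) : borel_rV 0)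
  | m.+1 => pushforward (lebesgue_measure \x @lebesgue_rV m)%E (@cons_rV m)
  end.

Lemma lebesgue_rV_struct n :
  [/\ lebesgue_rV (set0 : set (borel_rV n)) = 0%E,
      forall A : set (borel_rV n), (0 <= lebesgue_rV A)%E,
      semi_sigma_additive (@lebesgue_rV n) &
      sigma_finite setT (@lebesgue_rV n)].
Proof.
elim: n => [|n [m0 mge0 msa msf]].
  pose m : {finite_measure set (borel_rV 0) -> \bar R} :=
    dirac ((0 : 'rV[R]_0) : borel_rV 0).
  have -> : @lebesgue_rV 0 = m by [].
  split; [exact: measure0|by []|exact: measure_semi_sigma_additive|].
  exact: sigma_finiteT.
pose mm := isMeasure.Build _ _ _ (@lebesgue_rV n) m0 mge0 msa.
pose m1 : {measure set (borel_rV n) -> \bar R} :=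
  HB.pack (@lebesgue_rV n) mm.
pose ms := Measure_isSigmaFinite.Build _ _ _ m1 msf.
pose m : {sigma_finite_measure set (borel_rV n) -> \bar R} :=
  HB.pack (Measure.sort m1) ms.
pose p : {measure set (borel_rV n.+1) -> \bar R} :=
  measure_function_pushforward__canonical__measure_function_Measure
    (lebesgue_measure \x m)%E (@measurable_cons_rV n).
have pE : @lebesgue_rV n.+1 = p by [].
rewrite pE; split; [exact: measure0|by []|exact: measure_semi_sigma_additive|].
have /sigma_finiteP[F [UF ndF Foo]] := sigma_finiteT (@lebesgue_measure R).
have /sigma_finiteP[G [UG ndG Goo]] := sigma_finiteT m.
exists (fun k => @uncons_rV n @^-1` (F k `*` G k)).
  apply/esym; rewrite -subTset => x _.
  have [i _ Fi] : (\bigcup_k F k) (uncons_rV x).1 by rewrite -UF.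
  have [j _ Gj] : (\bigcup_k G k) (uncons_rV x).2 by rewrite -UG.
  exists (maxn i j) => //; split => /=.
  - by move: Fi; exact/subsetPset/ndF/leq_maxl.
  - by move: Gj; exact/subsetPset/ndG/leq_maxr.
move=> k; have [mF Fk] := Foo k; have [mG Gk] := Goo k.
have mFG : measurable (F k `*` G k) by exact: measurableX.
split.
  by rewrite -[X in measurable X]setTI; exact: measurable_uncons_rV.
rewrite /p /= /pushforward -comp_preimage.
rewrite (_ : _ \o _ = id); last by apply/funext => x /=; exact: cons_rVK.
rewrite preimage_id.
apply: (@le_lt_trans _ _ ((lebesgue_measure \x m)%E (F k `*` G k))) => //.
by rewrite product_measure1E// lte_mul_pinfty// ge0_fin_numE.
Qed.

HB.instance Definition _ n := isMeasure.Build _ _ _ (@lebesgue_rV n)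
  (let: And4 h _ _ _ := lebesgue_rV_struct n in h)
  (let: And4 _ h _ _ := lebesgue_rV_struct n in h)
  (let: And4 _ _ h _ := lebesgue_rV_struct n in h).

HB.instance Definition _ n := Measure_isSigmaFinite.Build _ _ _ (@lebesgue_rV n)
  (let: And4 _ _ _ h := lebesgue_rV_struct n in h).

End lebesgue_Rn.

Section euclidean_geometry.
Context {R : realType}.

Definition dot n (x y : 'rV[R]_n) : R := \sum_i x 0 i * y 0 i.

(* the norm of 'rV[R]_n provided by the library is the supremum norm *)
Definition enorm n (x : 'rV[R]_n) : R := Num.sqrt (dot x x).

Definition eball n (x : 'rV[R]_n) (r : R) : set 'rV[R]_n :=
  [set y | enorm (y - x) < r].

Definition boundary n (A : set 'rV[R]_n) : set 'rV[R]_n :=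
  closure A `\` interior A.

Definition boundary_dist n (D : set 'rV[R]_n) (x : 'rV[R]_n) : R :=
  inf [set enorm (x - y) | y in boundary D].

Definition inner_part n (D : set 'rV[R]_n) (a : R) : set 'rV[R]_n :=
  [set x | D x /\ a < boundary_dist D x].

Definition diam n (A : set 'rV[R]_n) : R :=
  sup [set enorm (p.1 - p.2) | p in A `*` A].

Definition small_covers n (delta : R) (A : set 'rV[R]_n) :
    set (nat -> set 'rV[R]_n) :=
  [set F | A `<=` \bigcup_i F i /\
     forall i x y, F i x -> F i y -> enorm (x - y) <= delta].

(* k-dimensional Hausdorff measure (k >= 1), normalised by the volume of the
   unit ball of R^k so as to agree with k-dimensional Lebesgue measure on
   k-dimensional surfaces *)
Definition hausdorff n (k : nat) (A : set 'rV[R]_n) : \bar R :=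
  ereal_sup [set
    ereal_inf [set
      (\sum_(i <oo)
         (lebesgue_rV (eball (0 : 'rV[R]_k) 1) * ((diam (F i) / 2) ^+ k)%:E))%E
      | F in small_covers delta A]
    | delta in [set delta : R | 0 < delta]].

Definition surface_area n (D : set 'rV[R]_n) : \bar R :=
  hausdorff n.-1 (boundary D).

Definition gradient n (phi : 'rV[R]_n -> R) (x : 'rV[R]_n) : 'rV[R]_n :=
  \row_i 'D_(delta_mx 0 i) phi x.

Definition C11_graph_function n (L : R) (phi : 'rV[R]_n -> R) : Prop :=
  [/\ forall x, differentiable phi x,
      phi 0 = 0 /\ gradient phi 0 = 0,
      forall x, enorm (gradient phi x) <= L &
      forall x y, enorm (gradient phi x - gradient phi y) <= L * enorm (x - y)].

(* e spans the hyperplane of the first n - 1 coordinates, nu is the direction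
   of the last one *)
Definition orthonormal_frame n (e : 'I_n.-1 -> 'rV[R]_n) (nu : 'rV[R]_n) :
    Prop :=
  [/\ forall i j, dot (e i) (e j) = (i == j)%:R,
      forall i, dot (e i) nu = 0 & dot nu nu = 1].

Definition C11_domain n (D : set 'rV[R]_n) : Prop :=
  exists R1 L : R, [/\ 0 < R1, 0 < L &
    forall z, boundary D z ->
      exists (phi : 'rV[R]_n.-1 -> R) (e : 'I_n.-1 -> 'rV[R]_n) (nu : 'rV[R]_n),
        [/\ C11_graph_function L phi, orthonormal_frame e nu &
            eball z R1 `&` D =
            eball z R1 `&`
              [set x | phi (\row_i dot (x - z) (e i)) < dot (x - z) nu]]].

Definition characteristic_radius n (D : set 'rV[R]_n) (r : R) : Prop :=
  0 < r /\
  forall z, boundary D z -> exists c1 c2 : 'rV[R]_n,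
    [/\ eball c1 r `<=` D, eball c2 r `<=` ~` closure D &
        boundary (eball c1 r) `&` boundary (eball c2 r) = [set z]].

End euclidean_geometry.

(* An element of D[0,1] is encoded by its extension to R that is constant on
   each side of [0,1]; this extension is cadlag on R exactly when the original
   function is cadlag on [0,1]. *)
Record cadlag_path (R : realType) (d : nat) := CadlagPath {
  path_fun :> R -> 'rV[R]_d ;
  path_right_continuous : forall t : R, path_fun s @[s --> t^'+] --> path_fun t ;
  path_left_limit : forall t : R, cvg (path_fun s @[s --> t^'-]) ;
  path_before0 : forall t : R, t <= 0 -> path_fun t = path_fun 0 ;
  path_after1 : forall t : R, 1 <= t -> path_fun t = path_fun 1 }.

Section path_space.
Context {R : realType} {d : nat}.

Lemma translate_right (x : 'rV[R]_d) (w : cadlag_path R d) (t : R) :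
  (w s + x) @[s --> t^'+] --> w t + x.
Proof. by apply: cvgD; [exact: path_right_continuous|exact: cvg_cst]. Qed.

Lemma translate_left (x : 'rV[R]_d) (w : cadlag_path R d) (t : R) :
  cvg ((w s + x) @[s --> t^'-]).
Proof. by apply: is_cvgD; [exact: path_left_limit|exact: is_cvg_cst]. Qed.

Lemma translate_before0 (x : 'rV[R]_d) (w : cadlag_path R d) (t : R) :
  t <= 0 -> w t + x = w 0 + x.
Proof. by move=> t0; rewrite path_before0. Qed.

Lemma translate_after1 (x : 'rV[R]_d) (w : cadlag_path R d) (t : R) :
  1 <= t -> w t + x = w 1 + x.
Proof. by move=> t1; rewrite path_after1. Qed.

Definition translate (x : 'rV[R]_d) (w : cadlag_path R d) : cadlag_path R d :=
  CadlagPath (@translate_right x w) (@translate_left x w)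
    (@translate_before0 x w) (@translate_after1 x w).

Definition null_path : cadlag_path R d.
Proof.
exists (fun=> 0) => // t; [exact: cvg_cst|exact: is_cvg_cst].
Defined.

HB.instance Definition _ := gen_eqMixin (cadlag_path R d).
HB.instance Definition _ := gen_choiceMixin (cadlag_path R d).
HB.instance Definition _ := isPointed.Build (cadlag_path R d) null_path.

(* the sigma-algebra of D[0,1] is generated by the coordinate projections *)
Definition path_cylinders : set (set (cadlag_path R d)) :=
  [set A | exists (t : R) (j : 'I_d) (B : set (measurableTypeR R)),
     [/\ t \in `[0, 1], measurable B &
         A = (fun w : cadlag_path R d => w t 0 j) @^-1` B]].

HB.instance Definition _ := Measurable.copy (cadlag_path R d)
  (g_sigma_algebraType path_cylinders).

End path_space.

Section gaussian.
Context {R : realType}.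

(* the Gaussian law on R, including the degenerate case of variance 0, for
   which [normal_prob] takes a conventional value *)
Definition gaussian (m s : R) (B : set (measurableTypeR R)) : \bar R :=
  if s == 0 then dirac (m : measurableTypeR R) B else normal_prob m s B.

Definition gaussian_vector dT (T : measurableType dT) (P : probability T R)
    (k : nat) (Y : 'I_k -> T -> R) : Prop :=
  forall c : 'I_k -> R, exists m s : R,
    forall B : set (measurableTypeR R), measurable B ->
      P ((fun w => \sum_i c i * Y i w) @^-1` B) = gaussian m s B.

Definition gaussian_process01 dT (T : measurableType dT) (P : probability T R)
    (X : R -> T -> R) : Prop :=
  forall (k : nat) (t : 'I_k -> R), (forall i, t i \in `[0, 1]) ->
    gaussian_vector P (fun i => X (t i)).

End gaussian.

Section spectral_heat_content.
Context {R : realType} {d : nat}.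
Implicit Types (P : probability (cadlag_path R d) R) (D : set 'rV[R]_d).

Definition running_sup (j : 'I_d) (t : R) (w : cadlag_path R d) : \bar R :=
  ereal_sup [set (w s 0 j)%:E | s in `[0, t]].

Definition mean_sup P (j : 'I_d) (t : R) : \bar R :=
  (\int[P]_w running_sup j t w)%E.

Definition var_sup P (j : 'I_d) (t : R) : \bar R :=
  ereal_sup [set 'E_P[fun w => (w s 0 j ^+ 2)%R]%E | s in `[0, t]].

Definition mean_sup_avg P (t : R) : \bar R :=
  ((d%:R^-1)%:E * \sum_(j < d) mean_sup P j t)%E.

Definition exit_time D (w : cadlag_path R d) : \bar R :=
  ereal_inf [set t%:E | t in [set t : R | t \in `]0, 1] /\ ~ D (w t)]].

(* The exit events {exit_time D > t} are complements of analytic sets: they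
   belong to the P-completion of the sigma-algebra generated by the
   coordinates, but not always to this sigma-algebra. P is therefore completed:
   on the completed sigma-algebra the outer measure P^* is the completion of
   P. *)
Definition law_from P (x : 'rV[R]_d) (F : set (cadlag_path R d)) : \bar R :=
  (P^*)%mu [set w | F (translate x w)].

(* As a function of x the integrand is nonnegative and Lebesgue measurable,
   though not always Borel; its library integral, a supremum over the Borel
   simple functions below it, is then its Lebesgue integral. *)
Definition heat_content P D (t : R) : \bar R :=
  (\int[@lebesgue_rV R d]_(x in D)
     law_from P x [set w | t%:E < exit_time D w])%E.

End spectral_heat_content.

(* Main.v *)
Require Import Defs.
From HB Require Import structures.
From mathcomp Require Import all_boot all_order all_algebra.
From mathcomp Require Import all_classical all_reals all_analysis.
From mathcomp Require Import measurable_realfun perm ring lra.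
Set Implicit Arguments.
Unset Strict Implicit.
Unset Printing Implicit Defensive.
Import Order.TTheory GRing.Theory Num.Theory.
Import numFieldNormedType.Exports.
Local Open Scope classical_set_scope.
Local Open Scope ring_scope.

(* The boundary layer of depth u has volume at most 2^(d-1) u |bd D|: the ball
   condition gives a unit normal at each boundary point, depending on the point in
   a Lipschitz way, and the layer is the union of the normal segments. Over a small
   piece of the boundary these segments fill a set whose differences lie in a thin
   cylinder, and Steiner symmetrization bounds the volume of such a set by that of
   the half-sized cylinder.

   A path started at distance delta from the boundary stays in D as long as the sum
   of the ranges of its coordinates is less than delta. By Fubini, the heat lost
   from the layer of depth a is then at most 2^(d-1) |bd D| times the expected total
   range, which is 2 d times the average expected supremum, -X being distributed
   like X. A path started deeper stays in D unless the supremum of some X^j or -X^j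
   reaches a / sqrt d, which is controlled by the Borell-TIS inequality.

   That inequality follows from E e^F(X) <= e^(L^2 v / 2 + E F(X)) for soft maxima
   F: X being the sum of N independent copies of X / sqrt N, one compares the two
   sides along these steps, with an error of order N^(-3/2) in each. Laws are
   identified by their moment generating functions.

   As t decreases to 0 the exponential terms are negligible because the variance of
   a centered Gaussian variable is a constant times the square of the mean of its
   positive part. *)

(** * Lebesgue measure on R^n *)

(** The factor 2^(d-1) is the price of tilting normals: normal segments of length at most Rad / 2
    over a piece of diameter eta spread sideways by up to eta / 2 each, so the collar has lateral
    differences up to 2 eta, while the Hausdorff measure charges the piece as a ball of diameter
    eta. A set whose differences lie in a cylinder need not fit into a translate of the half-sized
    one, hence symmetrization instead of inclusion. Measurability shapes the last part: survival
    probabilities are outer measures, and as functions of the starting point they need not be Borel,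
    so they are only compared with a Borel function from below. Suprema over [0, t] become suprema
    over countably many times, so Gaussian facts are needed for finite vectors only, with bounds
    free of the dimension. They are so because the gradient of a soft maximum of scale lam has l1
    norm lam: only the largest coordinate variance enters. The argument yields the constants d 2^d
    and 2, which d^(3/2) 2^d and 4 d dominate. *)

Section translation.
Context {R : realType}.

Lemma lebesgue_measure_translate (c : R) (A : set (measurableTypeR R)) :
  measurable A ->
  lebesgue_measure ((fun x => x + c) @^-1` A) = lebesgue_measure A.
Proof.
have mf : measurable_fun setT
    (fun x : measurableTypeR R => x + c : measurableTypeR R).
  exact: measurable_funD.
pose m : {measure set (measurableTypeR R) -> \bar R} :=
  measure_function_pushforward__canonical__measure_function_Measure
    (@lebesgue_measure R) mf.
move=> mA; apply/esym; change (lebesgue_measure A = m A).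
apply: lebesgue_measure_unique => // _ [[a b] _ <-] /=; rewrite /m/= /pushforward.
rewrite (_ : _ @^-1` _ = `]a - c, b - c]%classic); last first.
  by apply/seteqP; split => x /=; rewrite !in_itv/= ltrBlDr lerBrDr.
rewrite !lebesgue_measure_itv/= !lte_fin ltrD2r; case: ifP => // _.
by rewrite -!EFinB; congr (_%:E); ring.
Qed.

Lemma measurable_rVD d (T : measurableType d) n (f g : T -> borel_rV n) :
  measurable_fun setT f -> measurable_fun setT g ->
  measurable_fun setT (fun t => (f t + g t : borel_rV (R:=R) n)).
Proof.
move=> mf mg; apply: measurable_to_rV => i.
rewrite (_ : (fun _ => _) = (fun t => (f t 0 i + g t 0 i : R))).
  apply: measurable_funD; first exact: measurableT_comp (measurable_coord i) mf.
  exact: measurableT_comp (measurable_coord i) mg.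
by apply/funext => p; rewrite mxE.
Qed.

Lemma measurable_translate n (c : 'rV[R]_n) :
  measurable_fun setT (fun x : borel_rV n => (x + c : borel_rV n)).
Proof.
apply: measurable_to_rV => i.
rewrite (_ : (fun _ => _) = (fun x : borel_rV n => (x 0 i + c 0 i : R))).
  by apply: measurable_funD => //; exact: measurable_coord.
by apply/funext => x; rewrite mxE.
Qed.

Lemma measurable_scale n (a : R) :
  measurable_fun setT (fun x : borel_rV n => (a *: (x : 'rV_n) : borel_rV n)).
Proof.
apply: measurable_to_rV => i.
rewrite (_ : (fun _ => _) = (fun x : borel_rV n => (a * x 0 i : R))).
  by apply: measurable_funM => //; exact: measurable_coord.
by apply/funext => x; rewrite mxE.
Qed.

Lemma measurable_preimage d1 d2 (T1 : measurableType d1) (T2 : measurableType d2)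
    (f : T1 -> T2) (A : set T2) :
  measurable_fun setT f -> measurable A -> measurable (f @^-1` A).
Proof. by move=> mf mA; rewrite -[X in measurable X]setTI; exact: mf. Qed.

Lemma cons_rV0 n (p : measurableTypeR R * borel_rV n) : cons_rV p 0 0 = p.1.
Proof. by have := cons_rVK p; case: p => a y [->]. Qed.

Lemma rsubmx_cons_rV n (p : measurableTypeR R * borel_rV n) :
  rsubmx (cons_rV p : 'rV_(1 + n)) = p.2.
Proof. by rewrite /cons_rV row_mxKr. Qed.

Lemma cons_rVS n (p : measurableTypeR R * borel_rV n) (i : 'I_n) :
  cons_rV p 0 (lift ord0 i) = p.2 0 i.
Proof.
transitivity (rsubmx (cons_rV p : 'rV_(1 + n)) 0 i).
  by rewrite [RHS]mxE; congr (cons_rV p _ _); exact/val_inj.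
by rewrite rsubmx_cons_rV.
Qed.

Lemma cons_rVD n (p : measurableTypeR R * borel_rV n) (c : 'rV[R]_n.+1) :
  cons_rV p + c = cons_rV (p.1 + c 0 0, p.2 + rsubmx (c : 'rV_(1 + n))).
Proof.
apply: (can_inj (@uncons_rVK R n)); rewrite cons_rVK /uncons_rV mxE cons_rV0.
by congr pair; rewrite linearD/= rsubmx_cons_rV.
Qed.

(** Induction on the dimension: a translation acts separately on the first coordinate and on the
    others, and the translated product measure agrees with the product measure on rectangles. *)
Lemma lebesgue_rV_translate n (c : 'rV[R]_n) (A : set (borel_rV n)) :
  measurable A -> lebesgue_rV ((fun x => x + c) @^-1` A) = lebesgue_rV A.
Proof.
elim: n c A => [|n IH] c A mA.
  have -> : (fun x => x + c) = id by apply/funext => x; rewrite (thinmx0 c) addr0.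
  by rewrite preimage_id.
rewrite /= /pushforward.
have mcons := measurable_preimage (@measurable_cons_rV R n) mA.
pose c' : 'rV[R]_n := rsubmx (c : 'rV_(1 + n)).
pose s (p : measurableTypeR R * borel_rV n) :
  measurableTypeR R * borel_rV n := (p.1 + c 0 0, p.2 + c').
have ms : measurable_fun setT s.
  apply: measurable_fun_pair.
    by apply: measurable_funD => //; exact: measurable_fst.
  by apply: measurableT_comp (measurable_translate c') _; exact: measurable_snd.
pose m : {measure set (measurableTypeR R * borel_rV n) -> \bar R} :=
  measure_function_pushforward__canonical__measure_function_Measure
    (@lebesgue_measure R \x @lebesgue_rV R n)%E ms.
rewrite [RHS](@product_measure_unique _ _ _ _ _ _ _ m) //.
  by rewrite /m /= /pushforward; congr (_ _); apply/seteqP; split => p /=;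
    rewrite cons_rVD.
move=> B C mB mC; rewrite /m /= /pushforward.
rewrite (_ : s @^-1` _ = ((fun x => x + c 0 0) @^-1` B) `*` ((fun x => x + c') @^-1` C)).
  rewrite product_measure1E.
  - by congr (_ * _)%E; [exact: lebesgue_measure_translate|exact: IH].
  - apply: measurable_preimage => //; exact: measurable_funD.
  - exact: measurable_preimage (measurable_translate c') mC.
by apply/seteqP; split.
Qed.

Lemma measurable_opprV n :
  measurable_fun setT (fun x : borel_rV n => (- x : @borel_rV R n)).
Proof.
rewrite (_ : (fun x => - x) = (fun x => -1 *: (x : 'rV_n))).
  exact: measurable_scale.
by apply/funext => x; rewrite scaleN1r.
Qed.

Lemma fubini_sections d1 d2 (T1 : measurableType d1) (T2 : measurableType d2)
    (m1 : {sigma_finite_measure set T1 -> \bar R})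
    (m2 : {sigma_finite_measure set T2 -> \bar R}) (S : set (T1 * T2)) :
  measurable S ->
  (\int[m1]_x m2 (xsection S x) = \int[m2]_y m1 (ysection S y))%E.
Proof.
move=> mS; pose f p : \bar R := (\1_S p)%:E.
have mf : measurable_fun setT f by exact/measurable_EFinP/measurable_indic.
have f0 p : (0 <= f p)%E by rewrite lee_fin.
transitivity (\int[m1]_x \int[m2]_y f (x, y))%E.
  apply: eq_integral => x _.
  rewrite [RHS](eq_integral (fun y => (\1_(xsection S x) y)%:E)); last first.
    by move=> y _; rewrite /f !indicE mem_xsection.
  by rewrite integral_indic ?setIT//; exact: measurable_xsection.
rewrite fubini_tonelli//; apply: eq_integral => y _.
rewrite (eq_integral (fun x => (\1_(ysection S y) x)%:E)); last first.
  by move=> x _; rewrite /f !indicE mem_ysection.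
by rewrite integral_indic ?setIT//; exact: measurable_ysection.
Qed.

(* The usual proof of the uniqueness of Haar measure: integrate
   1_A(x) 1_I(x + y) in both orders. *)
Lemma lebesgue_rV_haar n (m : {sigma_finite_measure set (@borel_rV R n) -> \bar R})
    (I A : set (borel_rV n)) :
  (forall (c : 'rV[R]_n) (B : set (borel_rV n)), measurable B ->
    m ((fun x => x + c) @^-1` B) = m B) ->
  measurable I -> measurable A ->
  (lebesgue_rV I * m A = m I * lebesgue_rV ((fun x => (- x)%R) @^-1` A))%E.
Proof.
move=> mt mI mA.
pose S := [set p : borel_rV n * borel_rV n | A p.1 /\ I (p.2 + p.1)].
have mS : measurable S.
  apply: measurableI.
    exact: measurable_preimage measurable_fst mA.
  apply: (@measurable_preimage _ _ _ _
    (fun p : borel_rV n * borel_rV n => (p.2 + p.1 : borel_rV n))) => //.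
  by apply: measurable_rVD; [exact: measurable_snd|exact: measurable_fst].
have mN := @measurable_opprV n.
pose T := [set p : borel_rV n * borel_rV n | A (p.2 - p.1) /\ I p.2].
have mT : measurable T.
  apply: measurableI; last exact: measurable_preimage measurable_snd mI.
  apply: (@measurable_preimage _ _ _ _
    (fun p : borel_rV n * borel_rV n => (p.2 - p.1 : borel_rV n))) => //.
  apply: measurable_rVD; first exact: measurable_snd.
  by apply: measurableT_comp mN _; exact: measurable_fst.
have S1 : (\int[m]_x lebesgue_rV (xsection S x) = lebesgue_rV I * m A)%E.
  transitivity (\int[m]_x (lebesgue_rV I * (\1_A x)%:E))%E.
    apply: eq_integral => x _; rewrite indicE.
    have [xA|xA] := boolP (x \in A); last first.
      rewrite mule0 (_ : xsection S x = set0) ?measure0//.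
      apply/seteqP; split => // y /xsectionP[/= Ax _].
      by move: xA; rewrite notin_setE.
    rewrite mule1 -[RHS](lebesgue_rV_translate x)//.
    congr (lebesgue_rV _); apply/seteqP; split => y.
      by move/xsectionP => [].
    by move=> yI; apply/xsectionP; split => //=; rewrite -inE.
  rewrite ge0_integralZl//; last exact/measurable_EFinP/measurable_indic.
  by rewrite integral_indic// setIT.
have mA' : measurable ((fun x : borel_rV n => (- x)%R) @^-1` A).
  exact: measurable_preimage mN mA.
have S2 : (\int[m]_x lebesgue_rV (ysection T x) =
    m I * lebesgue_rV ((fun x => (- x)%R) @^-1` A))%E.
  transitivity (\int[m]_x (lebesgue_rV ((fun x => (- x)%R) @^-1` A) * (\1_I x)%:E))%E.
    apply: eq_integral => x _; rewrite indicE.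
    have [xI|xI] := boolP (x \in I); last first.
      rewrite mule0 (_ : ysection T x = set0) ?measure0//.
      apply/seteqP; split => // y /ysectionP[/= _ Ix].
      by move: xI; rewrite notin_setE.
    rewrite mule1 -[RHS](lebesgue_rV_translate (- x))//.
    congr (lebesgue_rV _); apply/seteqP; split => y.
      by move/ysectionP => [/=]; rewrite opprB.
    by rewrite /= opprB => yI; apply/ysectionP; split => //=; rewrite -inE.
  rewrite ge0_integralZl//; last exact/measurable_EFinP/measurable_indic.
  by rewrite integral_indic// setIT muleC.
rewrite -S1 -S2; transitivity (\int[@lebesgue_rV R n]_y m (ysection S y))%E.
  exact: fubini_sections.
transitivity (\int[@lebesgue_rV R n]_y m (xsection T y))%E; last exact: fubini_sections.
apply: eq_integral => y _; rewrite -(mt y (xsection T y)); last exact: measurable_xsection.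
congr (m _); apply/seteqP; split => x.
  by move/ysectionP => [/= Ax Ix]; apply/xsectionP; split => //=; rewrite ?addrK// addrC.
by move/xsectionP => [/= ]; rewrite addrK => Ax Ix; apply/ysectionP; split => //=; rewrite addrC.
Qed.

Lemma lebesgue_rVS n (A : set (borel_rV n.+1)) :
  lebesgue_rV A = (@lebesgue_measure R \x @lebesgue_rV R n)%E (@cons_rV R n @^-1` A).
Proof. by []. Qed.

Definition cube n (r : R) : set (borel_rV n) := [set x : 'rV[R]_n | forall i, 0 < x 0 i <= r].

Lemma measurable_box n (J : 'I_n -> interval R) :
  measurable [set x : borel_rV n | forall i, x 0 i \in J i].
Proof.
rewrite (_ : [set x : borel_rV n | _] = \bigcap_(i in [set: 'I_n])
    (fun x : borel_rV n => x 0 i : measurableTypeR R) @^-1` [set` J i]); last first.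
  by apply/seteqP; split => x /= H i; [move=> _; exact: H|exact: (H i I)].
apply: fin_bigcap_measurable => // i _.
by apply: measurable_preimage; [exact: measurable_coord|exact: measurable_itv].
Qed.

Lemma measurable_cube n r : measurable (@cube n r).
Proof.
rewrite (_ : @cube n r = [set x : borel_rV n | forall i, x 0 i \in `]0, r]]).
  exact: measurable_box.
by apply/seteqP; split => x /= H i; have := H i; rewrite in_itv.
Qed.

Lemma lebesgue_rV_cube n (r : R) : 0 <= r -> lebesgue_rV (@cube n r) = (r ^+ n)%:E.
Proof.
move=> r0; elim: n => [|n IH].
  by rewrite /= diracE mem_set// => -[].
rewrite lebesgue_rVS (_ : _ @^-1` _ = `]0, r]%classic `*` @cube n r).
  rewrite product_measure1E//; last exact: measurable_cube.
  rewrite exprS EFinM -IH; congr (_ * _)%E.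
  transitivity (lebesgue_measure (`]0, r]%classic : set R)) => //.
  rewrite lebesgue_measure_itv/= lte_fin; case: ltP => r1; first by rewrite oppr0 adde0.
  by congr (_%:E); apply/eqP; rewrite eq_le r0 r1.
apply/seteqP; split => -[a y] /=.
  move=> H; split; first by have := H 0; rewrite cons_rV0 in_itv.
  by move=> i; have := H (lift ord0 i); rewrite cons_rVS.
by rewrite in_itv/= => -[ar yr] i; case: (unliftP ord0 i) => [j|] ->; rewrite ?cons_rVS ?cons_rV0.
Qed.

(** The reflection in [lebesgue_rV_haar] goes away: that lemma, applied to Lebesgue measure itself
    with the unit cube as [I], says that Lebesgue measure is invariant under x |-> -x. *)
Lemma lebesgue_rV_unique n (m : {sigma_finite_measure set (@borel_rV R n) -> \bar R})
    (I A : set (borel_rV n)) :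
  (forall (c : 'rV[R]_n) (B : set (borel_rV n)), measurable B ->
    m ((fun x => x + c) @^-1` B) = m B) ->
  measurable I -> (0 < lebesgue_rV I < +oo)%E -> measurable A ->
  (lebesgue_rV I * m A = m I * lebesgue_rV A)%E.
Proof.
move=> mt mI I0 mA; rewrite lebesgue_rV_haar//; congr (_ * _)%E.
have c1 : @lebesgue_rV R n (cube 1) = 1%E by rewrite lebesgue_rV_cube// expr1n.
have H : (lebesgue_rV (@cube n 1) * lebesgue_rV A = lebesgue_rV (@cube n 1) *
    lebesgue_rV ((fun x => (- x)%R) @^-1` A))%E.
  by apply: lebesgue_rV_haar => //; [exact: lebesgue_rV_translate|exact: measurable_cube].
by move: H; rewrite c1 !mul1e.
Qed.

Lemma lebesgue_rV_bounded n (A : set (borel_rV n)) (k : R) :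
  measurable A -> (forall x i, A x -> `|x 0 i| <= k) -> (lebesgue_rV A < +oo)%E.
Proof.
move=> mA Ak; pose k' := Num.max k 0.
have k0 : 0 <= k' by rewrite le_max lexx orbT.
(* The cube is open at 0; shifting by k' + 1 puts the coordinates in [1, 2 k' + 1], away from the
   excluded face. *)
apply: (@le_lt_trans _ _ (lebesgue_rV ((fun x => x + const_mx (k' + 1)) @^-1`
    (@cube n (2 * k' + 1))))).
  apply: le_measure; rewrite ?inE//.
    exact: (measurable_preimage (@measurable_translate n _) (@measurable_cube n _)).
  move=> x /Ak Ax i; rewrite !mxE.
  have : `|x 0 i| <= k' by rewrite le_max Ax.
  by rewrite ler_norml => /andP[? ?]; apply/andP; split; lra.
rewrite lebesgue_rV_translate; last exact: measurable_cube.
by rewrite lebesgue_rV_cube ?ltry//; lra.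
Qed.

(** The image of Lebesgue measure under an additive surjection is again translation invariant, hence
    a multiple of Lebesgue measure; the reference set [I] fixes the factor, in place of a
    determinant. The bound with [C] makes the image measure sigma-finite. *)
Lemma lebesgue_rV_additive n (T : 'rV[R]_n -> 'rV[R]_n) (C : R) (I A : set (borel_rV n)) :
  measurable_fun setT (T : borel_rV n -> borel_rV n) ->
  {morph T : x y / x + y} -> (forall y, exists x, T x = y) ->
  (forall (k : nat) x, (forall i, `|T x 0 i| <= k%:R) -> forall i, `|x 0 i| <= C * k%:R) ->
  measurable I -> (0 < lebesgue_rV I < +oo)%E -> measurable A ->
  (lebesgue_rV I * lebesgue_rV (T @^-1` A) = lebesgue_rV (T @^-1` I) * lebesgue_rV A)%E.
Proof.
move=> mT TD Tsurj TC mI I0 mA.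
pose p : {measure set (@borel_rV R n) -> \bar R} :=
  measure_function_pushforward__canonical__measure_function_Measure
    (@lebesgue_rV R n) mT.
have psf : sigma_finite setT p.
  exists (fun k : nat => [set x : borel_rV n | forall i, `|x 0 i| <= k%:R]).
    apply/esym; rewrite -subTset => x _.
    have H i : exists k : nat, `|x 0 i| <= k%:R.
      by exists (Num.truncn `|x 0 i|).+1; apply/ltW; rewrite truncnS_gt.
    pose f i := projT1 (cid (H i)).
    exists (\max_i f i)%N => //= i.
    apply: (le_trans (projT2 (cid (H i)))); rewrite ler_nat.
    exact: (@leq_bigmax _ f i).
  move=> k; have mk : measurable [set x : @borel_rV R n | forall i, `|x 0 i| <= k%:R].
    rewrite [X in measurable X](_ : _ = [set x : borel_rV n | forall i, x 0 i \in `[- k%:R, k%:R]]).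
      exact: measurable_box.
    by apply/seteqP; split => x /= H i; have := H i; rewrite in_itv/= ler_norml.
  split => //; apply: (@lebesgue_rV_bounded n _ (C * k%:R)).
    exact: measurable_preimage.
  by move=> x i /= H; exact: TC.
pose ms := Measure_isSigmaFinite.Build _ _ _ p psf.
pose m : {sigma_finite_measure set (@borel_rV R n) -> \bar R} :=
  HB.pack (Measure.sort p) ms.
apply: (@lebesgue_rV_unique n m) => // c B mB.
have [c' <-] := Tsurj c.
change (lebesgue_rV (T @^-1` ((fun x => x + T c') @^-1` B)) = lebesgue_rV (T @^-1` B)).
rewrite -(lebesgue_rV_translate c' (measurable_preimage mT mB)).
by congr (lebesgue_rV _); apply/seteqP; split => x /=; rewrite TD.
Qed.

Lemma lebesgue_rV_scale n (a : R) (A : set (borel_rV n)) : 0 < a -> measurable A ->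
  lebesgue_rV ((fun x => a *: (x : 'rV[R]_n)) @^-1` A) = ((a^-1 ^+ n)%:E * lebesgue_rV A)%E.
Proof.
move=> a0 mA.
have c1 : @lebesgue_rV R n (cube 1) = 1%E by rewrite lebesgue_rV_cube// expr1n.
have := @lebesgue_rV_additive n (fun x => a *: x) a^-1 (cube 1) A.
rewrite c1 mul1e => -> //.
- congr (_ * _)%E; rewrite -lebesgue_rV_cube ?invr_ge0 ?ltW//; congr lebesgue_rV.
  apply/seteqP; split => x /= + i => /(_ i); rewrite mxE -[a^-1]mul1r ler_pdivlMr// pmulr_rgt0//.
    by rewrite mulrC.
  by rewrite mulrC.
- exact: measurable_scale.
- by move=> x y; rewrite scalerDr.
- by move=> y; exists (a^-1 *: y); rewrite scalerA divff ?scale1r// gt_eqF.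
- move=> k x H i; have := H i; rewrite mxE normrM (gtr0_norm a0).
  by rewrite [_^-1 * _]mulrC ler_pdivlMr// mulrC.
- exact: measurable_cube.
- by rewrite lte01 ltry.
Qed.

End translation.

(** * Euclidean geometry *)

Section euclidean.
Context {R : realType} {n : nat}.
Implicit Types x y z : 'rV[R]_n.

Lemma dotC x y : dot x y = dot y x.
Proof. by apply: eq_bigr => i _; rewrite mulrC. Qed.

Lemma dotDl x y z : dot (x + y) z = dot x z + dot y z.
Proof. by rewrite /dot -big_split; apply: eq_bigr => i _; rewrite mxE mulrDl. Qed.

Lemma dotDr x y z : dot x (y + z) = dot x y + dot x z.
Proof. by rewrite dotC dotDl !(dotC x). Qed.

Lemma dotZl a x y : dot (a *: x) y = a * dot x y.
Proof. by rewrite /dot mulr_sumr; apply: eq_bigr => i _; rewrite mxE mulrA. Qed.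

Lemma dotZr a x y : dot x (a *: y) = a * dot x y.
Proof. by rewrite dotC dotZl dotC. Qed.

Lemma dotNl x y : dot (- x) y = - dot x y.
Proof. by rewrite -scaleN1r dotZl mulN1r. Qed.

Lemma dotNr x y : dot x (- y) = - dot x y.
Proof. by rewrite dotC dotNl dotC. Qed.

Lemma dotBl x y z : dot (x - y) z = dot x z - dot y z.
Proof. by rewrite dotDl dotNl. Qed.

Lemma dotBr x y z : dot x (y - z) = dot x y - dot x z.
Proof. by rewrite dotDr dotNr. Qed.

Definition dotE := (dotDl, dotDr, dotNl, dotNr, dotZl, dotZr).

Lemma dot_ge0 x : 0 <= dot x x.
Proof. by apply: sumr_ge0 => i _; rewrite -expr2 sqr_ge0. Qed.

Lemma dot_eq0 x : (dot x x == 0) = (x == 0).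
Proof.
apply/eqP/eqP => [H|->]; last by rewrite /dot big1// => i _; rewrite mxE mul0r.
apply/rowP => i; rewrite mxE; apply/eqP; rewrite -sqrf_eq0 expr2; apply/eqP.
by apply: (psumr_eq0P _ H) => // j _; rewrite -expr2 sqr_ge0.
Qed.

Lemma enorm_ge0 x : 0 <= enorm x. Proof. exact: sqrtr_ge0. Qed.

Lemma sqr_enorm x : enorm x ^+ 2 = dot x x.
Proof. by rewrite sqr_sqrtr// dot_ge0. Qed.

Lemma enorm_eq0 x : (enorm x == 0) = (x == 0).
Proof. by rewrite -dot_eq0 -sqr_enorm sqrf_eq0. Qed.

Lemma enorm0 : enorm (0 : 'rV[R]_n) = 0.
Proof. by apply/eqP; rewrite enorm_eq0. Qed.

Lemma enormZ a x : enorm (a *: x) = `|a| * enorm x.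
Proof.
by rewrite /enorm dotZl dotZr mulrA -expr2 sqrtrM ?sqr_ge0// sqrtr_sqr.
Qed.

Lemma enormN x : enorm (- x) = enorm x.
Proof. by rewrite -scaleN1r enormZ normrN1 mul1r. Qed.

Lemma enormB x y : enorm (x - y) = enorm (y - x).
Proof. by rewrite -enormN opprB. Qed.

Lemma le_sqr_enorm x r : 0 <= r -> (enorm x <= r) = (dot x x <= r ^+ 2).
Proof. by move=> r0; rewrite -sqr_enorm ler_sqr// nnegrE// enorm_ge0. Qed.

Lemma cauchy_schwarz x y : dot x y <= enorm x * enorm y.
Proof.
have [->|y0] := eqVneq y 0.
  by rewrite -(scale0r (0 : 'rV_n)) dotZr mul0r mulr_ge0// enorm_ge0.
have yp : 0 < enorm y by rewrite lt0r enorm_eq0 y0 enorm_ge0.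
have := dot_ge0 (enorm y *: x - enorm x *: y).
rewrite dotBl !dotBr !dotZl !dotZr -!sqr_enorm (dotC y x) => H.
have [->|x0] := eqVneq x 0.
  by rewrite -(scale0r (0 : 'rV_n)) dotZl mul0r mulr_ge0// enorm_ge0.
have xp : 0 < enorm x by rewrite lt0r enorm_eq0 x0 enorm_ge0.
have : 0 <= 2 * (enorm x * enorm y) * (enorm x * enorm y - dot x y) by lra.
by rewrite pmulr_rge0 ?subr_ge0// mulr_gt0 ?mulr_gt0.
Qed.

Lemma enormD x y : enorm (x + y) <= enorm x + enorm y.
Proof.
rewrite le_sqr_enorm ?addr_ge0 ?enorm_ge0// !dotE (dotC y x) -!sqr_enorm.
have := cauchy_schwarz x y; lra.
Qed.

Lemma enorm_triangle x y z : enorm (x - z) <= enorm (x - y) + enorm (y - z).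
Proof. by rewrite -[x - z](subrKA y) enormD. Qed.

Lemma abs_dot x y : `|dot x y| <= enorm x * enorm y.
Proof.
have A := cauchy_schwarz x y; have := cauchy_schwarz (- x) y.
by rewrite dotNl enormN => B; rewrite ler_norml A andbT lerNl.
Qed.

Lemma coord_le_enorm x i : `|x 0 i| <= enorm x.
Proof.
rewrite -(ler_sqr (normr_ge0 _)) ?nnegrE ?enorm_ge0// sqr_enorm real_normK ?num_real//.
rewrite /dot (bigD1 i)//= -expr2 lerDl; apply: sumr_ge0 => j _.
by rewrite -expr2 sqr_ge0.
Qed.

Lemma enorm_le_sum x : enorm x <= \sum_i `|x 0 i|.
Proof.
have s0 (P : pred 'I_n) : 0 <= \sum_(i | P i) `|x 0 i| by apply: sumr_ge0.
rewrite le_sqr_enorm// expr2 mulr_suml; apply: ler_sum => i _.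
rewrite -expr2 -real_normK ?num_real// expr2 ler_wpM2l//.
by rewrite (bigD1 i)//= lerDl.
Qed.

Lemma enorm_le_max x r : 0 <= r -> (forall i, `|x 0 i| <= r) ->
  enorm x <= r * Num.sqrt n%:R.
Proof.
move=> r0 H; rewrite le_sqr_enorm; last by rewrite mulr_ge0// sqrtr_ge0.
rewrite exprMn sqr_sqrtr// -[n in n%:R]card_ord -sumr_const mulr_sumr.
apply: ler_sum => i _; rewrite mulr1 -expr2 -real_normK ?num_real//.
by rewrite ler_sqr ?nnegrE.
Qed.

Lemma mx_norm_le_enorm x : `|x| <= enorm x.
Proof.
rewrite [`|x|]mx_normrE; elim/big_ind: _ => //.
- exact: enorm_ge0.
- by move=> a b ? ?; rewrite ge_max; apply/andP.
- by move=> [i j] _ /=; rewrite ord1 coord_le_enorm.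
Qed.

Lemma enorm_le_mx_norm x : enorm x <= `|x| * Num.sqrt n%:R.
Proof.
apply: enorm_le_max => // i; rewrite [`|x|]mx_normrE.
exact: (@le_bigmax _ _ _ _ (fun i : 'I_1 * 'I_n => `|x i.1 i.2|) (0, i)).
Qed.

(** The equality case of the triangle inequality. It shows that the point where two balls touch, or
    a nearest boundary point, lies on the line of the centres. *)
Lemma enorm_add_eq x y r s : 0 < r -> 0 <= s -> enorm x <= r -> enorm y <= s ->
  r + s <= enorm (x + y) -> y = (s / r) *: x.
Proof.
move=> r0 s0 xr ys; have := enormD x y => H1 H2.
have xE : enorm x = r by lra.
have yE : enorm y = s by lra.
have : (r + s) ^+ 2 <= dot (x + y) (x + y).
  by rewrite -sqr_enorm ler_sqr ?nnegrE ?enorm_ge0//; lra.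
rewrite !dotE (dotC y x) -!sqr_enorm xE yE => H.
have xy : dot x y >= r * s by nra.
apply/eqP; rewrite -subr_eq0 -dot_eq0 eq_le dot_ge0 andbT.
rewrite !dotE (dotC y x) -!sqr_enorm xE yE.
have -> : s ^+ 2 + - (s / r * dot x y) + (- (s / r * dot x y) + - - (s / r * (s / r * r ^+ 2)))
  = 2 * (s / r) * (r * s - dot x y).
  by field; rewrite gt_eqF.
by rewrite mulr_ge0_le0 ?subr_le0// mulr_ge0// divr_ge0// ltW.
Qed.

End euclidean.

(** * Euclidean balls, topology and Borel sets *)

Section topology.
Context {R : realType} {n : nat}.
Implicit Types (x y z : 'rV[R]_n) (A : set 'rV[R]_n).

Lemma nbhs_eballP x A : nbhs x A <-> exists2 e, 0 < e & eball x e `<=` A.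
Proof.
(* The added 1 keeps the divisor positive in dimension 0. *)
have c0 : 0 < Num.sqrt n%:R + 1 :> R by rewrite ltr_wpDl ?sqrtr_ge0.
split.
  move=> /nbhs_ballP[e /= e0 eA]; exists e => // y; rewrite /eball/= => ye.
  apply: eA; rewrite mx_norm_ball /ball_/= distrC.
  exact: le_lt_trans (mx_norm_le_enorm _) ye.
move=> [e e0 eA]; apply/nbhs_ballP; exists (e / (Num.sqrt n%:R + 1)) => /=.
  by rewrite divr_gt0.
move=> y; rewrite mx_norm_ball /ball_/= distrC => ye; apply: eA; rewrite /eball/=.
apply: le_lt_trans (enorm_le_mx_norm _) _.
move: ye; rewrite ltr_pdivlMr//; apply: le_lt_trans.
by rewrite ler_wpM2l// lerDl.
Qed.

Lemma open_eballP A : open A <-> forall x, A x -> exists2 e, 0 < e & eball x e `<=` A.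
Proof.
rewrite openE; split => H x Ax.
  exact/nbhs_eballP/H.
exact/nbhs_eballP/H.
Qed.

Lemma closure_eballP A x :
  closure A x <-> forall e, 0 < e -> exists2 y, A y & enorm (y - x) < e.
Proof.
split => [cA e e0|H B /nbhs_eballP[e e0 eB]].
  have [|y [Ay ye]] := cA (eball x e); last by exists y.
  by apply/nbhs_eballP; exists e.
by have [y Ay ye] := H _ e0; exists y; split => //; apply: eB.
Qed.

Lemma open_eball x r : open (eball x r).
Proof.
apply/open_eballP => y; rewrite /eball/= => yr.
exists (r - enorm (y - x)); first by rewrite subr_gt0.
move=> z /=; have := enorm_triangle z y x; lra.
Qed.

Lemma closed_enorm_le (f : 'rV[R]_n -> R) r :
  (forall x y, `|f x - f y| <= enorm (x - y)) -> closed [set x | f x <= r].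
Proof.
move=> Lf; rewrite -openC; apply/open_eballP => x /= /negP; rewrite -ltNge => rx.
exists (f x - r); first by rewrite subr_gt0.
move=> y; rewrite /eball/=; have := Lf y x; rewrite ler_norml => /andP[H _] ye.
by apply/negP; rewrite -ltNge; lra.
Qed.

(** The sigma-algebra is generated by the coordinates, so an open set has to be written as a
    countable union of boxes: those of rational centre and half-width 1 / (m + 1) that it
    contains. *)
Lemma open_measurable_rV A : open A -> measurable (A : set (borel_rV n)).
Proof.
move=> oA.
pose B (q : {ffun 'I_n -> rat} * nat) : set (@borel_rV R n) :=
  [set x | forall i, x 0 i \in `]ratr (q.1 i) - q.2.+1%:R^-1, ratr (q.1 i) + q.2.+1%:R^-1[].
pose Q := [set q | B q `<=` A].
rewrite (_ : A = \bigcup_(q in Q) B q); last first.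
  apply/seteqP; split => [x Ax|x [q Qq]]; last exact: Qq.
  have : nbhs x A by move: oA; rewrite openE; apply.
  move=> /nbhs_ballP[e /= e0 eA].
  have [k ke] : exists k : nat, k.+1%:R^-1 < e / 2.
    have e2 : 0 < e / 2 by lra.
    exists (Num.truncn (e / 2)^-1); rewrite invf_plt ?posrE//.
    exact: truncnS_gt.
  have H i : exists q : rat, x 0 i - k.+1%:R^-1 < ratr q < x 0 i + k.+1%:R^-1.
    have [|q] := @rat_in_itvoo R (x 0 i - k.+1%:R^-1) (x 0 i + k.+1%:R^-1).
      by rewrite ltrD2l gtrN// invr_gt0.
    by rewrite in_itv/=; exists q.
  pose q := [ffun i => projT1 (cid (H i))].
  exists (q, k) => [y /= By|i /=]; last first.
    rewrite ffunE; case: (cid _) => r /=; rewrite in_itv/=; set c := _^-1.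
    by rewrite !ltrBlDr => /andP[? ?]; apply/andP; split; lra.
  apply: eA; split => // i j; rewrite ord1.
  have := By j; rewrite ffunE; case: (cid _) => r /=; rewrite in_itv/=.
  move: ke; set c := _^-1; rewrite /ball/= ltr_norml => ? /andP[? ?] /andP[? ?].
  by apply/andP; split; lra.
(* Indexes the boxes by natural numbers, with the empty set for a code that stands for no box inside
   [A]. *)
pose g k := if unpickle k is Some q then if q \in Q then B q else set0 else set0.
rewrite (_ : \bigcup_(q in Q) B q = \bigcup_k g k).
  apply: bigcupT_measurable => k; rewrite /g.
  case: unpickle => // q; case: ifP => // _; exact: measurable_box.
apply/seteqP; split => x [].
  by move=> q Qq Bx; exists (pickle q) => //; rewrite /g pickleK mem_set.
move=> k _; rewrite /g; case: unpickle => // q; case: ifPn => // /set_mem Qq Bx.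
by exists q.
Qed.

Lemma closed_measurable_rV A : closed A -> measurable (A : set (borel_rV n)).
Proof.
by move=> /closed_openC /open_measurable_rV mA; rewrite -(setCK A); apply: measurableC.
Qed.

Lemma lipschitz_measurable (f : 'rV[R]_n -> R) :
  (forall x y, `|f x - f y| <= enorm (x - y)) ->
  measurable_fun setT (f : borel_rV n -> measurableTypeR R).
Proof.
move=> Lf.
apply: (measurability (@RGenOInfty.G R)) => [|/= _ [_] [r] -> <-].
  exact: RGenOInfty.measurableE.
rewrite setTI; apply: open_measurable_rV.
rewrite (_ : _ @^-1` _ = ~` [set x | f x <= r]).
  by rewrite openC; exact: closed_enorm_le.
by apply/seteqP; split => x /=; rewrite in_itv/= andbT ltNge => /negP.
Qed.

Lemma enorm_lipschitz x y : `|enorm x - enorm y| <= enorm (x - y).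
Proof.
have := enorm_triangle x y 0; have := enorm_triangle y x 0.
rewrite !subr0 (enormB y x) ler_norml => ? ?; apply/andP; split; lra.
Qed.

End topology.

(** * Volumes of Euclidean balls *)

Section ball_volume.
Context {R : realType}.

Definition unit_ball_volume n : R := fine (lebesgue_rV (eball (0 : 'rV[R]_n) 1)).

Lemma measurable_eball n x r : measurable (eball x r : set (@borel_rV R n)).
Proof. by apply: open_measurable_rV; exact: open_eball. Qed.

Lemma lebesgue_eball1 n : (0 < lebesgue_rV (eball (0 : 'rV[R]_n) 1) < +oo)%E.
Proof.
apply/andP; split; last first.
  apply: (@lebesgue_rV_bounded _ _ _ 1); first exact: measurable_eball.
  move=> x i; rewrite /eball/= subr0 => /ltW; apply: le_trans; exact: coord_le_enorm.
(* A point of the cube of side 1 / (n + 1) has norm at most the sum of its coordinates, which is at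
   most n / (n + 1) < 1. *)
pose c : R := n.+1%:R^-1.
have c0 : 0 < c by rewrite invr_gt0.
apply: (@lt_le_trans _ _ (lebesgue_rV (@cube R n c))).
  by rewrite lebesgue_rV_cube ?ltW// lte_fin exprn_gt0.
apply: le_measure; rewrite ?inE; [exact: measurable_cube|exact: measurable_eball|].
move=> x xc; rewrite /eball/= subr0.
apply: le_lt_trans (enorm_le_sum _) _.
apply: (@le_lt_trans _ _ (\sum_(i < n) c)).
  by apply: ler_sum => i _; have /andP[x0 xc'] := xc i; rewrite gtr0_norm.
by rewrite sumr_const card_ord -mulr_natl /c ltr_pdivrMr// mul1r ltr_nat.
Qed.

Lemma unit_ball_volumeE n : (unit_ball_volume n)%:E = lebesgue_rV (eball (0 : 'rV[R]_n) 1).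
Proof. by rewrite /unit_ball_volume fineK// ge0_fin_numE//; have /andP[] := lebesgue_eball1 n. Qed.

Lemma unit_ball_volume_gt0 n : 0 < unit_ball_volume n.
Proof. by rewrite -lte_fin unit_ball_volumeE; have /andP[] := lebesgue_eball1 n. Qed.

Lemma lebesgue_eball n r : 0 < r ->
  lebesgue_rV (eball (0 : 'rV[R]_n) r) = (unit_ball_volume n * r ^+ n)%:E.
Proof.
move=> r0; have ri : 0 < r^-1 by rewrite invr_gt0.
have := lebesgue_rV_scale ri (@measurable_eball n 0 1).
rewrite invrK -unit_ball_volumeE -EFinM mulrC => <-; congr lebesgue_rV.
apply/seteqP; split => x; rewrite /eball/= !subr0 enormZ gtr0_norm// mulrC ltr_pdivrMr ?mul1r//.
Qed.

Lemma measurable_closed_eball n r :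
  measurable ([set x | enorm x <= r] : set (@borel_rV R n)).
Proof. by apply: closed_measurable_rV; apply: closed_enorm_le; exact: enorm_lipschitz. Qed.

(** The closed ball lies in the open balls of radii s > r; letting s decrease to r avoids computing
    the measure of the sphere. *)
Lemma lebesgue_closed_eball n r : 0 <= r ->
  (lebesgue_rV ([set x : 'rV[R]_n | (enorm x <= r)%R] : set (borel_rV n)) <= (unit_ball_volume n * r ^+ n)%:E)%E.
Proof.
move=> r0.
have H s : r < s -> (lebesgue_rV ([set x : 'rV[R]_n | (enorm x <= r)%R] : set (borel_rV n))
    <= (unit_ball_volume n * s ^+ n)%:E)%E.
  move=> rs; rewrite -lebesgue_eball; last exact: le_lt_trans rs.
  apply: le_measure; rewrite ?inE; [exact: measurable_closed_eball|exact: measurable_eball|].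
  by move=> x /= xr; rewrite /eball/= subr0; exact: le_lt_trans rs.
have Hf : (lebesgue_rV ([set x : 'rV[R]_n | (enorm x <= r)%R] : set (borel_rV n))) \is a fin_num.
  rewrite ge0_fin_numE//; apply: le_lt_trans (H (r + 1) _) _; last by rewrite ltry.
  by rewrite ltrDl.
rewrite -(fineK Hf) lee_fin leNgt; apply/negP => Hlt.
have : \forall s \near r^'+, unit_ball_volume n * s ^+ n < fine (lebesgue_rV ([set x : 'rV[R]_n | (enorm x <= r)%R] : set (borel_rV n))).
  have : (fun s => unit_ball_volume n * s ^+ n) @ r --> unit_ball_volume n * r ^+ n.
    by apply: cvgM; [exact: cvg_cst|exact: exprn_continuous].
  move=> /cvg_at_right_filter /cvgr_lt; exact.
move=> Hn; have : \forall s \near r^'+, r < s by exact: nbhs_right_gt.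
move=> /(filterI Hn) /filter_ex [s /= [sl rs]].
by move: (H _ rs); rewrite -(fineK Hf) lee_fin leNgt sl.
Qed.

End ball_volume.

(** * Steiner symmetrization *)

Section steiner.
Context {R : realType}.

Definition set_coord n (x : 'rV[R]_n) (j : 'I_n) (t : R) : 'rV[R]_n :=
  \row_i if i == j then t else x 0 i.

(** Each line parallel to axis [j] meets the new set in a centred interval as long as the old slice.
    The strict inequality leaves a line with a null slice empty, so a point of the new set always
    witnesses a slice of positive measure. *)
Definition steiner n (j : 'I_n) (A : set 'rV[R]_n) : set 'rV[R]_n :=
  [set x : 'rV[R]_n | ((2 * `|x 0 j|)%R%:E <
            lebesgue_measure ([set t | A (set_coord x j t)] : set (measurableTypeR R)))%E].

(** Symmetrization may replace a difference of two points by one whose coordinates are smaller in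
    absolute value; a set of admissible differences has to be stable under this. *)
Definition coordwise_solid n (C : set 'rV[R]_n) : Prop :=
  forall x y : 'rV[R]_n, C x -> (forall i, `|y 0 i| <= `|x 0 i|) -> C y.

Definition diff_in n (A C : set 'rV[R]_n) : Prop :=
  forall x y, A x -> A y -> C (x - y).

Definition flip n (i : 'I_n) (x : 'rV[R]_n) : 'rV[R]_n := set_coord x i (- x 0 i).

Definition flip_invariant n (i : 'I_n) (A : set 'rV[R]_n) : Prop :=
  forall x, A x -> A (flip i x).

Lemma lebesgue_measure_sym_itv (c : \bar R) : (0 <= c)%E ->
  lebesgue_measure ([set t | ((2 * `|t|)%:E < c)%E] : set (measurableTypeR R)) = c.
Proof.
case: c => [c||] //; last first.
  move=> _; rewrite (_ : mkset _ = [set` `]-oo, +oo[]).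
    by rewrite lebesgue_measure_itv.
  by apply/seteqP; split => x //= _; rewrite ltry.
rewrite lee_fin => c0.
rewrite (_ : mkset _ = [set` `]- (c / 2), c / 2[]); last first.
  apply/seteqP; split => x /=; rewrite lte_fin in_itv/= -ltr_norml; lra.
rewrite lebesgue_measure_itv/= lte_fin; case: ltP => ?.
  by rewrite -EFinD; congr (_%:E); lra.
by congr (_%:E); lra.
Qed.

Lemma set_coord_cons n (p : measurableTypeR R * borel_rV n) t :
  set_coord (cons_rV p) 0 t = cons_rV (t, p.2).
Proof.
apply/rowP => i; rewrite mxE; case: (unliftP ord0 i) => [k|] ->.
  by rewrite !cons_rVS.
by rewrite [RHS]cons_rV0.
Qed.

(** Tonelli with the first coordinate integrated innermost: the slices keep their lengths. Direction
    0 is the one that the product structure of [lebesgue_rV] singles out. *)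
Lemma measurable_steiner0 n (A : set (borel_rV n.+1)) : measurable A ->
  measurable (steiner (0 : 'I_n.+1) A : set (borel_rV n.+1)) /\
  lebesgue_rV (steiner (0 : 'I_n.+1) A : set (borel_rV n.+1)) = lebesgue_rV A.
Proof.
move=> mA; pose B := @cons_rV R n @^-1` A.
have mB : measurable B by exact: measurable_preimage (@measurable_cons_rV R n) mA.
pose phi (y : borel_rV n) := lebesgue_measure (ysection B y).
have mphi : measurable_fun setT phi by exact: measurable_fun_ysection.
pose S := [set p : measurableTypeR R * borel_rV n | ((2 * `|p.1|)%:E < phi p.2)%E].
have mS : measurable S.
  rewrite -[S]setTI.
  rewrite (_ : S = [set p : measurableTypeR R * borel_rV n | (2 * `|p.1|)%:E < phi p.2]%E)//.
  apply: emeasurable_fun_lt => //.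
    apply/measurable_EFinP; apply: measurable_funM => //.
    by apply: measurableT_comp => //; exact: measurable_fst.
  by apply: measurableT_comp mphi _; exact: measurable_snd.
have SE : @cons_rV R n @^-1` steiner (0 : 'I_n.+1) A = S.
  apply/seteqP; split => -[a y] /=; rewrite /steiner/= cons_rV0/= (_ : [set t | _] = ysection B y)//.
  - by rewrite predeqE => t; rewrite /= set_coord_cons; split=> [?|/ysectionP//]; apply/ysectionP.
  - by rewrite predeqE => t; rewrite /= set_coord_cons; split=> [?|/ysectionP//]; apply/ysectionP.
have m1 : measurable (steiner (0 : 'I_n.+1) A : set (borel_rV n.+1)).
  rewrite (_ : steiner _ _ = @uncons_rV R n @^-1` S).
    exact: measurable_preimage (@measurable_uncons_rV R n) mS.
  by rewrite -SE; apply/seteqP; split => x /=; rewrite uncons_rVK.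
split => //.
have E (X : set (measurableTypeR R * borel_rV n)) : measurable X ->
   (lebesgue_measure \x @lebesgue_rV R n)%E X = (\int[@lebesgue_rV R n]_y (lebesgue_measure (ysection X y)))%E.
  by move=> mX; rewrite /product_measure1 -fubini_sections.
rewrite !lebesgue_rVS SE !E//; apply: eq_integral => y _.
rewrite -[RHS]lebesgue_measure_sym_itv//; congr lebesgue_measure.
by rewrite predeqE => t; split => [/ysectionP//|?]; apply/ysectionP.
Qed.

(** The unit ball is its own preimage, so as reference set in [lebesgue_rV_additive] it gives the
    factor 1. *)
Lemma lebesgue_rV_isometry n (T : 'rV[R]_n -> 'rV[R]_n) (A : set (borel_rV n)) :
  measurable_fun setT (T : borel_rV n -> borel_rV n) ->
  {morph T : x y / x + y} -> (forall y, exists x, T x = y) ->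
  (forall x, enorm (T x) = enorm x) -> measurable A ->
  lebesgue_rV (T @^-1` A) = lebesgue_rV A.
Proof.
move=> mT TD Ts TE mA.
have := @lebesgue_rV_additive R n T n%:R (eball 0 1) A mT TD Ts.
have -> : T @^-1` eball 0 1 = eball 0 1.
  by apply/seteqP; split => x; rewrite /eball/= !subr0 TE.
rewrite -unit_ball_volumeE => H.
have : (((@unit_ball_volume R n)%:E * lebesgue_rV (T @^-1` A)) = (@unit_ball_volume R n)%:E * lebesgue_rV A)%E.
  apply: H => //.
  - move=> k x H i; apply: le_trans (coord_le_enorm _ _) _; rewrite -TE.
    apply: le_trans (enorm_le_sum _) _.
    by rewrite mulr_natl -[n in _ *+ n]card_ord -sumr_const; apply: ler_sum.
  - exact: measurable_eball.
  - by rewrite unit_ball_volumeE lebesgue_eball1.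
move=> /(congr1 (fun z => (((@unit_ball_volume R n)^-1)%:E * z)%E)).
by rewrite !muleA -EFinM mulVf ?mul1e// gt_eqF// unit_ball_volume_gt0.
Qed.

(** Exchanging the coordinates 0 and [j] is an isometry, which reduces the claim to direction 0. *)
Lemma steiner_measure n (j : 'I_n) (A : set (borel_rV n)) : measurable A ->
  measurable (steiner j A : set (borel_rV n)) /\
  lebesgue_rV (steiner j A : set (borel_rV n)) = lebesgue_rV A.
Proof.
case: n j A => [[]//|n] j A mA.
pose s : 'I_n.+1 -> 'I_n.+1 := perm.tperm (0 : 'I_n.+1) j.
have sK : involutive s by move=> i; rewrite /s perm.tpermK.
have s0 : s 0 = j by rewrite /s perm.tpermL.
pose T (x : 'rV[R]_n.+1) : 'rV[R]_n.+1 := \row_i x 0 (s i).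
have mT : measurable_fun setT (T : borel_rV n.+1 -> borel_rV n.+1).
  apply: measurable_to_rV => i.
  rewrite (_ : (fun _ => _) = (fun x : borel_rV n.+1 => x 0 (s i))).
    exact: measurable_coord.
  by apply/funext => x; rewrite mxE.
have TD : {morph T : x y / x + y} by move=> x y; apply/rowP => i; rewrite !mxE.
have TK x : T (T x) = x by apply/rowP => i; rewrite !mxE sK.
have Ts y : exists x, T x = y by exists (T y).
have TE x : enorm (T x) = enorm x.
  rewrite /enorm /dot; congr Num.sqrt; rewrite [RHS](reindex_inj (can_inj sK)).
  by apply: eq_bigr => i _; rewrite mxE.
have mTA : measurable (T @^-1` A : set (borel_rV n.+1)) by exact: (measurable_preimage mT mA).
have [m0 e0] := measurable_steiner0 mTA.
have SE x : [set t | A (set_coord x j t)] = [set t | A (T (set_coord (T x) 0 t))].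
  apply/funext => t /=; rewrite (_ : T (set_coord (T x) 0 t) = set_coord x j t)//.
  apply/rowP => i; rewrite !mxE sK.
  by rewrite (can2_eq sK sK) s0.
have E : steiner j A = T @^-1` (steiner 0 (T @^-1` A)).
  by apply/seteqP; split => x; rewrite /steiner/= mxE s0 SE.
split; first by rewrite E; exact: measurable_preimage mT m0.
by rewrite E lebesgue_rV_isometry// e0 lebesgue_rV_isometry.
Qed.

Lemma flipK n (i : 'I_n) : involutive (@flip n i).
Proof.
move=> x; apply/rowP => k; rewrite !mxE eqxx.
by case: eqP => // ->; rewrite opprK.
Qed.

Lemma flip_set_coord n (i j : 'I_n) (x : 'rV[R]_n) t : i != j ->
  set_coord (flip i x) j t = flip i (set_coord x j t).
Proof.
move=> ij; apply/rowP => k; rewrite !mxE (negbTE ij).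
by have [->|kj] := eqVneq k j; rewrite // eq_sym (negbTE ij).
Qed.

Lemma steiner_flip_same n (j : 'I_n) A : flip_invariant j (steiner j A).
Proof.
move=> x; rewrite /steiner/= mxE eqxx normrN.
rewrite (_ : [set t | A (set_coord (flip j x) j t)] = [set t | A (set_coord x j t)])//.
apply/seteqP; split => t /=; rewrite (_ : set_coord (flip j x) j t = set_coord x j t)//.
all: by apply/rowP => k; rewrite !mxE; case: eqP.
Qed.

(** Symmetries gained in other directions survive, because mirror images carry the same slices. *)
Lemma steiner_flip n (i j : 'I_n) A : flip_invariant i A -> flip_invariant i (steiner j A).
Proof.
have [->|ij] := eqVneq i j; first by move=> _; exact: steiner_flip_same.
move=> Ai x; rewrite /steiner/= mxE eq_sym (negbTE ij).
rewrite (_ : [set t | A (set_coord (flip i x) j t)] = [set t | A (set_coord x j t)])//.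
apply/seteqP; split => t /=; rewrite flip_set_coord//; last exact: Ai.
by move/Ai; rewrite flipK.
Qed.

(** If all distances were below c, then sup S - inf T and sup T - inf S would be at most c, and
    these two numbers add up to the total length of the intervals spanned by S and T. *)
Lemma spread_of_measure (S T : set (measurableTypeR R)) (c : R) :
  measurable S -> measurable T ->
  ((2 * c)%:E < lebesgue_measure S + lebesgue_measure T)%E ->
  (0 < lebesgue_measure S)%E -> (0 < lebesgue_measure T)%E ->
  exists s t, [/\ S s, T t & c <= `|s - t|].
Proof.
move=> mS mT cST S0 T0; apply: contrapT => H.
have {}H s t : S s -> T t -> `|s - t| < c.
  move=> Ss Tt; rewrite ltNge; apply/negP => cst; apply: H; by exists s, t.
have [s0 Ss0] : S !=set0.
  by apply/set0P/eqP => E; move: S0; rewrite E measure0 ltxx.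
have [t0 Tt0] : T !=set0.
  by apply/set0P/eqP => E; move: T0; rewrite E measure0 ltxx.
have hasS : has_sup S.
  split; first by exists s0.
  by exists (t0 + c) => s Ss; have := H _ _ Ss Tt0; rewrite ltr_norml; lra.
have hasT : has_sup T.
  split; first by exists t0.
  by exists (s0 + c) => s Ss; have := H _ _ Ss0 Ss; rewrite ltr_norml; lra.
have hisS : has_inf S.
  split; first by exists s0.
  by exists (t0 - c) => s Ss; have := H _ _ Ss Tt0; rewrite ltr_norml; lra.
have hisT : has_inf T.
  split; first by exists t0.
  by exists (s0 - c) => s Ss; have := H _ _ Ss0 Ss; rewrite ltr_norml; lra.
have le_len (X : set (measurableTypeR R)) : measurable X -> has_sup X -> has_inf X ->
    (lebesgue_measure X <= (sup X - inf X)%:E)%E.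
  move=> mX hs hi; apply: (@le_trans _ _ (lebesgue_measure (`[inf X, sup X]%classic : set R))).
      apply: le_measure; rewrite ?inE//.
    move=> x Xx /=; rewrite in_itv/=; apply/andP; split.
      by apply: ge_inf => //; case: hi.
    by apply: ub_le_sup => //; case: hs.
  rewrite lebesgue_measure_itv/= lte_fin; case: ltP => // _.
  rewrite lee_fin subr_ge0; have [[x Xx] _] := hs.
  apply: (@le_trans _ _ x); first by apply: ge_inf => //; case: hi.
  by apply: ub_le_sup => //; case: hs.
have H1 : sup S - inf T <= c.
  rewrite lerBlDr; apply: ge_sup; first by case: hasS.
  move=> s Ss; rewrite -lerBlDl; apply: lb_le_inf; first by case: hasT.
  by move=> t Tt; have := H _ _ Ss Tt; rewrite ltr_norml; lra.
have H2 : sup T - inf S <= c.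
  rewrite lerBlDr; apply: ge_sup; first by case: hasT.
  move=> s Ss; rewrite -lerBlDl; apply: lb_le_inf; first by case: hasS.
  by move=> t Tt; have := H _ _ Tt Ss; rewrite ltr_norml; lra.
have := lt_le_trans cST (leeD (le_len S mS hasS hisS) (le_len T mT hasT hisT)).
rewrite -EFinD lte_fin; lra.
Qed.

(** The slices of A through x and y are longer than 2 |x_j| and 2 |y_j|, hence contain points of A
    that are at least |x_j - y_j| apart along the axis; solidity of C passes from their difference
    to x - y. *)
Lemma steiner_diff_in n (j : 'I_n) (A : set (borel_rV n)) C : measurable A ->
  coordwise_solid C -> diff_in A C -> diff_in (steiner j A) C.
Proof.
move=> mA Csolid AC x y; rewrite /steiner /= => Sx Sy.
have mslice z : measurable ([set t | A (set_coord z j t)] : set (measurableTypeR R)).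
  apply: (@measurable_preimage _ _ (measurableTypeR R) (borel_rV n) (set_coord z j)) => //.
  apply: measurable_to_rV => i.
  rewrite (_ : (fun _ => _) = (fun t => if i == j then t else z 0 i)).
    by case: eqP => _; [exact: measurable_id|exact: measurable_cst].
  by apply/funext => t; rewrite mxE.
have [|||s [t [As At st]]] := @spread_of_measure _ _ `|x 0 j - y 0 j| (mslice x) (mslice y).
- apply: le_lt_trans (lteD Sx Sy); rewrite -EFinD lee_fin -mulrDr ler_wpM2l//.
  exact: ler_normB.
- by apply: le_lt_trans Sx; rewrite lee_fin mulr_ge0.
- by apply: le_lt_trans Sy; rewrite lee_fin mulr_ge0.
apply: Csolid (AC _ _ As At) _ => i; rewrite !mxE.
by case: eqP => [->|].
Qed.

(* Symmetrizing in every direction makes A invariant under x |-> -x, so that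
   2 A is contained in A - A. *)
Lemma lebesgue_rV_diff_in n (A C : set (borel_rV n)) : measurable A -> measurable C ->
  coordwise_solid C -> diff_in A C ->
  (lebesgue_rV A <= lebesgue_rV ([set x | C ((x : 'rV[R]_n) + x)%R] : set (borel_rV n)))%E.
Proof.
move=> mA mC Csolid AC.
have [A' [mA' <- AC' fA']] : exists A' : set (borel_rV n), [/\ measurable A',
    lebesgue_rV A' = lebesgue_rV A, diff_in A' C & forall i, i \in enum 'I_n -> flip_invariant i A'].
  elim: (enum 'I_n) => [|j s [A' [mA' E AC' fA']]]; first by exists A.
  have [m1 e1] := steiner_measure j mA'.
  exists (steiner j A'); split => //; first by rewrite e1.
    exact: steiner_diff_in.
  move=> i; rewrite inE => /orP[/eqP->|/fA'].
    exact: steiner_flip_same.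
  exact: steiner_flip.
apply: le_measure; rewrite ?inE//.
  apply: (@measurable_preimage _ _ (borel_rV n) (borel_rV n) (fun x => x + x)) => //.
  by apply: measurable_rVD.
move=> x A'x /=; rewrite -[X in x + X]opprK; apply: AC' => //.
have H (s : seq 'I_n) : A' (\row_i if i \in s then - x 0 i else x 0 i).
  elim: s => [|j s IH].
    by rewrite (_ : \row_i _ = x)//; apply/rowP => i; rewrite mxE.
  have [js|js] := boolP (j \in s).
    rewrite (_ : \row_i _ = \row_i if i \in s then - x 0 i else x 0 i)//.
    by apply/rowP => i; rewrite !mxE inE; case: eqP => //= ->; rewrite js.
  have := fA' j (mem_enum _ j) _ IH; congr (A' _).
  apply/rowP => i; rewrite !mxE inE; case: eqP => //= ->.
  by rewrite (negbTE js).
have := H (enum 'I_n); congr (A' _); apply/rowP => i.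
by rewrite !mxE mem_enum.
Qed.

(* For a unit vector nu, the reflection exchanging nu and the first basis vector. *)
Definition reflect k (nu x : 'rV[R]_k.+1) : 'rV[R]_k.+1 :=
  let v := nu - delta_mx 0 0 in x - (2 * dot x v / dot v v) *: v.

Lemma dot_delta n (x : 'rV[R]_n) i : dot x (delta_mx 0 i) = x 0 i.
Proof.
rewrite /dot (bigD1 i)//= mxE !eqxx mulr1 big1 ?addr0// => j ji.
by rewrite mxE eqxx (negbTE ji) mulr0.
Qed.

Lemma reflectD k (nu : 'rV[R]_k.+1) : {morph reflect nu : x y / x + y}.
Proof.
move=> x y; rewrite /reflect dotDl mulrDr mulrDl scalerDl opprD.
by rewrite addrACA.
Qed.

Lemma dot_reflect k (nu x y : 'rV[R]_k.+1) :
  dot (reflect nu x) (reflect nu y) = dot x y.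
Proof.
rewrite /reflect; move: (nu - _) => v.
have [v0|v0] := eqVneq (dot v v) 0; first by rewrite v0 invr0 !mulr0 !scale0r !subr0.
by rewrite !dotE (dotC v y); field.
Qed.

Lemma reflectK k (nu : 'rV[R]_k.+1) : involutive (reflect nu).
Proof.
move=> x; rewrite {1}/reflect /reflect; move: (nu - _) => v.
have [v0|v0] := eqVneq (dot v v) 0; first by rewrite v0 invr0 !mulr0 !scale0r !subr0.
rewrite !dotE -addrA -opprD -scalerDl.
rewrite (_ : 2 * dot x v / dot v v + _ = 0) ?scale0r ?subr0//.
by field.
Qed.

Lemma reflect_normal k (nu : 'rV[R]_k.+1) : dot nu nu = 1 ->
  reflect nu nu = delta_mx 0 0.
Proof.
move=> nu1; rewrite /reflect; set v := nu - delta_mx 0 0.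
have d1 : dot (delta_mx 0 0 : 'rV[R]_k.+1) (delta_mx 0 0) = 1.
  by rewrite dot_delta mxE !eqxx.
have [v0|v0] := eqVneq (dot v v) 0.
  have : v == 0 by rewrite -dot_eq0 v0.
  by rewrite v0 invr0 mulr0 scale0r subr0 subr_eq0 => /eqP.
have E : dot v v = 2 * dot nu v.
  by rewrite /v !dotE nu1 d1 (dotC (delta_mx _ _)); ring.
rewrite -E divff// scale1r /v opprB addrC subrK//.
Qed.

(** An isodiametric inequality for cylinders. Once a reflection has moved [nu] to the first basis
    vector, the differences lie in the product of [-2h, 2h] and a ball of radius 2r, which is
    coordinatewise solid; halving this set gives the bound. *)
Lemma lebesgue_rV_cylinder k (nu : 'rV[R]_k.+1) (A : set (borel_rV k.+1)) (h r : R) :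
  measurable A -> dot nu nu = 1 -> 0 <= h -> 0 <= r ->
  (forall x y : 'rV[R]_k.+1, A x -> A y -> `|dot (x - y) nu| <= 2 * h) ->
  (forall x y : 'rV[R]_k.+1, A x -> A y ->
     enorm ((x - y) - dot (x - y) nu *: nu) <= 2 * r) ->
  (lebesgue_rV A <= (2 * h * (@unit_ball_volume R k * r ^+ k))%:E)%E.
Proof.
move=> mA nu1 h0 r0 Ah Ar.
pose T := reflect nu.
have mT : measurable_fun setT (T : borel_rV k.+1 -> borel_rV k.+1).
  rewrite /T /reflect; set v := nu - delta_mx 0 0.
  apply: measurable_to_rV => i.
  rewrite (_ : (fun _ => _) = (fun x : borel_rV k.+1 =>
    x 0 i - (\sum_j x 0 j * v 0 j) * (2 / dot v v * v 0 i))); last first.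
    by apply/funext => x; rewrite !mxE /dot; congr (_ - _); rewrite !mulrA (mulrC 2).
  apply: measurable_funB; first exact: measurable_coord.
  apply: measurable_funM => //.
  apply: measurable_sum => j; apply: measurable_funM => //; exact: measurable_coord.
have TE x : enorm (T x) = enorm x by rewrite /enorm /T dot_reflect.
rewrite -(lebesgue_rV_isometry mT (@reflectD k nu) _ TE mA); last first.
  by move=> y; exists (reflect nu y); rewrite /T reflectK.
pose C : set (borel_rV k.+1) :=
  [set x : 'rV[R]_k.+1 | `|x 0 0| <= 2 * h /\ enorm (rsubmx (x : 'rV_(1 + k))) <= 2 * r].
have mr : measurable_fun setT (fun x : @borel_rV R k.+1 => rsubmx (x : 'rV_(1 + k)) : @borel_rV R k).
  exact: (measurableT_comp measurable_snd (@measurable_uncons_rV R k)).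
have mC : measurable C.
  apply: measurableI.
    have -> : (fun x : @borel_rV R k.+1 => `|x 0 0| <= 2 * h : Prop) =
       (fun x : borel_rV k.+1 => x 0 0 : measurableTypeR R) @^-1` `[- (2 * h), 2 * h]%classic.
      by apply/seteqP; split => x /=; rewrite in_itv/= ler_norml.
    by apply: measurable_preimage; [exact: measurable_coord|exact: measurable_itv].
  exact: (measurable_preimage mr (@measurable_closed_eball R k (2 * r))).
have sumE (x : 'rV[R]_k.+1) : dot x x = x 0 0 ^+ 2 + enorm (rsubmx (x : 'rV_(1 + k))) ^+ 2.
  rewrite sqr_enorm /dot big_ord_recl -expr2; congr (_ + _).
  apply: eq_bigr => i _; rewrite !mxE.
  by rewrite (_ : rshift 1 i = lift ord0 i)//; exact/val_inj.
have Csolid : coordwise_solid C.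
  move=> x y [x0 xr] H; split; first exact: le_trans (H 0) _.
  apply: le_trans xr; rewrite le_sqr_enorm ?enorm_ge0// sqr_enorm.
  apply: ler_sum => i _; rewrite !mxE -!expr2.
  rewrite -real_normK ?num_real// -[leRHS]real_normK ?num_real//.
  by rewrite ler_sqr ?nnegrE.
have TAC : diff_in (T @^-1` A) C.
  move=> x y /= Ax Ay.
  have E : x - y = T (T x - T y).
    rewrite /T -[in RHS](scaleN1r (reflect nu y)).
    have -> : -1 *: reflect nu y = reflect nu (- y).
      apply: (addrI (reflect nu y)); rewrite -reflectD subrr scaleN1r subrr.
      by rewrite /reflect dotC -(scale0r (0 : 'rV_k.+1)) dotZr !mul0r mulr0 mul0r !scale0r subrr.
    by rewrite -reflectD reflectK.
  have E0 : (x - y) 0 0 = dot (T x - T y) nu.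
    by rewrite -dot_delta -(reflect_normal nu1) E /T dot_reflect.
  split; first by rewrite E0; exact: Ah.
  apply: le_trans (Ar _ _ Ax Ay); rewrite le_sqr_enorm ?enorm_ge0// -sqr_enorm.
  have G : dot (x - y) (x - y) = dot (T x - T y) (T x - T y) by rewrite E /T dot_reflect.
  move: (sumE (x - y)); rewrite E0 G; move: (T x - T y) => z F.
  by rewrite [leRHS]sqr_enorm !dotE nu1 (dotC nu z); lra.
have mTA : measurable (T @^-1` A : set (borel_rV k.+1)) by exact: (measurable_preimage mT mA).
apply: le_trans (lebesgue_rV_diff_in mTA mC Csolid TAC) _.
rewrite lebesgue_rVS.
rewrite (_ : _ @^-1` _ = (`[- h, h]%classic : set (measurableTypeR R)) `*` [set x : borel_rV k | enorm x <= r]).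
  rewrite product_measure1E//; last exact: measurable_closed_eball.
  rewrite EFinM; apply: lee_pmul => //; last exact: lebesgue_closed_eball.
  apply: (@le_trans _ _ (lebesgue_measure (`[- h, h]%classic : set R))) => //.
  rewrite lebesgue_measure_itv/= lte_fin; case: ltP => _; rewrite ?lee_fin; lra.
have D2 m (z : 'rV[R]_m) : enorm (z + z) = 2 * enorm z.
  by rewrite -mulr2n -scaler_nat enormZ ger0_norm.
have d2 (b : R) : `|b + b| = 2 * `|b| by rewrite -mulr2n normrMn mulr_natl.
have CE (p : measurableTypeR R * borel_rV k) :
    C (cons_rV p + cons_rV p) = (`|p.1| <= h /\ enorm p.2 <= r).
  by rewrite /C/= mxE cons_rV0 linearD/= rsubmx_cons_rV D2 d2 !ler_pM2l.
by apply/seteqP; split => -[a y] /=; rewrite CE/= in_itv/= -ler_norml.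
Qed.

End steiner.

(** * Boundary layers *)

Lemma mx_norm_ge_coord (R : realType) n (x : 'rV[R]_n) (i : 'I_n) : `|x 0 i| <= `|x|.
Proof.
rewrite [leRHS]mx_normrE.
exact: (@le_bigmax _ _ _ _ (fun i : 'I_1 * 'I_n => `|x i.1 i.2|) (0, i)).
Qed.

Section normals.
Context {R : realType} {n : nat}.
Implicit Types (D A : set 'rV[R]_n) (x y z c nu : 'rV[R]_n) (r s Rad : R).

Lemma boundary_eball c r z : 0 < r -> boundary (eball c r) z -> enorm (z - c) = r.
Proof.
move=> r0 [cl ni]; apply/eqP; rewrite eq_le; apply/andP; split.
  apply/ler_addgt0Pr => e e0.
  have [y yc yz] := (closure_eballP _ _).1 cl _ e0.
  have := enorm_triangle z y c; move: yc; rewrite /eball/= (enormB z y); lra.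
rewrite leNgt; apply/negP => zc; apply: ni.
have := @open_eball R n c r; rewrite openE; exact.
Qed.

Lemma disjoint_eball c1 c2 r s : 0 < r -> 0 < s ->
  (forall y, eball c1 r y -> eball c2 s y -> False) -> r + s <= enorm (c1 - c2).
Proof.
move=> r0 s0 H; rewrite leNgt; apply/negP => lt.
have rs : 0 < r + s by lra.
(* The point dividing the segment between the centres in the ratio r : s would lie in both balls. *)
apply: (H (c1 + (r / (r + s)) *: (c2 - c1))); rewrite /eball/=.
  rewrite addrC addKr enormZ enormB gtr0_norm ?divr_gt0// mulrAC ltr_pdivrMr//.
  by rewrite ltr_pM2l.
have -> : c1 + (r / (r + s)) *: (c2 - c1) - c2 = (s / (r + s)) *: (c1 - c2).
  by apply/rowP => i; rewrite !mxE; field; rewrite gt_eqF.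
rewrite enormZ gtr0_norm ?divr_gt0// mulrAC ltr_pdivrMr//.
by rewrite ltr_pM2l.
Qed.

(** [nu] is the inward unit normal at [z], described by the balls of radius [Rad] tangent there from
    inside and from outside. *)
Definition two_ball_normal D Rad z nu : Prop :=
  [/\ dot nu nu = 1, eball (z + Rad *: nu) Rad `<=` D &
      eball (z - Rad *: nu) Rad `<=` ~` D].

(** The two balls are disjoint, so their centres are at least 2 Rad apart, yet both are at distance
    Rad from z: z is the midpoint, and the normal points to the inner centre. *)
Lemma two_ball_normal_exists D Rad z : characteristic_radius D Rad ->
  boundary D z -> exists nu, two_ball_normal D Rad z nu.
Proof.
move=> [R0 H] /H [c1 [c2 [b1 b2 b12]]].
have b2' : eball c2 Rad `<=` ~` D.
  by move=> y /b2 ny Dy; apply: ny; exact: subset_closure.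
have [z1 z2] : (boundary (eball c1 Rad) `&` boundary (eball c2 Rad)) z by rewrite b12.
have {}z1 := boundary_eball R0 z1; have {}z2 := boundary_eball R0 z2.
have dd : Rad + Rad <= enorm (c1 - c2).
  by apply: disjoint_eball => // y /b1 Dy /b2'.
have E : z - c2 = c1 - z.
  have := @enorm_add_eq _ _ (c1 - z) (z - c2) Rad Rad R0 (ltW R0).
  rewrite divff ?scale1r ?gt_eqF// addrA subrK; apply => //.
  - by rewrite enormB z1.
  - by rewrite z2.
exists (Rad^-1 *: (c1 - z)); split.
- rewrite dotZl dotZr -sqr_enorm enormB z1 expr2.
  by field; rewrite gt_eqF.
- by rewrite scalerA divff ?gt_eqF// scale1r addrC subrK.
- rewrite scalerA divff ?gt_eqF// scale1r -E opprB addrC subrK; exact: b2'.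
Qed.

(** The inner ball at each point is disjoint from the outer ball at the other one. Adding the
    squares of the two bounds |z - z' +/- Rad (nu + nu')| >= 2 Rad cancels the mixed terms and
    leaves |z - z'|^2 >= 2 Rad^2 (1 - nu . nu'), which is Rad^2 |nu - nu'|^2. *)
Lemma normal_lipschitz D Rad z z' nu nu' : 0 < Rad ->
  two_ball_normal D Rad z nu -> two_ball_normal D Rad z' nu' ->
  Rad * enorm (nu - nu') <= enorm (z - z').
Proof.
move=> R0 [n1 i1 o1] [n2 i2 o2].
have A : Rad + Rad <= enorm (z + Rad *: nu - (z' - Rad *: nu')).
  by apply: disjoint_eball => // y /i1 Dy /o2.
have B : Rad + Rad <= enorm (z' + Rad *: nu' - (z - Rad *: nu)).
  by apply: disjoint_eball => // y /i2 Dy /o1.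
have {}A : (Rad + Rad) ^+ 2 <= enorm (z + Rad *: nu - (z' - Rad *: nu')) ^+ 2.
  by rewrite ler_sqr ?nnegrE ?enorm_ge0//; lra.
have {}B : (Rad + Rad) ^+ 2 <= enorm (z' + Rad *: nu' - (z - Rad *: nu)) ^+ 2.
  by rewrite ler_sqr ?nnegrE ?enorm_ge0//; lra.
rewrite -(ler_sqr) ?nnegrE ?mulr_ge0 ?enorm_ge0 ?(ltW R0)//.
move: A B; rewrite exprMn !sqr_enorm !dotE n1 n2.
rewrite (dotC z' z) (dotC nu z) (dotC nu' z) (dotC nu z') (dotC nu' z') (dotC nu' nu).
lra.
Qed.

(** [z] is the point of the segment with the smallest parameter outside D; this infimum is attained
    because D is open. *)
Lemma exit_segment D x y : open D -> D x -> ~ D y ->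
  exists2 z, boundary D z & enorm (x - z) <= enorm (x - y).
Proof.
move=> oD Dx nDy.
pose p t := x + t *: (y - x).
pose S := [set t : R | 0 <= t /\ ~ D (p t)].
have S1 : S 1 by split => //; rewrite /p scale1r addrC subrK.
have lS : lbound S 0 by move=> t [].
have hS : has_inf S by split; [exists 1|exists 0].
pose t0 := inf S.
have t00 : 0 <= t0 by apply: lb_le_inf => //; exists 1.
have t01 : t0 <= 1 by apply: ge_inf => //; exists 0.
have c0 : 0 < enorm (y - x) + 1 by rewrite ltr_wpDl ?enorm_ge0.
have pd s t : enorm (p s - p t) = `|s - t| * enorm (y - x).
  by rewrite /p opprD addrACA subrr add0r -scalerBl enormZ.
have nD0 : ~ D (p t0).
  move=> /((open_eballP D).1 oD)[e e0 eD].
  have [|t [t_0 nDt] tt0] := @inf_adherent R S (e / (enorm (y - x) + 1)) _ hS.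
    by rewrite divr_gt0.
  have t0t : t0 <= t by apply: ge_inf => //; exists 0.
  apply: nDt; apply: eD; rewrite /eball/= pd.
  rewrite ger0_norm ?subr_ge0//; move: tt0; rewrite -ltrBlDl ltr_pdivlMr//.
  by apply: le_lt_trans; rewrite ler_wpM2l ?subr_ge0// lerDl.
have Dt s : 0 <= s -> s < t0 -> D (p s).
  move=> s0 st; apply: contrapT => nDs; move: st; rewrite ltNge => /negP; apply.
  by apply: ge_inf => //; exists 0.
exists (p t0); last first.
  have -> : x = p 0 by rewrite /p scale0r addr0.
  rewrite pd sub0r normrN ger0_norm// (_ : p 0 - y = - (y - x)); last first.
    by rewrite /p scale0r addr0 opprB.
  by rewrite enormN ler_piMl// enorm_ge0.
split; last by move=> /interior_subset.
have t0p : 0 < t0.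
  rewrite lt_neqAle t00 andbT eq_sym; apply/eqP => E; apply: nD0.
  by rewrite E /p scale0r addr0.
apply/closure_eballP => e e0.
pose s := Num.max 0 (t0 - e / (enorm (y - x) + 1)).
have e1 : 0 < e / (enorm (y - x) + 1) by rewrite divr_gt0.
have s0 : 0 <= s by rewrite le_max lexx.
have st : s < t0 by rewrite gt_max t0p ltrBlDr ltrDl.
exists (p s); first exact: Dt.
rewrite pd ler0_norm ?subr_le0 ?ltW// opprB.
have H : t0 - s <= e / (enorm (y - x) + 1).
  by rewrite lerBlDr -lerBlDl le_max lexx orbT.
move: H; rewrite ler_pdivlMr//; apply: lt_le_trans.
by rewrite ltr_pM2l ?subr_gt0// ltrDl.
Qed.

Section boundary_distance.
Variables (D : set 'rV[R]_n) (Rad : R).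
Hypotheses (oD : open D) (bD : bounded_set D) (D0 : D !=set0) (n0 : (0 < n)%N).

Lemma boundary_nonempty : boundary D !=set0.
Proof.
have [x Dx] := D0; have [M [_ HM]] := bD.
pose y : 'rV[R]_n := const_mx (`|M| + 2).
have nDy : ~ D y.
  have Mlt : M < `|M| + 1 by have := ler_norm M; lra.
  move=> /(HM _ Mlt); apply/negP; rewrite -ltNge.
  apply: (@lt_le_trans _ _ (`|M| + 2)); first lra.
  apply: le_trans (mx_norm_ge_coord y (Ordinal n0)).
  by rewrite mxE; exact: ler_norm.
by have [z bz _] := exit_segment oD Dx nDy; exists z.
Qed.

Lemma boundary_dist_le x z : boundary D z -> boundary_dist D x <= enorm (x - z).
Proof.
move=> bz; apply: ge_inf; last by exists z.
by exists 0 => _ [y _ <-]; exact: enorm_ge0.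
Qed.

Lemma boundary_dist_lip x y : `|boundary_dist D x - boundary_dist D y| <= enorm (x - y).
Proof.
have H u v : boundary_dist D u <= boundary_dist D v + enorm (u - v).
  rewrite -lerBlDr; apply: lb_le_inf.
    by have [z bz] := boundary_nonempty; exists (enorm (v - z)); exists z.
  move=> _ [z bz <-]; rewrite lerBlDr; apply: le_trans (boundary_dist_le u bz) _.
  by rewrite [leRHS]addrC enorm_triangle.
have := H x y; have := H y x; rewrite (enormB y x) ler_norml.
by move=> ? ?; apply/andP; split; lra.
Qed.

Lemma boundary_dist_sub x y : D x -> enorm (x - y) < boundary_dist D x -> D y.
Proof.
move=> Dx xy; apply: contrapT => nDy.
have [z bz] := exit_segment oD Dx nDy; have := boundary_dist_le x bz; lra.
Qed.

Lemma boundary_dist_gt0 x : D x -> 0 < boundary_dist D x.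
Proof.
move=> Dx; have [e e0 eD] := (open_eballP D).1 oD x Dx.
apply: (lt_le_trans e0); apply: lb_le_inf.
  by have [z bz] := boundary_nonempty; exists (enorm (x - z)); exists z.
move=> _ [z [_ niz] <-]; rewrite leNgt; apply/negP => xz; apply: niz.
move: oD; rewrite openE; apply; apply: eD.
by rewrite /eball/= enormB.
Qed.

Lemma boundary_nearest x : exists2 z, boundary D z & enorm (x - z) = boundary_dist D x.
Proof.
have cb : compact (boundary D).
  apply: bounded_closed_compact.
    have [M [Mr HM]] := bD; exists (M + 1); split; first by rewrite num_real.
    move=> N MN z [cz _].
    have [y Dy yz] := (closure_eballP _ _).1 cz 1 ltr01.
    have N1 : M < N - 1 by lra.
    have /= := HM _ N1 y Dy; have := ler_normD y (z - y); rewrite addrC subrK.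
    have := mx_norm_le_enorm (z - y); rewrite (enormB z y); lra.
  by apply: closedI; [exact: closed_closure|apply: open_closedC; exact: open_interior].
have [|z] := EVT_min_rV boundary_nonempty cb (f := fun z => enorm (x - z)).
  apply: continuous_subspaceT => z.
  suff : (fun z => enorm (x - z)) @ z --> enorm (x - z) by [].
  apply/(@cvgrPdist_lt R R _ (nbhs z) _) => e e0.
  have : nbhs z (eball z e) by apply/nbhs_eballP; exists e.
  apply: filterS => y; rewrite /eball/=; apply: le_lt_trans.
  have := enorm_lipschitz (x - z) (x - y).
  by rewrite (_ : x - z - (x - y) = y - z)// opprB addrC addrA subrK.
move=> /set_mem bz zmin; exists z => //; apply/eqP; rewrite eq_le boundary_dist_le// andbT.
apply: lb_le_inf; first by exists (enorm (x - z)); exists z.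
by move=> _ [y by_ <-]; apply: zmin; exact: mem_set.
Qed.

(** The ball about x whose radius s is the distance to the boundary lies in D, hence misses the
    outer tangent ball at z. The centre of the latter is then at distance s + Rad from x, by a path
    through z: equality in the triangle inequality puts x on the normal. *)
Lemma nearest_normal x z nu : 0 < Rad -> D x -> boundary D z ->
  enorm (x - z) = boundary_dist D x -> two_ball_normal D Rad z nu ->
  x = z + boundary_dist D x *: nu.
Proof.
move=> R0 Dx bz xz [nu1 i1 o1]; set s := boundary_dist D x.
have s0 : 0 < s by exact: boundary_dist_gt0.
have H : s + Rad <= enorm (x - (z - Rad *: nu)).
  apply: disjoint_eball => // y; rewrite /eball/= enormB => yx /o1; apply.
  exact: boundary_dist_sub yx.
have E : Rad *: nu + (x - z) = x - (z - Rad *: nu) by rewrite opprB addrCA addrC.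
have en : enorm nu = 1 by rewrite /enorm nu1 sqrtr1.
have A : enorm (Rad *: nu) <= Rad by rewrite enormZ en mulr1 gtr0_norm.
have B : enorm (x - z) <= s by rewrite xz.
rewrite -E addrC in H.
by have := enorm_add_eq R0 (ltW s0) A B H; rewrite scalerA divfK ?gt_eqF// => <-; rewrite addrC subrK.
Qed.

End boundary_distance.

End normals.

(** * Volume of the layer near the boundary *)

Section layer.
Context {R : realType} {k : nat}.
Variables (D : set 'rV[R]_k.+1) (Rad : R).
Hypotheses (oD : open D) (bD : bounded_set D) (D0 : D !=set0).
Hypothesis cD : characteristic_radius D Rad.

Definition layer (u : R) : set (borel_rV k.+1) :=
  [set x | D x /\ boundary_dist D x <= u].

Lemma measurable_boundary_dist :
  measurable_fun setT (boundary_dist D : borel_rV k.+1 -> measurableTypeR R).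
Proof. by apply: lipschitz_measurable; exact: boundary_dist_lip. Qed.

Lemma measurable_layer u : measurable (layer u).
Proof.
apply: measurableI; first exact: open_measurable_rV.
by apply: closed_measurable_rV; apply: closed_enorm_le; exact: boundary_dist_lip.
Qed.

(** The collar over an arbitrary piece need not be measurable. Its closure is, and bounds on
    differences through a 1-Lipschitz function pass to it. *)
Lemma diff_closure (N : set 'rV[R]_k.+1) (f : 'rV[R]_k.+1 -> R) c :
  (forall x y, f x <= f y + enorm (x - y)) ->
  (forall x y, N x -> N y -> f (x - y) <= c) ->
  forall x y, closure N x -> closure N y -> f (x - y) <= c.
Proof.
move=> Lf H x y cx cy; apply/ler_addgt0Pr => e e0.
have e2 : 0 < e / 2 by lra.
have [x' Nx' xx'] := (closure_eballP _ _).1 cx _ e2.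
have [y' Ny' yy'] := (closure_eballP _ _).1 cy _ e2.
have := Lf (x - y) (x' - y'); have := H _ _ Nx' Ny'.
have := enormD (x - x') (y' - y).
rewrite (_ : x - x' + (y' - y) = x - y - (x' - y')); last first.
  by rewrite opprB addrACA [RHS]addrACA (addrC _ y') (addrC (- y)).
by rewrite (enormB x x'); lra.
Qed.

Definition collar (F : set 'rV[R]_k.+1) (u : R) : set 'rV[R]_k.+1 :=
  [set x | exists z s nu, [/\ F z, boundary D z, 0 <= s <= u,
      two_ball_normal D Rad z nu & x = z + s *: nu]].

(* Normals over a piece of diameter eta vary by at most eta / Rad, so the collar
   lies in a cylinder of height u + 2 eta whose base has diameter 2 eta. *)
Lemma lebesgue_collar (F : set 'rV[R]_k.+1) (u eta : R) : 0 <= u <= Rad / 2 -> 0 <= eta ->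
  (forall x y, F x -> F y -> enorm (x - y) <= eta) ->
  (lebesgue_rV (closure (collar F u) : set (borel_rV k.+1)) <=
   ((u + 2 * eta) * (@unit_ball_volume R k * eta ^+ k))%:E)%E.
Proof.
move=> /andP[u0 uR] eta0 Feta; have [R0 _] := cD.
have [E|/set0P[x0 [z0 [s0 [nu0 [Fz0 bz0 _ tb0 _]]]]]] := eqVneq (collar F u) set0.
  rewrite E closure0 measure0 lee_fin mulr_ge0//; first by lra.
  by rewrite mulr_ge0 ?exprn_ge0// ltW// unit_ball_volume_gt0.
have nu01 : dot nu0 nu0 = 1 by case: tb0.
have en0 : enorm nu0 = 1 by rewrite /enorm nu01 sqrtr1.
have dev z nu s : F z -> two_ball_normal D Rad z nu -> 0 <= s <= u ->
    enorm (s *: (nu - nu0)) <= eta / 2.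
  move=> Fz tb /andP[s_ge0 su]; rewrite enormZ ger0_norm//.
  have H := normal_lipschitz R0 tb tb0; have H2 := Feta _ _ Fz Fz0.
  have : s * enorm (nu - nu0) <= Rad / 2 * enorm (nu - nu0).
    by rewrite ler_wpM2r ?enorm_ge0//; lra.
  lra.
(* The displacement along the reference normal is at most u; the remaining part is eta from the base
   points plus eta / 2 from the tilt of each normal. *)
have main x y : collar F u x -> collar F u y -> exists w r,
    [/\ x - y = w + r *: nu0, enorm w <= 2 * eta & `|r| <= u].
  move=> [z [s [nu [Fz bz su tb ->]]]] [z' [s' [nu' [Fz' bz' su' tb' ->]]]].
  exists ((z - z') + (s *: (nu - nu0) - s' *: (nu' - nu0))), (s - s'); split.
  - by apply/rowP => i; rewrite !mxE; ring.
  - have A := dev _ _ _ Fz tb su; have B := dev _ _ _ Fz' tb' su'.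
    have C := Feta _ _ Fz Fz'.
    have := enormD (z - z') (s *: (nu - nu0) - s' *: (nu' - nu0)).
    have := enormD (s *: (nu - nu0)) (- (s' *: (nu' - nu0))).
    rewrite enormN; lra.
  - by rewrite ler_norml; move: su su' => /andP[? ?] /andP[? ?]; apply/andP; split; lra.
(* The height is u plus the contribution of w, up to 2 eta, as w need not be orthogonal to [nu0]. *)
rewrite (_ : (u + 2 * eta) = 2 * ((u + 2 * eta) / 2)); last by field.
have mc : measurable (closure (collar F u) : set (borel_rV k.+1)).
  by apply: closed_measurable_rV; exact: closed_closure.
apply: (lebesgue_rV_cylinder mc nu01) => //; first lra.
- move=> x y cx cy; rewrite [leRHS]mulrC divfK//.
  apply: (@diff_closure (collar F u) (fun w => `|dot w nu0|)) cx cy.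
    move=> w w'; have := abs_dot (w - w') nu0; rewrite en0 mulr1 dotBl.
    have := ler_normD (dot w' nu0) (dot w nu0 - dot w' nu0).
    by rewrite addrC subrK; lra.
  move=> x' y' /main H /H[w [r [-> ew er]]].
  rewrite dotDl dotZl nu01 mulr1; have := abs_dot w nu0; rewrite en0 mulr1.
  have := ler_normD (dot w nu0) r; lra.
- pose perp (w : 'rV[R]_k.+1) := w - dot w nu0 *: nu0.
  have perp_le w : enorm (perp w) <= enorm w.
    rewrite le_sqr_enorm ?enorm_ge0// sqr_enorm /perp !dotE nu01 (dotC nu0 w).
    have := sqr_ge0 (dot w nu0); rewrite expr2; lra.
  move=> x y; apply: (@diff_closure (collar F u) (fun w => enorm (perp w))).
    move=> w w'; have := perp_le (w - w'); have := enormD (perp w') (perp (w - w')).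
    rewrite (_ : perp w' + perp (w - w') = perp w); first lra.
    by rewrite /perp dotBl scalerBl; apply/rowP => i; rewrite !mxE; ring.
  move=> x' y' /main H /H[w [r [-> ew _]]].
  apply: le_trans ew; apply: le_trans (perp_le w).
  rewrite (_ : perp _ = perp w)// /perp dotDl dotZl nu01 mulr1.
  by apply/rowP => i; rewrite !mxE; ring.
Qed.

Lemma le_diam (F : set 'rV[R]_k.+1) (delta : R) :
  (forall x y, F x -> F y -> enorm (x - y) <= delta) -> 0 <= delta ->
  [/\ 0 <= diam F, diam F <= delta & forall x y, F x -> F y -> enorm (x - y) <= diam F].
Proof.
move=> H d0; have [->|/set0P[x Fx]] := eqVneq F set0.
  rewrite /diam (_ : [set enorm (p.1 - p.2) | p in set0 `*` set0] = set0) ?sup0//.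
  by apply/seteqP; split => // y [p []].
have ub y z : F y -> F z -> enorm (y - z) <= diam F.
  move=> Fy Fz; apply: ub_le_sup; last by exists (y, z).
  by exists delta => _ [p [? ?] <-]; exact: H.
split => //.
  by apply: le_trans (ub _ _ Fx Fx); exact: enorm_ge0.
apply: ge_sup; first by exists (enorm (x - x)); exists (x, x).
by move=> _ [p [? ?] <-]; exact: H.
Qed.

Lemma layer_sub_collar (F : nat -> set 'rV[R]_k.+1) u :
  boundary D `<=` \bigcup_i F i -> layer u `<=` \bigcup_i closure (collar (F i) u).
Proof.
move=> cover x [Dx xu]; have [R0 _] := cD.
have [z bz xz] := boundary_nearest oD bD D0 (ltn0Sn k) x.
have [nu tb] := two_ball_normal_exists cD bz.
have [i _ Fz] := cover _ bz; exists i => //; apply: subset_closure.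
exists z, (boundary_dist D x), nu; split => //.
  by rewrite -xz enorm_ge0 xz.
exact: (nearest_normal oD bD D0 (ltn0Sn k) R0 Dx bz xz tb).
Qed.

(** The collar estimate is summed over a cover by pieces of diameter at most delta. It has the
    factor (diam F)^k where the Hausdorff measure has (diam F / 2)^k, hence 2^k; the height u + 2
    delta tends to u with delta. *)
Lemma lebesgue_layer u : 0 < u <= Rad / 2 ->
  (lebesgue_rV (layer u) <= (2 ^+ k * u)%:E * surface_area D)%E.
Proof.
move=> /andP[u0 uR].
have main delta : 0 < delta ->
    (lebesgue_rV (layer u) <= (2 ^+ k * (u + 2 * delta))%:E * surface_area D)%E.
  move=> d0; set c := 2 ^+ k * (u + 2 * delta).
  have c0 : 0 < c by rewrite mulr_gt0 ?exprn_gt0//; lra.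
  rewrite -lee_pdivrMl//.
  rewrite /surface_area /hausdorff /=; set S := [set _ | _ in _].
  apply: (@le_trans _ _ (ereal_inf [set (\sum_(i <oo)
         (lebesgue_rV (eball (0%R : 'rV[R]_k) 1) * ((diam (F i) / 2) ^+ k)%:E))%E
      | F in small_covers delta (boundary D)])); last first.
    by apply: ereal_sup_ubound; exists delta.
  apply: le_ereal_inf_tmp => _ [F [cover Fd] <-].
  rewrite lee_pdivrMl//.
  have Fp i := le_diam (Fd i) (ltW d0).
  have mcl i : measurable (closure (collar (F i) u) : set (borel_rV k.+1)).
    by apply: closed_measurable_rV; exact: closed_closure.
  apply: (@le_trans _ _ (\sum_(i <oo) lebesgue_rV (closure (collar (F i) u) : set (borel_rV k.+1)))%E).
    by apply: (@measure_sigma_subadditive _ R _ (@lebesgue_rV R k.+1) (layer u)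
      (fun i => closure (collar (F i) u)) mcl (measurable_layer u) (layer_sub_collar cover)).
  rewrite -nneseriesZl; last first.
    move=> i _; have [? _ _] := Fp i; rewrite -unit_ball_volumeE -EFinM lee_fin.
    by rewrite mulr_ge0 ?exprn_ge0 ?divr_ge0// ltW// unit_ball_volume_gt0.
  apply: lee_nneseries => // i _; have [d_ge0 dd dF] := Fp i.
  apply: le_trans (@lebesgue_collar (F i) u (diam (F i)) _ d_ge0 dF) _; first by rewrite (ltW u0).
  rewrite -unit_ball_volumeE -!EFinM lee_fin /c.
  have -> : diam (F i) ^+ k = 2 ^+ k * (diam (F i) / 2) ^+ k.
    by rewrite expr_div_n mulrC divfK// expf_neq0.
  rewrite (_ : _ * (unit_ball_volume k * _) = (u + 2 * diam (F i)) * (2 ^+ k * (unit_ball_volume k * (diam (F i) / 2) ^+ k))); last by ring.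
  rewrite (_ : 2 ^+ k * _ * _ = (u + 2 * delta) * (2 ^+ k * (unit_ball_volume k * (diam (F i) / 2) ^+ k))); last by ring.
  apply: ler_wpM2r; last lra.
  by rewrite !mulr_ge0 ?exprn_ge0 ?divr_ge0// ltW// unit_ball_volume_gt0.
(* A negative value would make the measure of the layer negative in [main]. *)
have S0 : (0 <= surface_area D)%E.
  rewrite leNgt; apply/negP => Sneg.
  have := main 1 ltr01; apply/negP; rewrite -ltNge.
  apply: (@lt_le_trans _ _ 0%E) => //; rewrite mule_gt0_lt0//.
  by rewrite lte_fin mulr_gt0 ?exprn_gt0//; lra.
have cu : 0 < 2 ^+ k * u by rewrite mulr_gt0 ?exprn_gt0.
move: S0 main; case: (surface_area D) => [H||]//; last first.
  by move=> _ _; rewrite gt0_muley ?leey// lte_fin.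
rewrite lee_fin => H0 main.
apply/lee_addgt0Pr => e e0; rewrite -EFinM -EFinD.
(* With delta equal to e divided by this number, the excess 2^k * 2 delta * H is e H / (H + 1) <= e;
   the 1 covers H = 0. *)
have q0 : 0 < 2 ^+ k * 2 * (H + 1) by rewrite !mulr_gt0 ?exprn_gt0//; lra.
have := main (e / (2 ^+ k * 2 * (H + 1))) (divr_gt0 e0 q0); move=> /le_trans; apply.
rewrite -EFinM lee_fin mulrDr mulrDl lerD2l.
rewrite (_ : _ * H = e * (H / (H + 1))); last by field; rewrite expf_neq0//= gt_eqF//; lra.
by rewrite ler_piMr// ?(ltW e0)// ler_pdivrMr; lra.
Qed.

End layer.

(** * Moment generating functions *)

Section density.
Context d (T : measurableType d) (R : realType).
Variables (mu nu : {measure set T -> \bar R}) (p : T -> R).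
Hypotheses (mp : measurable_fun setT p) (p0 : forall x, 0 <= p x).
Hypothesis nuE : forall A, measurable A -> nu A = (\int[mu]_(x in A) (p x)%:E)%E.
Local Open Scope ereal_scope.
Import HBNNSimple.

Let integral_density_nnsfun (f : {nnsfun T >-> R}) :
  \int[nu]_x (f x)%:E = \int[mu]_x ((f x)%:E * (p x)%:E).
Proof.
under [LHS]eq_integral do rewrite fimfunE -fsumEFin//.
rewrite [LHS]ge0_integral_fsum//; last 2 first.
  - by move=> r; exact/measurable_EFinP/measurableT_comp.
  - by move=> n x _; rewrite EFinM nnfun_muleindic_ge0.
under [RHS]eq_integral.
  move=> x xD; rewrite fimfunE -fsumEFin// muleC ge0_mule_fsumr; last first.
    by move=> r; rewrite EFinM nnfun_muleindic_ge0.
  over.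
rewrite [RHS]ge0_integral_fsum//; last 2 first.
  - move=> r; apply/emeasurable_funM; first exact/measurable_EFinP.
    by apply/measurable_EFinP; do 2 apply/measurableT_comp => //.
  - move=> n x _; apply: mule_ge0; first by rewrite lee_fin.
    by rewrite EFinM nnfun_muleindic_ge0.
apply: eq_fsbigr => r _; rewrite integralZl_indic_nnsfun// integral_indic// setIT nuE//.
rewrite [RHS](eq_integral (fun x => r%:E * ((\1_(f @^-1` [set r]) x)%:E * (p x)%:E))); last first.
  by move=> x _; rewrite EFinM muleC muleA.
(* [f] is nonnegative, so a negative value has an empty fibre. *)
have [r0|r0] := leP 0%R r; last first.
  rewrite (_ : f @^-1` [set r] = set0).
    rewrite integral_set0 mule0 (eq_integral (cst 0)) ?integral0// => x _.
    by rewrite indicE in_set0 mul0e mule0.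
  apply/seteqP; split => // x /= fx; have h : (0 <= r)%R by rewrite -fx.
  by move: r0; rewrite ltNge h.
rewrite ge0_integralZl//; last 2 first.
  - by apply: emeasurable_funM => //; exact/measurable_EFinP.
  - by move=> x _; rewrite mule_ge0 ?lee_fin.
congr (_ * _); rewrite integral_mkcond; apply: eq_integral => x _.
by rewrite patchE indicE; case: ifP => _; rewrite ?mul1e ?mul0e.
Qed.

(** The change of measure d nu = p d mu, by monotone convergence from simple functions. *)
Lemma ge0_integral_density (f : T -> \bar R) :
  measurable_fun setT f -> (forall x, 0 <= f x) ->
  \int[nu]_x f x = \int[mu]_x (f x * (p x)%:E).
Proof.
move=> mf f0.
pose f_ := nnsfun_approx measurableT mf.
have cf x : (f_ n x)%:E @[n --> \oo] --> f x by exact: cvg_nnsfun_approx.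
transitivity (limn (fun n => \int[nu]_x (f_ n x)%:E)).
  rewrite -monotone_convergence//=.
  - by apply: eq_integral => x _; apply/esym/cvg_lim.
  - by move=> n; apply: measurableT_comp.
  - by move=> n x _; rewrite lee_fin.
  - by move=> x _ a b ab; rewrite lee_fin; exact/lefP/nd_nnsfun_approx.
transitivity (limn (fun n => \int[mu]_x ((f_ n x)%:E * (p x)%:E))).
  by congr (limn _); apply/funext => n; exact: integral_density_nnsfun.
rewrite -monotone_convergence//=.
- apply: eq_integral => x _; apply/cvg_lim => //.
  rewrite muleC; under eq_fun do rewrite muleC.
  exact: cvgeZl.
- by move=> n; apply: emeasurable_funM; apply: measurableT_comp.
- by move=> n x _; rewrite mule_ge0 ?lee_fin.
- move=> x _ a b ab; rewrite lee_wpmul2r ?lee_fin//.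
  exact/lefP/nd_nnsfun_approx.
Qed.

End density.

Section gaussian_mgf.
Context {R : realType}.

Lemma complete_square (m s a x : R) : s != 0 ->
  a * m + a ^+ 2 * s ^+ 2 / 2 + - (x - (m + a * s ^+ 2)) ^+ 2 / (s ^+ 2 *+ 2) =
  a * x + - (x - m) ^+ 2 / (s ^+ 2 *+ 2).
Proof. by move=> s0; field. Qed.

(** Completing the square turns e^(a x) times the density of mean m into a constant times the
    density of mean m + a s^2, which integrates to 1. *)
Lemma normal_mgf (m s a : R) : s != 0 ->
  (\int[normal_prob m s]_x (expR (a * x))%:E = (expR (a * m + a ^+ 2 * s ^+ 2 / 2))%:E)%E.
Proof.
move=> s0.
have mf : measurable_fun setT (fun x : measurableTypeR R => (expR (a * x))%:E).
  by apply/measurable_EFinP; apply: measurableT_comp => //; exact: measurable_funM.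
transitivity (\int[lebesgue_measure]_x ((expR (a * x))%:E * (normal_pdf m s x)%:E))%E.
  apply: (@ge0_integral_density _ _ _ lebesgue_measure (normal_prob m s) (normal_pdf m s)) => //.
  - exact: measurable_normal_pdf.
  - by move=> x; exact: normal_pdf_ge0.
transitivity ((expR (a * m + a ^+ 2 * s ^+ 2 / 2))%:E *
    \int[lebesgue_measure]_x (normal_pdf (m + a * s ^+ 2) s x)%:E)%E; last first.
  by rewrite integral_normal_pdf mule1.
have mpdf : measurable_fun setT (fun x : measurableTypeR R => (normal_pdf (m + a * s ^+ 2) s x)%:E).
  by apply/measurable_EFinP; exact: measurable_normal_pdf.
have pdf0 x : (0 <= (normal_pdf (m + a * s ^+ 2) s x)%:E)%E by rewrite lee_fin normal_pdf_ge0.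
have c0 : (0 <= (expR (a * m + a ^+ 2 * s ^+ 2 / 2))%:E)%E by rewrite lee_fin expR_ge0.
rewrite -(@ge0_integralZl _ _ _ lebesgue_measure setT measurableT _ mpdf _ (fun x _ => pdf0 x) c0).
apply: eq_integral => x _; rewrite -!EFinM !normal_pdfE//; congr (_%:E).
rewrite mulrCA [RHS]mulrCA; congr (_ * _).
by rewrite /normal_fun -!expRD complete_square.
Qed.

Lemma gaussian_integral dT (T : measurableType dT) (P : probability T R) (Y : T -> R) m s
    (f : R -> \bar R) :
  measurable_fun setT Y -> measurable_fun setT f -> (forall x, (0 <= f x)%E) ->
  (forall B : set (measurableTypeR R), measurable B -> P (Y @^-1` B) = gaussian m s B) ->
  (\int[P]_w f (Y w) = if (s == 0)%R then f m else \int[normal_prob m s]_x f x)%E.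
Proof.
move=> mY mf f0 H.
transitivity (\int[pushforward P (Y : T -> measurableTypeR R)]_y f y)%E.
  by rewrite ge0_integral_pushforward.
case: eqP => [s0|/eqP s0].
  rewrite (eq_measure_integral (dirac (m : measurableTypeR R))).
    by rewrite integral_dirac// diracT mul1e.
  by move=> A mA _; rewrite /= /pushforward H// /gaussian s0 eqxx.
apply: eq_measure_integral => A mA _.
by rewrite /= /pushforward H// /gaussian (negbTE s0).
Qed.

Lemma gaussian_mgf dT (T : measurableType dT) (P : probability T R) (Y : T -> R) m s a :
  measurable_fun setT Y ->
  (forall B : set (measurableTypeR R), measurable B -> P (Y @^-1` B) = gaussian m s B) ->
  (\int[P]_w (expR (a * Y w))%:E = (expR (a * m + a ^+ 2 * s ^+ 2 / 2))%:E)%E.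
Proof.
move=> mY H; rewrite (@gaussian_integral _ _ P Y m s (fun x => (expR (a * x))%:E))//.
  case: eqP => [->|/eqP s0]; last exact: normal_mgf.
  by rewrite expr0n mulr0 mul0r addr0.
by apply/measurable_EFinP; apply: measurableT_comp => //; exact: measurable_funM.
Qed.

End gaussian_mgf.

(** * Functions whose expectation the moment generating function determines *)

Section exponential_class.
Context {R : realType}.

(* For u in this class, the expectation of u (X) is determined by the moment
   generating function of X. *)
Inductive exp_class : (R -> R) -> Prop :=
| exp_class_exp a : exp_class (fun x => expR (a * x))
| exp_class_lin a u v : exp_class u -> exp_class v ->
    exp_class (fun x => a * u x + v x)
| exp_class_lim (u_ : nat -> R -> R) u C :
    (forall n, exp_class (u_ n)) -> 0 <= C ->
    (forall n x, `|u_ n x| <= C * expR (C * `|x|)) ->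
    (forall x, u_ n x @[n --> \oo] --> u x) -> exp_class u.

Lemma exp_class_ext u v : exp_class u -> u =1 v -> exp_class v.
Proof. by move=> + /funext <-. Qed.

Lemma exp_class_bound u : exp_class u ->
  exists2 C, 0 <= C & forall x, `|u x| <= C * expR (C * `|x|).
Proof.
elim=> [a|a {}u v _ [C C0 uC] _ [E E0 vE]|u_ {}u C _ _ C0 uC uu].
- exists (1 + `|a|); first by rewrite addr_ge0.
  move=> x; rewrite ger0_norm ?expR_ge0//.
  have H : expR (a * x) <= expR ((1 + `|a|) * `|x|).
    rewrite ler_expR; apply: le_trans (ler_norm _) _; rewrite normrM ler_wpM2r// lerDr//.
  apply: le_trans H _; rewrite ler_peMl ?expR_ge0//; have := normr_ge0 a; lra.
- have C1 : C <= `|a| * C + C + E by have := mulr_ge0 (normr_ge0 a) C0; lra.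
  have E1 : E <= `|a| * C + C + E by have := mulr_ge0 (normr_ge0 a) C0; lra.
  exists (`|a| * C + C + E) => [|x].
    by rewrite !addr_ge0// mulr_ge0.
  apply: le_trans (ler_normD _ _) _; rewrite normrM.
  set e := expR (_ * `|x|).
  have ue : `|u x| <= C * e.
    by apply: le_trans (uC x) _; rewrite ler_wpM2l// ler_expR ler_wpM2r.
  have ve : `|v x| <= E * e.
    by apply: le_trans (vE x) _; rewrite ler_wpM2l// ler_expR ler_wpM2r.
  have e0 : 0 <= e by exact: expR_ge0.
  have := ler_wpM2l (normr_ge0 a) ue; have := mulr_ge0 C0 e0; lra.
- exists C => // x.
  have H : `|u_ n x| @[n --> \oo] --> `|u x| by apply: cvg_norm; exact: uu.
  rewrite -(cvg_lim (@Rhausdorff R) H); apply: limr_le; first by apply/cvg_ex; eexists; exact: H.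
  by apply: nearW => n; exact: uC.
Qed.

Lemma measurable_exp_class u : exp_class u -> measurable_fun setT u.
Proof.
elim=> [a|a {}u v _ mu _ mv|u_ {}u C _ mu _ _ uu].
- by apply: measurableT_comp => //; exact: measurable_funM.
- by apply: measurable_funD => //; apply: measurable_funM.
- by apply: (measurable_fun_cvg (h := u_)) => // x _; exact: uu.
Qed.

Lemma exp_class0 : exp_class (fun=> 0).
Proof.
apply: (@exp_class_ext (fun x => (-1) * expR (0 * x) + expR (0 * x))).
  by apply: exp_class_lin; exact: exp_class_exp.
by move=> x; rewrite mulN1r addNr.
Qed.

Lemma exp_class_cst c : exp_class (fun=> c).
Proof.
apply: (@exp_class_ext (fun x => c * expR (0 * x) + 0)).
  by apply: exp_class_lin; [exact: exp_class_exp|exact: exp_class0].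
by move=> x; rewrite mul0r expR0 mulr1 addr0.
Qed.

Lemma exp_classZ a u : exp_class u -> exp_class (fun x => a * u x).
Proof.
move=> cu; apply: (exp_class_ext (exp_class_lin a cu exp_class0)).
by move=> x; rewrite addr0.
Qed.

Lemma exp_classD u v : exp_class u -> exp_class v -> exp_class (fun x => u x + v x).
Proof.
move=> cu cv; apply: (exp_class_ext (exp_class_lin 1 cu cv)).
by move=> x; rewrite mul1r.
Qed.

Lemma exp_classB u v : exp_class u -> exp_class v -> exp_class (fun x => u x - v x).
Proof.
move=> cu cv; apply: (exp_class_ext (exp_class_lin (-1) cv cu)).
by move=> x; rewrite mulN1r addrC.
Qed.

(** One constant serves both as factor and in the exponent; C E + C + E dominates the product C E of
    the factors and the sum C + E of the exponents. *)
Lemma norm_mul_exp_le (C E y z x : R) : 0 <= C -> 0 <= E ->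
  `|y| <= C * expR (C * `|x|) -> `|z| <= E * expR (E * `|x|) ->
  `|y * z| <= (C * E + C + E) * expR ((C * E + C + E) * `|x|).
Proof.
move=> C0 E0 yC zE; rewrite normrM.
apply: (@le_trans _ _ ((C * expR (C * `|x|)) * (E * expR (E * `|x|)))).
  exact: ler_pM.
rewrite mulrACA -expRD -mulrDl; have CE := mulr_ge0 C0 E0.
apply: ler_pM; rewrite ?expR_ge0//; first lra.
by rewrite ler_expR ler_wpM2r//; lra.
Qed.

(** Induction on both derivations: exponentials multiply to exponentials, and limits stay dominated
    because the other factor has an exponential bound of its own. *)
Lemma exp_classM u v : exp_class u -> exp_class v -> exp_class (fun x => u x * v x).
Proof.
move=> cu cv; elim: cu => [a|a {}u w _ IHu _ IHw|u_ {}u C cu_ IH C0 uC uu].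
- elim: cv => [b|b {}v w _ IHv _ IHw|v_ {}v C cv_ IH C0 vC vv].
  + apply: (exp_class_ext (exp_class_exp (a + b))) => x.
    by rewrite -expRD mulrDl.
  + apply: (exp_class_ext (exp_class_lin b IHv IHw)) => x; ring.
  + have [E E0 uE] := exp_class_bound (exp_class_exp a).
    apply: (@exp_class_lim _ _ (E * C + E + C) IH).
    * by rewrite !addr_ge0// mulr_ge0.
    * by move=> n x; exact: norm_mul_exp_le.
    * by move=> x; apply: cvgM; [exact: cvg_cst|exact: vv].
- by apply: (exp_class_ext (exp_class_lin a IHu IHw)) => x; ring.
- have [E E0 vE] := exp_class_bound cv.
  apply: (@exp_class_lim _ _ (C * E + C + E) IH).
  + by rewrite !addr_ge0// mulr_ge0.
  + by move=> n x; exact: norm_mul_exp_le.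
  + by move=> x; apply: cvgM; [exact: uu|exact: cvg_cst].
Qed.

Lemma exp_classX u n : exp_class u -> exp_class (fun x => u x ^+ n).
Proof.
move=> cu; elim: n => [|n IH]; first exact: exp_class_cst.
by apply: (exp_class_ext (exp_classM cu IH)) => x; rewrite exprS.
Qed.

Lemma exp_class_sum (u_ : nat -> R -> R) n : (forall i, exp_class (u_ i)) ->
  exp_class (fun x => \sum_(0 <= i < n) u_ i x).
Proof.
move=> cu; elim: n => [|n IH].
  by apply: (exp_class_ext exp_class0) => x; rewrite big_nil.
by apply: (exp_class_ext (exp_classD IH (cu n))) => x; rewrite big_nat_recr.
Qed.

Lemma expR_sub1_le (y : R) : `|expR y - 1| <= `|y| * expR `|y|.
Proof.
have [y0|y0] := leP 0 y.
  rewrite ger0_norm ?subr_ge0 -?expR0 ?ler_expR// expR0 ger0_norm//.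
  have := expR_ge1Dx (- y); rewrite expRN => H.
  have e0 := expR_gt0 y.
  have : (1 - y) * expR y <= 1 by rewrite -ler_pdivlMr// mul1r.
  lra.
rewrite ler0_norm ?subr_le0 -?expR0 ?ler_expR ?(ltW y0)// expR0 (ltr0_norm y0).
have := expR_ge1Dx y => H.
have H1 : 1 <= expR (- y) by rewrite -expR0 ler_expR; lra.
have : - y <= - y * expR (- y) by rewrite ler_peMr//; lra.
lra.
Qed.

Lemma expR_taylor1 (y : R) : `|expR y - 1 - y| <= y ^+ 2 * expR `|y|.
Proof.
have H1 : 0 <= expR y - 1 - y by have := expR_ge1Dx y; lra.
rewrite ger0_norm//; have e0 := expR_gt0 y.
have H2 : (1 - y) * expR y <= 1.
  by rewrite -ler_pdivlMr// mul1r -expRN; exact: expR_ge1Dx.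
have [y0|y0] := leP 0 y; first by rewrite ger0_norm//; nra.
have H3 : 1 <= expR `|y| by rewrite -expR0 ler_expR.
apply: (@le_trans _ _ (y ^+ 2)); first nra.
by rewrite ler_peMr// sqr_ge0.
Qed.

(** The limit of the difference quotients (e^(h x) - 1) / h with h = 1 / (n + 1). Together with
    [exp_classM] it puts all polynomials in the class. *)
Lemma exp_class_id : exp_class id.
Proof.
pose h (n : nat) : R := n.+1%:R^-1.
have h0 n : 0 < h n by rewrite invr_gt0.
have h1 n : h n <= 1 by rewrite invf_le1// ler1n.
apply: (@exp_class_lim (fun n x => (h n)^-1 * (expR (h n * x) - 1)) _ 2).
- by move=> n; apply/exp_classZ/exp_classB; [exact: exp_class_exp|exact: exp_class_cst].
- by [].
- move=> n x; rewrite normrM gtr0_norm ?invr_gt0// mulrC ler_pdivrMr//.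
  apply: le_trans (expR_sub1_le _) _.
  rewrite normrM (gtr0_norm (h0 n)) -mulrA mulrC; apply: ler_wpM2r; first exact: ltW.
  apply: (@le_trans _ _ (expR `|x| * expR `|x|)).
    apply: ler_pM; rewrite ?expR_ge0//.
      by have := expR_ge1Dx `|x|; lra.
    by rewrite ler_expR ler_piMl.
  rewrite -expRD (_ : `|x| + `|x| = 2 * `|x|); last by ring.
  by rewrite ler_peMl ?expR_ge0// ler1n.
- move=> x; apply/cvgrPdist_le => e e0.
  have c0 : 0 < x ^+ 2 * expR `|x| + 1 by rewrite ltr_wpDl// mulr_ge0 ?sqr_ge0 ?expR_ge0.
  near=> n.
  have hn : h n * (x ^+ 2 * expR `|x| + 1) <= e.
    rewrite -ler_pdivlMr//; near: n.
    by have /cvgrPdist_le/(_ _ (divr_gt0 e0 c0)) := @cvg_harmonic R; apply: filterS => n;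
      rewrite sub0r normrN ger0_norm// invr_ge0.
  have -> : id x - (h n)^-1 * (expR (h n * x) - 1) = - ((h n)^-1 * (expR (h n * x) - 1 - h n * x)).
    by field; rewrite gt_eqF.
  rewrite normrN normrM gtr0_norm ?invr_gt0// mulrC ler_pdivrMr//.
  apply: le_trans (expR_taylor1 _) _.
  rewrite exprMn normrM (gtr0_norm (h0 n)).
  have : expR (h n * `|x|) <= expR `|x| by rewrite ler_expR ler_piMl.
  have p1 : 0 <= h n ^+ 2 * x ^+ 2 by rewrite mulr_ge0 ?sqr_ge0.
  move=> /(ler_wpM2l p1)/le_trans; apply.
  have := ltW (h0 n); move: hn; rewrite expr2; nra.
Unshelve. all: by end_near.
Qed.

Lemma exp_class_scale u c : exp_class u -> exp_class (fun x => u (c * x)).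
Proof.
elim=> [a|a {}u v _ IHu _ IHv|u_ {}u C _ IH C0 uC uu].
- apply: (exp_class_ext (exp_class_exp (a * c))) => x.
  by rewrite mulrA.
- exact: exp_class_lin.
- have Cc := mulr_ge0 C0 (normr_ge0 c).
  apply: (@exp_class_lim _ _ (C + C * `|c|) IH).
  + by rewrite addr_ge0.
  + move=> n x; apply: le_trans (uC n _) _; apply: ler_pM; rewrite ?expR_ge0//; first lra.
    by rewrite ler_expR normrM mulrA ler_wpM2r//; lra.
  + by move=> x; exact: uu.
Qed.

(** The partial sums of the series are polynomials dominated by e^|x|. The sine is the bounded
    function whose sign later yields indicators. *)
Lemma exp_class_sin : exp_class (@sin R).
Proof.
apply: (@exp_class_lim (fun n x => series (sin_coeff x) n) _ 1) => //.
- move=> n; apply: exp_class_sum => i.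
  apply: (exp_class_ext (exp_classZ ((odd i)%:R * (-1) ^+ i.-1./2 / i`!%:R) (exp_classX i exp_class_id))).
  by move=> x; rewrite /sin_coeff/=; ring.
- move=> n x; rewrite !mul1r; apply: le_trans (ler_norm_sum _ _ _) _.
  apply: (@le_trans _ _ (series (exp_coeff `|x|) n)).
    apply: ler_sum => i _; rewrite /sin_coeff /exp_coeff/= !normrM normrX normrX normrN1 expr1n mulr1.
    rewrite normfV (normr_nat _ i`!) normr_nat ler_wpM2r ?invr_ge0//.
    by rewrite ler_piMl ?exprn_ge0// lern1 leq_b1.
  rewrite /expR; apply: nondecreasing_cvgn_le; last exact: is_cvg_series_exp_coeff.
  by apply: nondecreasing_series => i _ _; exact: exp_coeff_ge0.
- by move=> x; rewrite sin.unlock; exact: is_cvg_series_sin_coeff.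
Qed.

(* Visser's iteration: for |y| <= 1 it increases to |y|, which makes |u| a limit
   of polynomials in u. *)
Fixpoint visser (y : R) n : R :=
  if n is m.+1 then visser y m + (y ^+ 2 - visser y m ^+ 2) / 2 else 0.

Lemma visser_bounds y n : `|y| <= 1 ->
  0 <= visser y n <= `|y| /\ `|y| - visser y n <= `|y| * (1 - `|y| / 2) ^+ n.
Proof.
move=> y1; elim: n => [|n [/andP[IH0 IH1] IH2]]; first by rewrite /= lexx normr_ge0 subr0 expr0 mulr1.
(* The identity behind the iteration: each step multiplies the error by a factor between 0 and 1 -
   |y| / 2. *)
have E : `|y| - visser y n.+1 = (`|y| - visser y n) * (1 - (`|y| + visser y n) / 2).
  by rewrite /= -(real_normK (num_real y)); field.
have H0 : 0 <= `|y| - visser y n by lra.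
have H1 : 0 <= 1 - (`|y| + visser y n) / 2 by lra.
have H : 0 <= `|y| - visser y n.+1 by rewrite E mulr_ge0.
split; last first.
  rewrite E exprSr mulrA; apply: ler_pM => //; lra.
apply/andP; split; last lra.
rewrite /= -(real_normK (num_real y)); nra.
Qed.

Lemma exp_class_abs u : exp_class u -> (forall x, `|u x| <= 1) -> exp_class (fun x => `|u x|).
Proof.
move=> cu u1.
have cv n : exp_class (fun x => visser (u x) n).
  elim: n => [|n IH]; first exact: exp_class_cst.
  apply: (exp_class_ext (exp_classD IH (exp_classZ 2^-1 (exp_classB (exp_classX 2 cu) (exp_classX 2 IH))))).
  by move=> x /=; rewrite [2^-1 * _]mulrC.
apply: (@exp_class_lim _ _ 1 cv) => //.
  move=> n x; have [/andP[v0 vu] _] := visser_bounds n (u1 x).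
  rewrite mul1r mul1r ger0_norm//; apply: le_trans (le_trans vu (u1 x)) _.
  by rewrite -expR0 ler_expR.
move=> x; have [->|ux0] := eqVneq (u x) 0.
  have E n : visser 0 n = 0 by elim: n => [//|n IH] /=; rewrite IH expr0n subrr mul0r addr0.
  by under eq_fun do rewrite E; rewrite normr0; exact: cvg_cst.
have up : 0 < `|u x| by rewrite normr_gt0.
have H : `|u x| * (1 - `|u x| / 2) ^+ n @[n --> \oo] --> 0.
  rewrite -[0](mulr0 `|u x|); apply: cvgM; first exact: cvg_cst.
  apply: cvg_expr; have := u1 x => ?.
  by rewrite ger0_norm; lra.
apply/cvgrPdist_le => e e0; move/cvgrPdist_le : H => /(_ e e0).
apply: filterS => n; have [/andP[v0 vu] vb] := visser_bounds n (u1 x).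
rewrite sub0r normrN => H; rewrite ger0_norm ?subr_ge0//; apply: le_trans vb _.
by apply: le_trans (ler_norm _) H.
Qed.

Lemma exp_class_bounded_lim (u_ : nat -> R -> R) u :
  (forall n, exp_class (u_ n)) -> (forall n x, `|u_ n x| <= 1) ->
  (forall x, u_ n x @[n --> \oo] --> u x) -> exp_class u.
Proof.
move=> cu u1 uu; apply: (@exp_class_lim u_ u 1) => // n x.
rewrite !mul1r; apply: le_trans (u1 n x) _.
by rewrite -expR0 ler_expR.
Qed.

(** With p the positive part of u, which lies in [0, 1], the functions 1 - (1 - p)^n tend to the
    indicator of p > 0. *)
Lemma exp_class_pos u : exp_class u -> (forall x, `|u x| <= 1) ->
  exp_class (fun x => (0 < u x)%R%:R : R).
Proof.
move=> cu u1.
pose p x := 2^-1 * (u x + `|u x|).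
have cp : exp_class p by apply/exp_classZ/exp_classD => //; exact: exp_class_abs.
have p01 x : 0 <= p x <= 1.
  by rewrite /p; have := u1 x; rewrite ler_norml; case: (ger0P (u x)) => ? /andP[? ?]; apply/andP; split; lra.
apply: (@exp_class_bounded_lim (fun n x => 1 - (1 - p x) ^+ n)).
- move=> n; apply: exp_classB; first exact: exp_class_cst.
  by apply/exp_classX/exp_classB => //; exact: exp_class_cst.
- move=> n x; have /andP[p0 p1] := p01 x.
  have q0 : 0 <= (1 - p x) ^+ n by rewrite exprn_ge0//; lra.
  have q1 : (1 - p x) ^+ n <= 1 by rewrite exprn_ile1//; lra.
  by rewrite ger0_norm; lra.
- move=> x; have /andP[p0 p1] := p01 x; case: (ltP 0 (u x)) => ux.
    have px : p x = u x by rewrite /p gtr0_norm//; field.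
    rewrite -[X in _ --> X]subr0; apply: cvgB; first exact: cvg_cst.
    by apply: cvg_expr; rewrite ger0_norm; rewrite px in p1 *; lra.
  have -> : p x = 0 by rewrite /p ler0_norm// subrr mulr0.
  by rewrite subr0; under eq_fun do rewrite expr1n subrr; exact: cvg_cst.
Qed.

Lemma exp_class_shift u b : exp_class u -> exp_class (fun x => u (x - b)).
Proof.
elim=> [a|a {}u v _ IHu _ IHv|u_ {}u C _ IH C0 uC uu].
- apply: (exp_class_ext (exp_classZ (expR (- a * b)) (exp_class_exp a))) => x.
  by rewrite -expRD; congr expR; ring.
- exact: exp_class_lin.
- apply: (@exp_class_lim _ _ (C * expR (C * `|b|)) IH).
  + by rewrite mulr_ge0 ?expR_ge0.
  + move=> n x; apply: le_trans (uC n _) _; rewrite -mulrA; apply: ler_wpM2l => //.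
    rewrite -expRD ler_expR.
    have : C * `|x - b| <= C * `|b| + C * `|x|.
      by rewrite -mulrDr ler_wpM2l// [leRHS]addrC ler_normB.
    move=> /le_trans; apply; rewrite lerD2l.
    apply: ler_wpM2r => //; rewrite ler_peMr// -expR0 ler_expR mulr_ge0//.
  + by move=> x; exact: uu.
Qed.

(** As soon as |x| / (n + 1) < pi, sin (x / (n + 1)) has the sign of x. The sine stands in for x
    because [exp_class_pos] asks for a bounded function. *)
Lemma exp_class_gt b : exp_class (fun x : R => (b < x)%R%:R : R).
Proof.
have c0 : exp_class (fun x : R => (0 < x)%R%:R : R).
  apply: (@exp_class_bounded_lim (fun n x => (0 < sin (n.+1%:R^-1 * x))%R%:R)).
  - move=> n; apply: (exp_class_pos (u := fun x => sin (n.+1%:R^-1 * x))).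
      exact: exp_class_scale exp_class_sin.
    by move=> x; rewrite ler_norml sin_geN1 sin_le1.
  - by move=> n x; case: ltP; rewrite ?normr1 ?normr0.
  - move=> x; apply: cvg_near_cst; near=> n.
    have nx : n.+1%:R^-1 * `|x| < pi.
      rewrite mulrC ltr_pdivrMr// mulrC -ltr_pdivrMr ?pi_gt0//.
      near: n; exists (Num.truncn (`|x| / pi)) => // n /= xn.
      by apply: lt_le_trans (truncnS_gt _) _; rewrite ler_nat ltnS.
    have n0 : 0 < n.+1%:R^-1 :> R by rewrite invr_gt0.
    have [x0|x0] := ltP 0 x.
      rewrite (_ : (0 < sin _) = true)//; apply: sin_gt0_pi.
      by rewrite mulr_gt0//=; move: nx; rewrite gtr0_norm.
    rewrite ltNge (_ : (_ <= 0) = true)//.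
    rewrite -oppr_ge0 -sinN -mulrN sin_ge0_pi//.
    rewrite mulr_ge0 ?oppr_ge0 ?(ltW n0)//=.
    by move: nx; rewrite ler0_norm// => /ltW.
apply: (exp_class_ext (exp_class_shift b c0)) => x.
by rewrite subr_gt0.
Unshelve. all: by end_near.
Qed.

End exponential_class.

Section l1_norm.
Context {R : realType} {k : nat}.

Definition l1 (x : 'rV[R]_k) : R := \sum_i `|x 0 i|.

Lemma l1_ge0 (x : 'rV[R]_k) : 0 <= l1 x. Proof. exact: sumr_ge0. Qed.

Lemma coord_le_l1 (x : 'rV[R]_k) i : `|x 0 i| <= l1 x.
Proof. by rewrite /l1 (bigD1 i)//= lerDl sumr_ge0. Qed.

Lemma measurable_l1 : measurable_fun setT (l1 : borel_rV k -> R).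
Proof.
by apply: measurable_sum => i; apply: measurableT_comp => //; exact: measurable_coord.
Qed.

(** l1 x is at most k times the largest |x_i|, and e^|y| <= e^y + e^(-y). Finiteness of the moment
    generating function thus gives all exponential moments of the l1 norm. The leading 1 takes care
    of x = 0. *)
Lemma expR_l1_le a (x : 'rV[R]_k) : 0 <= a ->
  expR (a * l1 x) <= 1 + \sum_i (expR (dot ((a * k%:R) *: delta_mx 0 i) x) +
                                 expR (dot ((- (a * k%:R)) *: delta_mx 0 i) x)).
Proof.
move=> a0.
have s0 (y : 'rV[R]_k) (P : pred 'I_k) : 0 <= \sum_(i | P i)
    (expR (dot ((a * k%:R) *: delta_mx 0 i) y) + expR (dot ((- (a * k%:R)) *: delta_mx 0 i) y)).
  by apply: sumr_ge0 => i _; rewrite addr_ge0 ?expR_ge0.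
have [->|x0] := eqVneq x 0.
  rewrite (_ : l1 0 = 0) ?mulr0 ?expR0 ?lerDl; first exact: s0.
  by rewrite /l1 big1// => i _; rewrite mxE normr0.
have /mx_norm_neq0[[i0 i] /=] : mx_norm x != 0.
  by apply: contra x0 => /eqP/mx_norm_eq0 ->.
rewrite ord1 => xi.
have l1le : l1 x <= k%:R * `|x 0 i|.
  rewrite /l1 mulr_natl -[k in _ *+ k]card_ord -sumr_const.
  apply: ler_sum => j _; rewrite -xi; exact: mx_norm_ge_coord.
apply: ler_wpDl => //; rewrite (bigD1 i)//=.
apply: ler_wpDr => //; rewrite !dotZl !(dotC _ x) !dot_delta.
have H : a * l1 x <= a * k%:R * `|x 0 i| by rewrite -mulrA ler_wpM2l.
have [xi0|xi0] := leP 0 (x 0 i).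
  apply: ler_wpDr; first exact: expR_ge0.
  by rewrite ler_expR; move: H; rewrite ger0_norm.
apply: ler_wpDl; first exact: expR_ge0.
by rewrite ler_expR mulNr -mulrN; move: H; rewrite ltr0_norm.
Qed.

End l1_norm.

Section exp_moments.
Context {R : realType} {k : nat} {d} {T : measurableType d}.
Variables (P : probability T R) (X : T -> borel_rV (R:=R) k).
Hypothesis mX : measurable_fun setT X.
Hypothesis mgf_fin : forall c : 'rV[R]_k, (\int[P]_w (expR (dot c (X w)))%:E < +oo)%E.

Lemma measurable_expR_dot (c : 'rV[R]_k) : measurable_fun setT (fun w => expR (dot c (X w))).
Proof.
apply: measurableT_comp => //; apply: measurable_sum => i.
by apply: measurable_funM => //; exact: measurableT_comp (measurable_coord i) mX.
Qed.

Lemma integrable_expR_dot (c : 'rV[R]_k) :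
  P.-integrable setT (fun w => (expR (dot c (X w)))%:E).
Proof.
apply/integrableP; split; first exact/measurable_EFinP/measurable_expR_dot.
by under eq_integral do rewrite gee0_abs ?lee_fin ?expR_ge0//.
Qed.

Lemma integrable_exp_l1 (f : T -> R) C : measurable_fun setT f -> 0 <= C ->
  (forall w, `|f w| <= C * expR (C * l1 (X w))) -> P.-integrable setT (EFin \o f).
Proof.
move=> mf C0 fC.
pose g w : R := C * (1 + \sum_i (expR (dot ((C * k%:R) *: delta_mx 0 i) (X w)) +
                                 expR (dot ((- (C * k%:R)) *: delta_mx 0 i) (X w)))).
apply: (@le_integrable _ _ _ P setT measurableT _ (EFin \o g)).
- exact/measurable_EFinP.
- move=> w _ /=; rewrite lee_fin; apply: le_trans (fC w) _.
  apply: le_trans (ler_norm _); rewrite /g ler_wpM2l//; exact: expR_l1_le.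
rewrite (_ : EFin \o g = (fun w => (C%:E * (1 + \sum_(i < k)
    ((expR (dot ((C * k%:R) *: delta_mx 0%R i) (X w)))%:E +
     (expR (dot ((- (C * k%:R)) *: delta_mx 0%R i) (X w)))%:E)))%E)); last first.
  by apply/funext => w; rewrite /g/= EFinM EFinD -sumEFin.
apply: integrableZl => //; apply: integrableD => //.
  exact: finite_measure_integrable_cst.
apply: integrable_sum => // i _; apply: integrableD => //; exact: integrable_expR_dot.
Qed.

Definition cylinder_fun (u : 'I_k -> R -> R) (w : T) : R := \prod_i u i (X w 0 i).

Lemma measurable_cylinder_fun u : (forall i, exp_class (u i)) ->
  measurable_fun setT (cylinder_fun u).
Proof.
move=> cu; apply: measurable_prod => i _.
apply: measurableT_comp; first exact: measurable_exp_class.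
exact: measurableT_comp (measurable_coord i) mX.
Qed.

(** The constant depends on the bounds [Cs] alone and not on the functions [v]: dominated
    convergence requires this uniformity. *)
Lemma prod_exp_bound (s : seq 'I_k) (u : 'I_k -> R -> R) (Cs : 'I_k -> R) :
  (forall i, 0 <= Cs i) -> exists2 C, 0 <= C &
  forall v : 'I_k -> R -> R, (forall i x, `|v i x| <= Cs i * expR (Cs i * `|x|)) ->
    forall x : 'rV[R]_k, `|\prod_(i <- s) v i (x 0 i)| <= C * expR (C * l1 x).
Proof.
move=> Cs0; elim: s => [|i s [C C0 H]].
  exists 1 => // v _ x; rewrite big_nil normr1 !mul1r -expR0 ler_expR; exact: l1_ge0.
exists (Cs i * C + Cs i + C); first by rewrite !addr_ge0// mulr_ge0.
move=> v vC x; rewrite big_cons -[l1 x in leRHS]ger0_norm ?l1_ge0//.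
apply: norm_mul_exp_le => //; last by rewrite (ger0_norm (l1_ge0 x)); exact: H.
apply: le_trans (vC _ _) _; apply: ler_wpM2l => //; rewrite ler_expR ler_wpM2l//.
by rewrite (ger0_norm (l1_ge0 x)) coord_le_l1.
Qed.

Lemma integrable_cylinder_fun u : (forall i, exp_class (u i)) ->
  P.-integrable setT (EFin \o cylinder_fun u).
Proof.
move=> cu; have H i := exp_class_bound (cu i).
pose Cs i := projT1 (cid2 (H i)).
have Cs0 i : 0 <= Cs i by rewrite /Cs; case: (cid2 _).
have [C C0 uC] := prod_exp_bound (index_enum 'I_k) u Cs0.
apply: (integrable_exp_l1 (measurable_cylinder_fun cu) C0) => w.
by apply: uC => i x; rewrite /Cs; case: (cid2 _).
Qed.

Definition set_fun (u : 'I_k -> R -> R) (j : 'I_k) (v : R -> R) (i : 'I_k) : R -> R :=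
  if i == j then v else u i.

Lemma set_fun_class u j v : (forall i, exp_class (u i)) -> exp_class v ->
  forall i, exp_class (set_fun u j v i).
Proof. by move=> cu cv i; rewrite /set_fun; case: eqP. Qed.

Lemma cylinder_fun_set u j v w : cylinder_fun (set_fun u j v) w =
  v (X w 0 j) * \prod_(i | i != j) u i (X w 0 i).
Proof.
rewrite /cylinder_fun (bigD1 j)//= /set_fun eqxx; congr (_ * _).
by apply: eq_bigr => i /negbTE ->.
Qed.

Lemma integral_cylinder_lin u j a v v' : (forall i, exp_class (u i)) ->
  exp_class v -> exp_class v' ->
  (\int[P]_w (cylinder_fun (set_fun u j (fun x => a * v x + v' x)%R) w)%:E =
   a%:E * \int[P]_w (cylinder_fun (set_fun u j v) w)%:E +
   \int[P]_w (cylinder_fun (set_fun u j v') w)%:E)%E.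
Proof.
move=> cu cv cv'.
have i1 := integrable_cylinder_fun (set_fun_class j cu cv).
have i2 := integrable_cylinder_fun (set_fun_class j cu cv').
rewrite -integralZl// -integralD//; last exact: integrableZl.
by apply: eq_integral => w _; rewrite /= -EFinM -EFinD !cylinder_fun_set mulrDl mulrA.
Qed.

Lemma integral_cylinder_lim u j (v_ : nat -> R -> R) v C : (forall i, exp_class (u i)) ->
  (forall n, exp_class (v_ n)) -> exp_class v -> 0 <= C ->
  (forall n x, `|v_ n x| <= C * expR (C * `|x|)) ->
  (forall x, v_ n x @[n --> \oo] --> v x) ->
  (\int[P]_w (cylinder_fun (set_fun u j (v_ n)) w)%:E @[n --> \oo] -->
   \int[P]_w (cylinder_fun (set_fun u j v) w)%:E)%E.
Proof.
move=> cu cv_ cv C0 vC vv.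
have H i := exp_class_bound (cu i).
pose Cs i := projT1 (cid2 (H i)) + C.
have Cs0 i : 0 <= Cs i by rewrite /Cs; case: (cid2 _) => /= E ? _; rewrite addr_ge0.
have [E E0 uE] := prod_exp_bound (index_enum 'I_k) u Cs0.
have mon (y z x : R) : 0 <= y -> y <= z -> y * expR (y * `|x|) <= z * expR (z * `|x|).
  by move=> y0 yz; apply: ler_pM; rewrite ?expR_ge0// ler_expR ler_wpM2r.
have [] // := @dominated_convergence _ _ _ P setT measurableT
   (fun n w => (cylinder_fun (set_fun u j (v_ n)) w)%:E)
   (fun w => (cylinder_fun (set_fun u j v) w)%:E)
   (fun w => (E * expR (E * l1 (X w)))%:E).
- by move=> n; apply/measurable_EFinP/measurable_cylinder_fun/set_fun_class.
- by apply/measurable_EFinP/measurable_cylinder_fun/set_fun_class.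
- apply: aeW => w _; apply: cvg_EFin; first exact: nearW.
  rewrite cylinder_fun_set; under eq_fun do rewrite cylinder_fun_set.
  by apply: cvgM; [exact: vv|exact: cvg_cst].
- apply: (integrable_exp_l1 (C := E)) => //.
    apply: measurable_funM => //; apply: measurableT_comp => //.
    apply: measurable_funM => //; exact: measurableT_comp measurable_l1 mX.
  by move=> w; rewrite ger0_norm// mulr_ge0 ?expR_ge0.
- apply: aeW => w n _; rewrite lee_fin; apply: uE => i x.
  rewrite /set_fun; case: eqP => _.
    apply: le_trans (vC _ _) _; apply: mon => //.
    by rewrite /Cs; case: (cid2 _) => /= ? ? _; rewrite lerDr.
  rewrite /Cs; case: (cid2 _) => /= F F0 uF; apply: le_trans (uF _) _; apply: mon => //.
  by rewrite lerDl.
Qed.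

End exp_moments.

Section mgf_unique.
Context {R : realType} {k : nat} {d1 d2} {T1 : measurableType d1} {T2 : measurableType d2}.
Variables (P1 : probability T1 R) (P2 : probability T2 R).
Variables (X : T1 -> borel_rV (R:=R) k) (Y : T2 -> borel_rV (R:=R) k).
Hypotheses (mX : measurable_fun setT X) (mY : measurable_fun setT Y).
Hypothesis mgf_fin : forall c : 'rV[R]_k, (\int[P1]_w (expR (dot c (X w)))%:E < +oo)%E.
Hypothesis mgfE : forall c : 'rV[R]_k,
  (\int[P1]_w (expR (dot c (X w)))%:E = \int[P2]_w (expR (dot c (Y w)))%:E)%E.

Let mgf_finY c : (\int[P2]_w (expR (dot c (Y w)))%:E < +oo)%E.
Proof. by rewrite -mgfE. Qed.

Lemma cylinder_agree (u : 'I_k -> R -> R) : (forall i, exp_class (u i)) ->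
  (\int[P1]_w (cylinder_fun X u w)%:E = \int[P2]_w (cylinder_fun Y u w)%:E)%E.
Proof.
move=> cu.
(* Induction on the number j of coordinates that carry a function of the class, the others carrying
   pure exponentials; for j = 0 the product is e^(c . x). The step is an inner induction on how the
   function of the new coordinate belongs to the class. *)
suff H (j : nat) (v : 'I_k -> R -> R) :
    (forall i : 'I_k, (i < j)%N -> exp_class (v i)) ->
    (forall i : 'I_k, (j <= i)%N -> exists a, v i = (fun x => expR (a * x))) ->
    (\int[P1]_w (cylinder_fun X v w)%:E = \int[P2]_w (cylinder_fun Y v w)%:E)%E.
  by apply: (H k) => // i; rewrite leqNgt ltn_ord.
elim: j v => [|j IH] v vc ve.
  pose a i := projT1 (cid (ve i (leq0n i))).
  have vE i : v i = (fun x => expR (a i * x)) by rewrite /a; case: (cid _).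
  have cE (x : 'rV[R]_k) : \prod_i v i (x 0 i) = expR (dot (\row_i a i) x).
    rewrite /dot expR_sum; apply: eq_bigr => i _; by rewrite vE mxE.
  transitivity (\int[P1]_w (expR (dot (\row_i a i) (X w)))%:E)%E.
    by apply: eq_integral => w _; rewrite /cylinder_fun cE.
  by rewrite mgfE; apply: eq_integral => w _; rewrite /cylinder_fun cE.
have [jk|kj] := ltnP j k; last first.
  apply: IH => i; first by move=> ij; apply: vc; exact: leqW.
  by move=> /(leq_trans kj); rewrite leqNgt ltn_ord.
pose j0 := Ordinal jk.
have cv i : exp_class (v i).
  have [ij|ij] := leqP i j; first exact: vc.
  by have [a ->] := ve i ij; exact: exp_class_exp.
suff H u' : exp_class u' -> (\int[P1]_w (cylinder_fun X (set_fun v j0 u') w)%:E =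
    \int[P2]_w (cylinder_fun Y (set_fun v j0 u') w)%:E)%E.
  have vE : set_fun v j0 (v j0) = v.
    by apply/funext => i; rewrite /set_fun; case: eqP => // ->.
  by have := H _ (cv j0); rewrite vE.
elim=> [a|a {}u' w' cu' IHu cw' IHw|u_ {}u' C cu_ IHu C0 uC uu].
- apply: IH => i ij; rewrite /set_fun.
    by case: eqP => [_|_]; [exact: exp_class_exp|exact: cv].
  have [ij0|ij0] := eqVneq i j0; first by exists a.
  apply: ve; rewrite ltn_neqAle ij andbT; apply: contra ij0 => /eqP ji.
  by apply/eqP/val_inj; rewrite /= ji.
- by rewrite !integral_cylinder_lin// IHu IHw.
- have cu' : exp_class u' by exact: exp_class_lim uC uu.
  have l1 := integral_cylinder_lim mX mgf_fin (j := j0) cv cu_ cu' C0 uC uu.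
  have l2 := integral_cylinder_lim mY mgf_finY (j := j0) cv cu_ cu' C0 uC uu.
  rewrite -(cvg_lim _ l1)// -(cvg_lim _ l2)//; congr (limn _).
  by apply/funext => n; exact: IHu.
Qed.

Definition orthant (b : 'I_k -> R) : set (@borel_rV R k) := [set x | forall i, b i < x 0 i].

Lemma measurable_orthant b : measurable (orthant b).
Proof.
rewrite (_ : orthant b = [set x : borel_rV k | forall i, x 0 i \in `]b i, +oo[]).
  exact: measurable_box.
by apply/seteqP; split => x /= H i; have := H i; rewrite in_itv/= andbT.
Qed.

Lemma borel_rV_orthant : @measurable _ (@borel_rV R k) = <<s range orthant >>.
Proof.
apply/seteqP; split.
  apply: smallest_sub; first exact: smallest_sigma_algebra.
  move=> _ [i [B [mB ->]]].
  pose S := g_sigma_algebraType (range orthant).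
  suff : measurable_fun setT (fun x : S => (x : 'rV[R]_k) 0 i : measurableTypeR R).
    by move=> /(_ measurableT B mB); rewrite setTI.
  apply: (measurability (@RGenOInfty.G R)) => [|/= _ [_] [r] -> <-].
    exact: RGenOInfty.measurableE.
  (* A half-space is the union over n of the orthants bounded below by -n in the other
     coordinates. *)
  rewrite setTI (_ : _ @^-1` _ =
    \bigcup_n orthant (fun j => if j == i then r else - n%:R)); last first.
    apply/seteqP; split => x /=; rewrite in_itv/= andbT.
      move=> rx; have [n nx] : exists n : nat, l1 x < n%:R.
        by exists (Num.truncn (l1 x)).+1; exact: truncnS_gt.
      exists n => // j; case: eqP => [->//|_].
      have := coord_le_l1 x j; rewrite ler_norml => /andP[? ?]; lra.
    by move=> [n _] /(_ i); rewrite eqxx.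
  apply: bigcupT_measurable => n; apply: sub_sigma_algebra.
  by exists (fun j => if j == i then r else - n%:R).
apply: smallest_sub; first exact: sigma_algebra_measurable.
by move=> _ [b _ <-]; exact: measurable_orthant.
Qed.

Lemma orthant_cylinder d (T : measurableType d) (P : probability T R)
    (Z : T -> borel_rV (R:=R) k) b : measurable_fun setT Z ->
  P (Z @^-1` orthant b) =
  (\int[P]_w (cylinder_fun Z (fun i x => (b i < x)%R%:R) w)%:E)%E.
Proof.
move=> mZ; have mO : measurable (Z @^-1` orthant b).
  exact: measurable_preimage mZ (measurable_orthant b).
transitivity (\int[P]_w (\1_(Z @^-1` orthant b) w)%:E)%E.
  by rewrite integral_indic// setIT.
apply: eq_integral => w _; congr (_%:E); rewrite indicE /cylinder_fun.
have [H|H] := pselect (forall i, b i < Z w 0 i).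
  by rewrite mem_set// big1// => i _; rewrite H.
rewrite memNset//; move/existsNP: H => [i /negP Hi].
by rewrite (bigD1 i)//= (negbTE Hi) mul0r.
Qed.

(** The orthants form a generating pi-system, and the indicators of half-lines belong to
    [exp_class], so [cylinder_agree] identifies the two laws on orthants. *)
Lemma law_unique (A : set (borel_rV k)) : measurable A -> P1 (X @^-1` A) = P2 (Y @^-1` A).
Proof.
pose m1 : {measure set (@borel_rV R k) -> \bar R} :=
  measure_function_pushforward__canonical__measure_function_Measure P1 mX.
pose m2 : {measure set (@borel_rV R k) -> \bar R} :=
  measure_function_pushforward__canonical__measure_function_Measure P2 mY.
apply: (@measure_unique _ _ _ (range orthant) (fun n => orthant (fun=> - n%:R)) _ _ _ _ m1 m2).
- exact: borel_rV_orthant.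
- move=> _ _ [b _ <-] [c _ <-]; exists (fun i => Num.max (b i) (c i)) => //.
  apply/seteqP; split => x /=.
    by move=> H; split => i; have := H i; rewrite gt_max => /andP[].
  by move=> [H1 H2] i; rewrite gt_max H1 H2.
- by move=> n; exists (fun=> - n%:R).
- apply/seteqP; split => // x _; exists (Num.truncn (l1 x)).+1 => // j.
  have := coord_le_l1 x j; rewrite ler_norml => /andP[? ?].
  have := truncnS_gt (l1 x); lra.
- move=> _ [b _ <-]; rewrite /m1 /m2 /= /pushforward !orthant_cylinder//.
  by apply: cylinder_agree => i; exact: exp_class_gt.
- by move=> n; rewrite /m1 /= /pushforward; apply: le_lt_trans (probability_le1 _ _) _;
    rewrite ?ltry//; exact: measurable_preimage mX (measurable_orthant _).
Qed.

Lemma integral_unique (h : borel_rV k -> \bar R) : measurable_fun setT h ->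
  (forall x, (0 <= h x)%E) -> (\int[P1]_w h (X w) = \int[P2]_w h (Y w))%E.
Proof.
move=> mh h0.
transitivity (\int[pushforward P1 X]_x h x)%E.
  by rewrite ge0_integral_pushforward.
transitivity (\int[pushforward P2 Y]_x h x)%E; last first.
  by rewrite ge0_integral_pushforward.
by apply: eq_measure_integral => A mA _; exact: law_unique.
Qed.

Lemma Rintegral_unique (h : borel_rV k -> R) : measurable_fun setT h ->
  \int[P1]_w h (X w) = \int[P2]_w h (Y w).
Proof.
move=> mh; rewrite /Rintegral; congr fine; rewrite [LHS]integralE [RHS]integralE.
pose g (x : borel_rV k) := (h x)%:E.
have mg : measurable_fun setT g by exact/measurable_EFinP.
have Hp := integral_unique (measurable_funepos mg) (@funepos_ge0 _ _ g).
have Hn := integral_unique (measurable_funeneg mg) (@funeneg_ge0 _ _ g).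
congr (_ - _)%E.
  transitivity (\int[P1]_w g^\+%E (X w))%E; first by apply: eq_integral => w _; rewrite !funeposE.
  by rewrite Hp; apply: eq_integral => w _; rewrite !funeposE.
transitivity (\int[P1]_w g^\-%E (X w))%E; first by apply: eq_integral => w _; rewrite !funenegE.
by rewrite Hn; apply: eq_integral => w _; rewrite !funenegE.
Qed.

End mgf_unique.

(** * Gaussian concentration *)

(** The mean value theorem for the remainder, whose derivative e^x - 1 - x is nonnegative: for z < 0
    the remainder is at most 0, and for z > 0 it is at most z times the bound of [expR_taylor1]. *)
Lemma expR_taylor2 (R : realType) (z : R) :
  expR z <= 1 + z + z ^+ 2 / 2 + `|z| ^+ 3 * expR `|z|.
Proof.
pose g (x : R) := expR x - 1 - x - x ^+ 2 / 2.
have dg (x : R) : is_derive x (1 : R) g (expR x - 1 - x).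
  rewrite /g; apply: is_derive_eq.
  by rewrite /GRing.scale/=; field.
have cg x y : {within `[x, y], continuous g}.
  apply: continuous_subspaceT => t; apply: differentiable_continuous.
  by apply/derivable1_diffP; case: (dg t).
have g0 : g 0 = 0 by rewrite /g expR0 subrr expr0n/= mul0r !subr0.
suff : g z <= `|z| ^+ 3 * expR `|z| by rewrite /g; lra.
have [z0|z0|->] := ltgtP z 0; last by rewrite g0 normr0 expr0n/= mul0r.
- have [c c0 gc] := @MVT R g (fun x => expR x - 1 - x) z 0 z0 (fun x _ => dg x) (cg _ _).
  have H : 0 <= expR c - 1 - c by have := expR_ge1Dx c; lra.
  apply: (@le_trans _ _ 0); last by rewrite mulr_ge0 ?exprn_ge0 ?expR_ge0.
  move: gc; rewrite g0; nra.
- have [c c0 gc] := @MVT R g (fun x => expR x - 1 - x) 0 z z0 (fun x _ => dg x) (cg _ _).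
  move: c0; rewrite in_itv/= => /andP[c0 cz].
  move: gc; rewrite g0 !subr0 => ->; rewrite gtr0_norm// exprSr -mulrAC mulrC.
  rewrite [leRHS]mulrC; apply: ler_wpM2l; first exact: ltW.
  apply: le_trans (le_trans (ler_norm _) (expR_taylor1 c)) _.
  rewrite (gtr0_norm c0); apply: ler_pM; rewrite ?sqr_ge0 ?expR_ge0//.
    by rewrite ler_sqr ?nnegrE ?ltW.
  by rewrite ler_expR ltW.
Qed.

Section exponentially_bounded.
Context {R : realType} {k : nat} {d} {T : measurableType d}.
Variables (P : probability T R) (X : T -> borel_rV (R:=R) k).
Hypothesis mX : measurable_fun setT X.
Hypothesis mgf_fin : forall c : 'rV[R]_k, (\int[P]_w (expR (dot c (X w)))%:E < +oo)%E.

(** A class of integrable functions stable under the algebraic operations, which makes linearity and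
    monotonicity of the integral available throughout. *)
Definition exp_bounded (g : T -> R) : Prop := measurable_fun setT g /\
  exists2 C, 0 <= C & forall w, `|g w| <= C * expR (C * l1 (X w)).

Lemma exp_bounded_integrable g : exp_bounded g -> P.-integrable setT (EFin \o g).
Proof. by move=> [mg [C C0 gC]]; exact: integrable_exp_l1 gC. Qed.

Lemma exp_bounded_ext g h : exp_bounded g -> g =1 h -> exp_bounded h.
Proof. by move=> + /funext <-. Qed.

Lemma exp_bounded_le (g h : T -> R) : measurable_fun setT g -> exp_bounded h ->
  (forall w, `|g w| <= h w) -> exp_bounded g.
Proof.
move=> mg [mh [C C0 hC]] gh; split => //; exists C => // w.
by apply: le_trans (gh w) (le_trans (ler_norm _) (hC w)).
Qed.

Lemma exp_boundedM g h : exp_bounded g -> exp_bounded h -> exp_bounded (fun w => g w * h w).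
Proof.
move=> [mg [C C0 gC]] [mh [E E0 hE]]; split; first exact: measurable_funM.
exists (C * E + C + E); first by rewrite !addr_ge0// mulr_ge0.
move=> w; rewrite -[l1 _](ger0_norm (l1_ge0 (X w))).
by apply: norm_mul_exp_le => //; rewrite (ger0_norm (l1_ge0 (X w))).
Qed.

Lemma exp_bounded_cst c : exp_bounded (fun=> c).
Proof.
split => //; exists `|c| => // w; by rewrite ler_peMr// -expR0 ler_expR mulr_ge0// l1_ge0.
Qed.

Lemma exp_boundedD g h : exp_bounded g -> exp_bounded h -> exp_bounded (fun w => g w + h w).
Proof.
move=> [mg [C C0 gC]] [mh [E E0 hE]]; split; first exact: measurable_funD.
exists (C + E); first by rewrite addr_ge0.
move=> w; apply: le_trans (ler_normD _ _) _; rewrite mulrDl; have W0 := l1_ge0 (X w).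
by apply: lerD; [apply: le_trans (gC w) _|apply: le_trans (hE w) _];
  rewrite ler_wpM2l// ler_expR ler_wpM2r//; lra.
Qed.

Lemma exp_boundedZ a g : exp_bounded g -> exp_bounded (fun w => a * g w).
Proof. by apply: exp_boundedM; exact: exp_bounded_cst. Qed.

Lemma exp_boundedB g h : exp_bounded g -> exp_bounded h -> exp_bounded (fun w => g w - h w).
Proof.
move=> eg eh; apply: (exp_bounded_ext (exp_boundedD eg (exp_boundedZ (-1) eh))) => w.
by rewrite mulN1r.
Qed.

Lemma exp_boundedX g n : exp_bounded g -> exp_bounded (fun w => g w ^+ n).
Proof.
move=> eg; elim: n => [|n IH]; first exact: exp_bounded_cst.
by apply: (exp_bounded_ext (exp_boundedM eg IH)) => w; rewrite exprS.
Qed.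

Lemma exp_bounded_l1 : exp_bounded (fun w => l1 (X w)).
Proof.
split; first exact: measurableT_comp measurable_l1 mX.
exists 1 => // w; rewrite !mul1r ger0_norm ?l1_ge0//.
have := expR_ge1Dx (l1 (X w)); lra.
Qed.

Lemma exp_bounded_coord i : exp_bounded (fun w => X w 0 i).
Proof.
apply: (exp_bounded_le _ exp_bounded_l1); first exact: measurableT_comp (measurable_coord i) mX.
by move=> w; exact: coord_le_l1.
Qed.

Lemma exp_bounded_exp_l1 a : 0 <= a -> exp_bounded (fun w => expR (a * l1 (X w))).
Proof.
move=> a0; split.
  apply: measurableT_comp => //; apply: measurable_funM => //.
  by case: exp_bounded_l1.
exists (a + 1); first lra.
move=> w; rewrite ger0_norm ?expR_ge0//; have W0 := l1_ge0 (X w).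
apply: (@le_trans _ _ (expR ((a + 1) * l1 (X w)))); first by rewrite ler_expR ler_wpM2r//; lra.
by rewrite ler_peMl ?expR_ge0//; lra.
Qed.

Lemma exp_bounded_sum (I : Type) (s : seq I) (g : I -> T -> R) :
  (forall i, exp_bounded (g i)) -> exp_bounded (fun w => \sum_(i <- s) g i w).
Proof.
move=> eg; elim: s => [|i s IH].
  by apply: (exp_bounded_ext (exp_bounded_cst 0)) => w; rewrite big_nil.
by apply: (exp_bounded_ext (exp_boundedD (eg i) IH)) => w; rewrite big_cons.
Qed.

Lemma Rintegral_sum_exp_bounded (I : Type) (s : seq I) (g : I -> T -> R) :
  (forall i, exp_bounded (g i)) ->
  \int[P]_w (\sum_(i <- s) g i w) = \sum_(i <- s) \int[P]_w g i w.
Proof.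
move=> eg; elim: s => [|i s IH].
  rewrite big_nil; under eq_Rintegral do rewrite big_nil.
  by rewrite Rintegral_cst// mul0r.
rewrite big_cons -IH -RintegralD//.
- by apply: eq_Rintegral => w _; rewrite big_cons.
- exact: exp_bounded_integrable.
- exact/exp_bounded_integrable/exp_bounded_sum.
Qed.

Lemma exp_bounded_le_Rintegral g h : exp_bounded g -> exp_bounded h -> (forall w, g w <= h w) ->
  \int[P]_w g w <= \int[P]_w h w.
Proof.
move=> eg eh gh; apply: le_Rintegral => //; exact: exp_bounded_integrable.
Qed.

Lemma exp_bounded_RintegralD g h : exp_bounded g -> exp_bounded h ->
  \int[P]_w (g w + h w) = \int[P]_w g w + \int[P]_w h w.
Proof. by move=> eg eh; rewrite RintegralD//; exact: exp_bounded_integrable. Qed.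

Lemma exp_bounded_RintegralZ a g : exp_bounded g -> \int[P]_w (a * g w) = a * \int[P]_w g w.
Proof. by move=> eg; rewrite RintegralZl//; exact: exp_bounded_integrable. Qed.

Lemma Rintegral_cst_prob c : \int[P]_w (cst c w) = c.
Proof. by rewrite Rintegral_cst// [X in fine X]probability_setT/= mulr1. Qed.

Definition l1_lipschitz (f : 'rV[R]_k -> R) (L : R) :=
  forall x h, `|f (x + h) - f x| <= L * l1 h.

(** [p] plays the gradient of [f] at [s]. The exponential factor accommodates remainders estimated
    by the exponential, and stays integrable when the moment generating function is finite. *)
Definition l1_expansion (f : 'rV[R]_k -> R) (s p : 'rV[R]_k) (K : R) :=
  forall h, `|f (s + h) - f s - dot p h| <= K * l1 h ^+ 2 * expR (K * l1 h).

Lemma l1Z u (x : 'rV[R]_k) : l1 (u *: x) = `|u| * l1 x.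
Proof. by rewrite /l1 mulr_sumr; apply: eq_bigr => i _; rewrite mxE normrM. Qed.

Lemma measurable_affine (s : 'rV[R]_k) u : measurable_fun setT (fun w => s + u *: (X w : 'rV_k) : borel_rV k).
Proof.
apply: measurable_rVD; first exact: measurable_cst.
exact: measurableT_comp (measurable_scale u) mX.
Qed.

Lemma exp_bounded_lipschitz (f : borel_rV k -> R) s u L : 0 <= L -> measurable_fun setT f ->
  l1_lipschitz f L -> exp_bounded (fun w => f (s + u *: (X w : 'rV_k))).
Proof.
move=> L0 mf Lf.
apply: (@exp_bounded_le _ (fun w => `|f s| + L * `|u| * l1 (X w))).
- exact: measurableT_comp mf (measurable_affine s u).
- by apply: exp_boundedD; [exact: exp_bounded_cst|apply: exp_boundedZ; exact: exp_bounded_l1].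
- move=> w; have := Lf s (u *: (X w : 'rV_k)); rewrite l1Z mulrA.
  have := ler_normD (f s) (f (s + u *: (X w : 'rV_k)) - f s); rewrite addrC subrK; lra.
Qed.

Lemma exp_bounded_exp_lipschitz (f : borel_rV k -> R) s u L : 0 <= L -> measurable_fun setT f ->
  l1_lipschitz f L -> exp_bounded (fun w => expR (f (s + u *: (X w : 'rV_k)))).
Proof.
move=> L0 mf Lf.
apply: (@exp_bounded_le _ (fun w => expR (f s) * expR (L * `|u| * l1 (X w)))).
- by apply: measurableT_comp => //; exact: measurableT_comp mf (measurable_affine s u).
- by apply: exp_boundedZ; apply: exp_bounded_exp_l1; rewrite mulr_ge0.
- move=> w; rewrite ger0_norm ?expR_ge0// -expRD ler_expR.
  have := Lf s (u *: (X w : 'rV_k)); rewrite l1Z mulrA ler_norml; lra.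
Qed.

(** Cauchy-Schwarz with the weights |p_i|. In expectation it bounds the second moment of p . X by
    l1(p)^2 times the largest coordinate variance, whatever the correlations. *)
Lemma sqr_dot_le (p x : 'rV[R]_k) : dot p x ^+ 2 <= l1 p * \sum_i `|p 0 i| * x 0 i ^+ 2.
Proof.
have H : dot p x ^+ 2 <= \sum_i \sum_j `|p 0 i| * `|p 0 j| * ((x 0 i ^+ 2 + x 0 j ^+ 2) / 2).
  rewrite expr2 /dot mulr_suml; apply: ler_sum => i _; rewrite mulr_sumr; apply: ler_sum => j _.
  apply: le_trans (ler_norm _) _; rewrite !normrM mulrACA; apply: ler_wpM2l; first by rewrite mulr_ge0.
  rewrite -(real_normK (num_real (x 0 i))) -(real_normK (num_real (x 0 j))).
  have := sqr_ge0 (`|x 0 i| - `|x 0 j|); nra.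
apply: le_trans H _; rewrite le_eqVlt; apply/orP; left; apply/eqP.
transitivity (\sum_i \sum_j (`|p 0 i| * `|p 0 j| * x 0 i ^+ 2 / 2 + `|p 0 i| * `|p 0 j| * x 0 j ^+ 2 / 2)).
  by apply: eq_bigr => i _; apply: eq_bigr => j _; field.
under eq_bigr => i _ do rewrite big_split.
rewrite big_split/= [X in _ + X = _]exchange_big/= -big_split/= /l1 mulr_sumr.
apply: eq_bigr => i _; rewrite -big_split/= mulr_suml.
by apply: eq_bigr => j _; field.
Qed.

Lemma dot_le_l1 (p x : 'rV[R]_k) : `|dot p x| <= l1 p * l1 x.
Proof.
apply: le_trans (ler_norm_sum _ _ _) _; rewrite /l1 mulr_suml; apply: ler_sum => i _.
by rewrite normrM ler_wpM2l// coord_le_l1.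
Qed.

(* Linearizing f at s, the error terms of third order in u vanish in the limit
   when the inequality is iterated 1 / u ^+ 2 times. *)
Lemma exp_moment_step L K v : 0 <= L -> 0 <= K -> 0 <= v -> (forall i, \int[P]_w (X w 0 i ^+ 2) <= v) ->
  exists2 C, 0 <= C & forall (f : borel_rV k -> R) (s p : 'rV[R]_k) u, 0 <= u <= 1 ->
    measurable_fun setT f -> l1_lipschitz f L -> l1 p <= L -> l1_expansion f s p K ->
    (forall i, \int[P]_w (X w 0 i) = 0) ->
    \int[P]_w expR (f (s + u *: (X w : 'rV_k))) <=
    (1 + u ^+ 2 * (L ^+ 2 * v / 2) + u ^+ 3 * C) * expR (\int[P]_w f (s + u *: (X w : 'rV_k))).
Proof.
move=> L0 K0 v0 Xv.
pose W w := l1 (X w); have W0 w : 0 <= W w by exact: l1_ge0.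
pose V w := K * W w ^+ 2 * expR (K * W w).
have V0 w : 0 <= V w by rewrite !mulr_ge0 ?expR_ge0 ?sqr_ge0.
(* All the contributions of order u^3 to e^D: the linearization error, once against the linear term
   and once squared, and the Taylor remainder. *)
pose G w := L * W w * V w + V w ^+ 2 / 2 + (L * W w) ^+ 3 * expR (L * W w).
have G0 w : 0 <= G w.
  by rewrite !addr_ge0 ?divr_ge0 ?sqr_ge0// !mulr_ge0 ?expR_ge0 ?exprn_ge0// mulr_ge0.
have eW : exp_bounded W by exact: exp_bounded_l1.
have eV : exp_bounded V.
  by apply: exp_boundedM; [apply/exp_boundedZ/exp_boundedX|exact: exp_bounded_exp_l1].
have eG : exp_bounded G.
  apply: exp_boundedD; last by apply: exp_boundedM; [apply/exp_boundedX/exp_boundedZ|exact: exp_bounded_exp_l1].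
  apply: exp_boundedD; first by apply: exp_boundedM => //; exact: exp_boundedZ.
  by apply: (exp_bounded_ext (exp_boundedZ 2^-1 (exp_boundedX 2 eV))) => w; rewrite mulrC.
pose c := L * \int[P]_w W w; pose C1 := \int[P]_w G w; pose A := L ^+ 2 * v / 2.
have c0 : 0 <= c by rewrite mulr_ge0// Rintegral_ge0.
have C10 : 0 <= C1 by exact: Rintegral_ge0.
have A0 : 0 <= A by rewrite divr_ge0// mulr_ge0// sqr_ge0.
exists (A * c * expR c + C1 * expR c); first by apply: addr_ge0; rewrite mulr_ge0 ?expR_ge0// mulr_ge0.
move=> f s p u /andP[u0 u1] mf Lf pL fe X0.
pose D w := f (s + u *: (X w : 'rV_k)) - f s.
have ef : exp_bounded (fun w => f (s + u *: (X w : 'rV_k))) by exact: exp_bounded_lipschitz Lf.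
have eD : exp_bounded D by apply: exp_boundedB => //; exact: exp_bounded_cst.
have DW w : `|D w| <= u * (L * W w).
  by have := Lf s (u *: (X w : 'rV_k)); rewrite l1Z (ger0_norm u0) mulrCA.
pose S w := \sum_i `|p 0 i| * X w 0 i ^+ 2.
have eS : exp_bounded S by apply: exp_bounded_sum => i; apply/exp_boundedZ/exp_boundedX/exp_bounded_coord.
have pt w : expR (D w) <= 1 + D w + u ^+ 2 / 2 * (L * S w) + u ^+ 3 * G w.
  apply: le_trans (expR_taylor2 _) _.
  have uW : u * W w <= W w by rewrite ler_piMl.
  have r1 : `|D w - u * dot p (X w)| <= u ^+ 2 * V w.
    have := fe (u *: (X w : 'rV_k)); rewrite dotZr l1Z (ger0_norm u0) => /le_trans; apply.
    rewrite (_ : _ * _ * _ = u ^+ 2 * (K * W w ^+ 2 * expR (K * (u * W w)))); last by rewrite /W; ring.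
    apply: ler_wpM2l; first exact: sqr_ge0.
    apply: ler_wpM2l; first by rewrite mulr_ge0 ?sqr_ge0.
    by rewrite ler_expR ler_wpM2l.
  have r2 : `|dot p (X w)| <= L * W w.
    by apply: le_trans (dot_le_l1 _ _) _; apply: ler_wpM2r => //; exact: l1_ge0.
  have r3 : dot p (X w) ^+ 2 <= L * S w.
    apply: le_trans (sqr_dot_le _ _) _; apply: ler_wpM2r => //.
    by apply: sumr_ge0 => i _; rewrite mulr_ge0 ?sqr_ge0.
  have r4 : D w ^+ 2 <= u ^+ 2 * (L * S w) + u ^+ 3 * (2 * (L * W w) * V w + V w ^+ 2).
    set rho := D w - u * dot p (X w) in r1.
    have -> : D w = u * dot p (X w) + rho by rewrite addrC subrK.
    have -> : (u * dot p (X w) + rho) ^+ 2 = u ^+ 2 * dot p (X w) ^+ 2 + 2 * u * (dot p (X w) * rho) + rho ^+ 2 by ring.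
    have a1 : u ^+ 2 * dot p (X w) ^+ 2 <= u ^+ 2 * (L * S w) by rewrite ler_wpM2l// sqr_ge0.
    have a2 : dot p (X w) * rho <= (L * W w) * (u ^+ 2 * V w).
      by apply: le_trans (ler_norm _) _; rewrite normrM; apply: ler_pM.
    have a3 : rho ^+ 2 <= (u ^+ 2 * V w) ^+ 2.
      by rewrite -real_normK ?num_real// ler_sqr ?nnegrE// mulr_ge0// sqr_ge0.
    have a4 : 2 * u * (dot p (X w) * rho) <= 2 * u * ((L * W w) * (u ^+ 2 * V w)).
      by rewrite ler_wpM2l// mulr_ge0.
    have a5 : (u ^+ 2 * V w) ^+ 2 <= u ^+ 3 * V w ^+ 2.
      rewrite exprMn -exprM; apply: ler_wpM2r; first exact: sqr_ge0.
      by apply: ler_wiXn2l.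
    have -> : u ^+ 3 * (2 * (L * W w) * V w + V w ^+ 2) =
      2 * u * ((L * W w) * (u ^+ 2 * V w)) + u ^+ 3 * V w ^+ 2 by ring.
    lra.
  have r5 : `|D w| ^+ 3 * expR `|D w| <= u ^+ 3 * ((L * W w) ^+ 3 * expR (L * W w)).
    rewrite mulrA -exprMn; apply: ler_pM; rewrite ?exprn_ge0 ?expR_ge0//.
      by apply: lerXn2r; rewrite ?nnegrE// !mulr_ge0.
    rewrite ler_expR; apply: le_trans (DW w) _; rewrite ler_piMl// mulr_ge0//.
  have -> : u ^+ 3 * G w = u ^+ 3 * (2 * (L * W w) * V w + V w ^+ 2) / 2 + u ^+ 3 * ((L * W w) ^+ 3 * expR (L * W w)).
    by rewrite /G; field.
  lra.
pose delta := \int[P]_w D w.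
have eS' : exp_bounded (fun w => u ^+ 2 / 2 * (L * S w)) by apply/exp_boundedZ/exp_boundedZ.
have eG' : exp_bounded (fun w => u ^+ 3 * G w) by exact: exp_boundedZ.
have e1 : exp_bounded (fun w => 1 + D w) by apply: exp_boundedD => //; exact: exp_bounded_cst.
have e2 : exp_bounded (fun w => 1 + D w + u ^+ 2 / 2 * (L * S w)) by exact: exp_boundedD.
have eED : exp_bounded (fun w => expR (D w)).
  apply: (exp_bounded_ext (exp_boundedZ (expR (- f s)) (exp_bounded_exp_lipschitz s u L0 mf Lf))) => w.
  by rewrite -expRD [in LHS]addrC.
have ES : \int[P]_w S w <= L * v.
  rewrite /S Rintegral_sum_exp_bounded; last by move=> i; apply/exp_boundedZ/exp_boundedX/exp_bounded_coord.
  apply: (@le_trans _ _ (\sum_i `|p 0 i| * v)).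
    apply: ler_sum => i _; rewrite exp_bounded_RintegralZ; last exact/exp_boundedX/exp_bounded_coord.
    by rewrite ler_wpM2l.
  by rewrite -mulr_suml ler_wpM2r.
have H1 : \int[P]_w expR (D w) <= 1 + delta + (u ^+ 2 * A + u ^+ 3 * C1).
  apply: le_trans (exp_bounded_le_Rintegral eED (exp_boundedD e2 eG') pt) _.
  rewrite exp_bounded_RintegralD// exp_bounded_RintegralD// exp_bounded_RintegralD//; last exact: exp_bounded_cst.
  rewrite Rintegral_cst_prob (exp_bounded_RintegralZ _ (exp_boundedZ L eS)) (exp_bounded_RintegralZ _ eS) (exp_bounded_RintegralZ _ eG).
  rewrite -/delta -/C1 -addrA lerD2l; apply: lerD => //.
  rewrite /A -mulrA; apply: (@le_trans _ _ (u ^+ 2 / 2 * (L * (L * v)))).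
    by rewrite ler_wpM2l ?divr_ge0 ?sqr_ge0// ler_wpM2l.
  by rewrite le_eqVlt; apply/orP; left; apply/eqP; field.
have dW : `|delta| <= u * c.
  apply: le_trans (le_normr_Rintegral measurableT (exp_bounded_integrable eD)) _.
  rewrite /c mulrA -exp_bounded_RintegralZ//; apply: exp_bounded_le_Rintegral.
  - by apply: (exp_bounded_le _ (exp_boundedZ (u * L) eW)) => [|w]; [apply: measurableT_comp => //; case: eD|rewrite normr_id -mulrA].
  - exact: exp_boundedZ.
  - by move=> w; rewrite -mulrA.
have fsD : \int[P]_w f (s + u *: (X w : 'rV_k)) = f s + delta.
  rewrite -[f s](Rintegral_cst_prob (f s)) -exp_bounded_RintegralD//; last exact: exp_bounded_cst.
  by apply: eq_Rintegral => w _; rewrite /D /cst [RHS]addrC subrK.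
have -> : \int[P]_w expR (f (s + u *: (X w : 'rV_k))) = expR (f s) * \int[P]_w expR (D w).
  rewrite -exp_bounded_RintegralZ//; apply: eq_Rintegral => w _.
  by rewrite -expRD /D [in RHS]addrC subrK.
rewrite fsD expRD mulrCA; apply: ler_wpM2l; first exact: expR_ge0.
apply: (le_trans H1).
(* 1 + delta + B is at most (1 + B e^|delta|) e^delta. As |delta| <= u c, the factor e^|delta|
   alters B, which is of order u^2, only at order u^3. *)
have h1 := expR_ge1Dx delta.
have h2 : 1 <= expR `|delta| * expR delta.
  rewrite -expRD -expR0 ler_expR; have := ler_norm (- delta); rewrite normrN; lra.
have h3 : expR `|delta| <= expR (u * c) by rewrite ler_expR.
have h4 : expR (u * c) <= expR c by rewrite ler_expR ler_piMl.
have h5 : expR (u * c) <= 1 + u * c * expR c.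
  have uc0 : 0 <= u * c by rewrite mulr_ge0.
  have := expR_sub1_le (u * c); rewrite (ger0_norm uc0) => h.
  have := le_trans (ler_norm _) h.
  have : u * c * expR (u * c) <= u * c * expR c by rewrite ler_wpM2l.
  lra.
set B := u ^+ 2 * A + u ^+ 3 * C1.
have B0 : 0 <= B by rewrite addr_ge0// mulr_ge0 ?exprn_ge0.
have hB : B * expR `|delta| <= u ^+ 2 * A + u ^+ 3 * (A * c * expR c + C1 * expR c).
  have a1 : u ^+ 2 * A * expR `|delta| <= u ^+ 2 * A * (1 + u * c * expR c).
    by apply: ler_wpM2l; [rewrite mulr_ge0 ?exprn_ge0|exact: le_trans h5].
  have a2 : u ^+ 3 * C1 * expR `|delta| <= u ^+ 3 * C1 * expR c.
    by apply: ler_wpM2l; [rewrite mulr_ge0 ?exprn_ge0|exact: le_trans h4].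
  rewrite /B mulrDl; apply: le_trans (lerD a1 a2) _.
  by rewrite le_eqVlt; apply/orP; left; apply/eqP; ring.
have e0 := expR_gt0 delta.
have : B <= B * expR `|delta| * expR delta by rewrite -mulrA ler_peMr.
have : B * expR `|delta| * expR delta <= (u ^+ 2 * A + u ^+ 3 * (A * c * expR c + C1 * expR c)) * expR delta.
  by rewrite ler_wpM2r// ltW.
rewrite -/A; lra.
Qed.

End exponentially_bounded.

Lemma le_expR_harmonic (R : realType) (C Y a : R) : 0 <= C ->
  (forall M : nat, Y <= expR (a + C * M.+1%:R^-1)) -> Y <= expR a.
Proof.
move=> C0 H; rewrite leNgt; apply/negP => AY.
have Y0 : 0 < Y by exact: lt_trans (expR_gt0 _) AY.
have lY : a < ln Y by rewrite -ltr_expR lnK.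
have d0 : 0 < ln Y - a by rewrite subr_gt0.
pose M := Num.truncn (C / (ln Y - a)).
have HM : C / (ln Y - a) < M.+1%:R by exact: truncnS_gt.
have : ln Y <= a + C * M.+1%:R^-1 by rewrite -ler_expR lnK.
have : C * M.+1%:R^-1 < ln Y - a by rewrite ltr_pdivrMr// mulrC -ltr_pdivrMr.
move: (C * _) => z; lra.
Qed.

(** * Soft maxima *)

Section softmax.
Context {R : realType} {k : nat}.

Definition l1_smooth (f : 'rV[R]_k -> R) L K :=
  l1_lipschitz f L /\ forall x, exists2 p, l1 p <= L & l1_expansion f x p K.

(** The log-sum-exp approximation of lam max x_i. It exceeds this by at most lam ln k / beta, and
    beta tends to infinity in the tail bound. *)
Definition softmax (lam beta : R) (x : 'rV[R]_k) : R :=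
  lam / beta * ln (\sum_i expR (beta * x 0 i)).

Lemma softmax_den_gt0 beta (x : 'rV[R]_k) : (0 < k)%N -> 0 < \sum_i expR (beta * x 0 i).
Proof.
move=> k0; rewrite (bigD1 (Ordinal k0))//= ltr_pwDl ?expR_gt0//.
by apply: sumr_ge0 => i _; exact: expR_ge0.
Qed.

Lemma le_softmax lam beta (x : 'rV[R]_k) i : 0 <= lam -> 0 < beta -> lam * x 0 i <= softmax lam beta x.
Proof.
move=> l0 b0; rewrite /softmax -mulrA ler_wpM2l// mulrC ler_pdivlMr// mulrC.
rewrite -[X in X <= _]expRK ler_ln ?posrE ?expR_gt0 ?softmax_den_gt0//; last by case: i => ? /(leq_trans _) ->.
by rewrite (bigD1 i)//= lerDl sumr_ge0// => j _; exact: expR_ge0.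
Qed.

Lemma softmax_le lam beta (x : 'rV[R]_k) : (0 < k)%N -> 0 <= lam -> 0 < beta ->
  exists i, softmax lam beta x <= lam * x 0 i + lam * ln k%:R / beta.
Proof.
move=> k0 l0 b0; case: (arg_maxP (fun i : 'I_k => x 0 i) (i0 := Ordinal k0) (P := xpredT) isT) => i _ imax.
exists i; rewrite /softmax -!mulrA -mulrDr ler_wpM2l//.
rewrite mulrC ler_pdivrMr// mulrDl divfK ?gt_eqF//.
rewrite (_ : x 0 i * beta + ln k%:R = ln (expR (beta * x 0 i) * k%:R)); last first.
  by rewrite lnM ?posrE ?expR_gt0 ?ltr0n// expRK mulrC.
rewrite ler_ln ?posrE ?mulr_gt0 ?expR_gt0 ?ltr0n ?softmax_den_gt0//.
rewrite mulr_natr -[k in _ *+ k]card_ord -sumr_const; apply: ler_sum => j _.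
by rewrite ler_expR ler_wpM2l// ?(ltW b0)//; exact: imax.
Qed.

(** The gradient is lam times the Gibbs probability vector p, of l1 norm lam in every dimension. An
    increment is lam / beta times ln S, where S is the p-mean of e^(beta h_i); Jensen's inequality
    bounds it from below and ln S <= S - 1 from above. *)
Lemma l1_smooth_softmax lam beta : (0 < k)%N -> 0 <= lam -> 0 < beta ->
  l1_smooth (softmax lam beta) lam (lam * beta + beta).
Proof.
move=> k0 l0 b0; pose Z x := \sum_i expR (beta * (x : 'rV[R]_k) 0 i).
have Z0 x : 0 < Z x by exact: softmax_den_gt0.
pose p (x : 'rV[R]_k) : 'rV[R]_k := \row_i (expR (beta * x 0 i) / Z x).
have p0 x i : 0 <= p x 0 i by rewrite mxE divr_ge0 ?expR_ge0// ltW.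
have p1 x : \sum_i p x 0 i = 1.
  under eq_bigr do rewrite mxE.
  by rewrite -mulr_suml divff// gt_eqF//; exact: Z0.
pose S x h := \sum_i p x 0 i * expR (beta * (h : 'rV[R]_k) 0 i).
have ZS x h : Z (x + h) = Z x * S x h.
  rewrite /S mulr_sumr; apply: eq_bigr => i _.
  by rewrite !mxE mulrDr expRD mulrA; congr (_ * _); rewrite [RHS]mulrC divfK// gt_eqF//; exact: Z0.
have r0 h := l1_ge0 (h : 'rV[R]_k).
have hr (h : 'rV[R]_k) i : `|beta * h 0 i| <= beta * l1 h.
  by rewrite normrM gtr0_norm// ler_wpM2l ?(ltW b0)// coord_le_l1.
have mean x (c : R) : c = \sum_i p x 0 i * c by rewrite -mulr_suml p1 mul1r.
have S0 x h : 0 < S x h.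
  by have := Z0 (x + h); rewrite ZS pmulr_rgt0.
have dE x h : softmax lam beta (x + h) - softmax lam beta x = lam / beta * ln (S x h).
  by rewrite /softmax -/(Z (x + h)) -/(Z x) ZS lnM ?posrE// mulrDr addrC addKr.
have lb0 : 0 <= lam / beta by rewrite divr_ge0// ltW.
split=> [x h|x].
  rewrite dE normrM ger0_norm// [leRHS](_ : _ = lam / beta * (beta * l1 h)); last first.
    by rewrite mulrA divfK// gt_eqF.
  apply: ler_wpM2l => //; rewrite ler_norml; apply/andP; split.
    rewrite -ler_expR lnK ?posrE// [leLHS](mean x); apply: ler_sum => i _.
    apply: ler_wpM2l => //; rewrite ler_expR; have := hr h i; rewrite ler_norml; lra.
  rewrite -ler_expR lnK ?posrE// [leRHS](mean x); apply: ler_sum => i _.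
  apply: ler_wpM2l => //; rewrite ler_expR; have := hr h i; rewrite ler_norml; lra.
exists (lam *: p x).
  rewrite l1Z ger0_norm// /l1; under eq_bigr do rewrite ger0_norm//.
  by rewrite p1 mulr1.
move=> h; rewrite dE dotZl; pose m := \sum_i p x 0 i * (beta * h 0 i).
have -> : dot (p x) h = m / beta.
  rewrite /m mulr_suml; apply: eq_bigr => i _.
  by field; rewrite gt_eqF.
rewrite [X in `|X|](_ : _ = lam / beta * (ln (S x h) - m)); last by field; rewrite gt_eqF.
have mS : m <= ln (S x h).
  rewrite -ler_expR lnK ?posrE//.
  have -> : S x h = expR m * \sum_i p x 0 i * expR (beta * h 0 i - m).
    rewrite mulr_sumr; apply: eq_bigr => i _.
    by rewrite mulrCA -expRD addrC subrK.
  rewrite ler_peMr ?expR_ge0//.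
  rewrite [leLHS](_ : _ = \sum_i p x 0 i * (1 + (beta * h 0 i - m))); last first.
    under eq_bigr do rewrite mulrDr mulrBr mulr1.
    by rewrite big_split/= sumrB p1 -/m -mulr_suml p1 mul1r subrr addr0.
  by apply: ler_sum => i _; rewrite ler_wpM2l// expR_ge1Dx.
have Sm : ln (S x h) - m <= (beta * l1 h) ^+ 2 * expR (beta * l1 h).
  have : ln (S x h) <= S x h - 1.
    have := expR_ge1Dx (ln (S x h)); rewrite lnK ?posrE//; lra.
  have : S x h - 1 - m <= (beta * l1 h) ^+ 2 * expR (beta * l1 h).
    rewrite [leRHS](mean x) [leLHS](_ : _ = \sum_i p x 0 i * (expR (beta * h 0 i) - 1 - beta * h 0 i)).
      apply: ler_sum => i _; rewrite ler_wpM2l//.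
      apply: le_trans (le_trans (ler_norm _) (expR_taylor1 _)) _.
      rewrite -real_normK ?num_real//.
      apply: ler_pM; rewrite ?sqr_ge0 ?expR_ge0 ?ler_expR//.
      by rewrite ler_sqr ?nnegrE// mulr_ge0// ltW.
    under [RHS]eq_bigr do rewrite !mulrBr mulr1.
    by rewrite !sumrB p1.
  lra.
rewrite normrM ger0_norm// ger0_norm ?subr_ge0//.
apply: le_trans (ler_wpM2l lb0 Sm) _.
rewrite (_ : lam / beta * _ = lam * beta * l1 h ^+ 2 * expR (beta * l1 h)); last by field; rewrite gt_eqF.
have lb : 0 <= lam * beta by rewrite mulr_ge0// ltW.
apply: ler_pM; rewrite ?expR_ge0 ?mulr_ge0 ?sqr_ge0 ?(ltW b0)//.
  by rewrite ler_wpM2r ?sqr_ge0// lerDl ltW.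
by rewrite ler_expR ler_wpM2r// lerDr.
Qed.

End softmax.

Section gaussian_concentration.
Context {R : realType} {k : nat} {d} {T : measurableType d}.
Variables (P : probability T R) (X : T -> borel_rV (R:=R) k) (q : 'rV[R]_k -> R).
Hypothesis mX : measurable_fun setT X.
Hypothesis mgfX : forall c : 'rV[R]_k, (\int[P]_w (expR (dot c (X w)))%:E = (expR (q c))%:E)%E.
Hypothesis qZ : forall a c, q (a *: c) = a ^+ 2 * q c.

Lemma mgf_lty (c : 'rV[R]_k) : (\int[P]_w (expR (dot c (X w)))%:E < +oo)%E.
Proof. by rewrite mgfX ltry. Qed.

Lemma mgf_scaled u (c : 'rV[R]_k) :
  (\int[P]_w (expR (dot c (u *: (X w : 'rV_k))))%:E = (expR (u ^+ 2 * q c))%:E)%E.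
Proof.
by rewrite -qZ -mgfX; apply: eq_integral => w _; rewrite dotZr dotZl.
Qed.

Lemma measurable_scaled u : measurable_fun setT (fun w => u *: (X w : 'rV_k) : borel_rV k).
Proof. exact: measurableT_comp (measurable_scale u) mX. Qed.

(** The quadratic form [q] is even, so -X has the law of X. *)
Lemma centered_coord i : \int[P]_w (X w 0 i) = 0.
Proof.
have H : \int[P]_w (X w 0 i) = \int[P]_w (- X w 0 i).
  rewrite (@Rintegral_unique _ _ _ _ _ _ P P X (fun w => (-1) *: (X w : 'rV_k)) mX
    (measurable_scaled _) mgf_lty _ (fun x => x 0 i)); last exact: measurable_coord.
    by apply: eq_Rintegral => w _; rewrite mxE mulN1r.
  by move=> c; rewrite mgfX mgf_scaled sqrrN expr1n mul1r.
have eX := exp_bounded_coord mX i.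
have : \int[P]_w (- X w 0 i) = - \int[P]_w (X w 0 i).
  rewrite -mulN1r -(exp_bounded_RintegralZ mX mgf_lty)//.
  by apply: eq_Rintegral => w _; rewrite mulN1r.
lra.
Qed.

Definition pair_comb a b (w : T * T) : borel_rV k := a *: (X w.1 : 'rV_k) + b *: (X w.2 : 'rV_k).

Lemma measurable_pair_comb a b : measurable_fun setT (pair_comb a b).
Proof.
apply: measurable_rVD.
  exact: measurableT_comp (measurable_scaled a) measurable_fst.
exact: measurableT_comp (measurable_scaled b) measurable_snd.
Qed.

Lemma mgf_pair a b (c : 'rV[R]_k) :
  (\int[P \x P]_w (expR (dot c (pair_comb a b w)))%:E = (expR ((a ^+ 2 + b ^+ 2) * q c))%:E)%E.
Proof.
rewrite fubini_tonelli1//=; last first.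
  apply/measurable_EFinP; exact: measurable_expR_dot (measurable_pair_comb a b) c.
rewrite /fubini_F /=.
transitivity (\int[P]_w1 ((expR (b ^+ 2 * q c))%:E * (expR (dot c (a *: (X w1 : 'rV_k))))%:E))%E.
  apply: eq_integral => w _; rewrite -mgf_scaled -ge0_integralZr//.
  - by apply: eq_integral => w' _; rewrite /pair_comb /= dotDr expRD EFinM muleC.
  - by apply/measurable_EFinP; exact: measurable_expR_dot (measurable_scaled b) c.
rewrite ge0_integralZl//; last by apply/measurable_EFinP; exact: measurable_expR_dot (measurable_scaled a) c.
by rewrite mgf_scaled -EFinM -expRD -mulrDl addrC.
Qed.

Lemma semigroup_integral a b c (h : borel_rV k -> \bar R) : a ^+ 2 + b ^+ 2 = c ^+ 2 ->
  measurable_fun setT h -> (forall x, 0 <= h x)%E ->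
  (\int[P]_w h (c *: (X w : 'rV_k)) = \int[P]_w1 \int[P]_w2 h (pair_comb a b (w1, w2)))%E.
Proof.
move=> abc mh h0.
rewrite (@integral_unique _ _ _ _ _ _ P (P \x P)%E (fun w => c *: (X w : 'rV_k)) (pair_comb a b)
  (measurable_scaled c) (measurable_pair_comb a b) _ _ h mh h0); last 2 first.
- by move=> e; rewrite mgf_scaled ltry.
- by move=> e; rewrite mgf_scaled mgf_pair abc.
by rewrite fubini_tonelli1//; exact: measurableT_comp mh (measurable_pair_comb a b).
Qed.

Lemma l1_lipschitz_measurable (f : 'rV[R]_k -> R) L : 0 <= L -> l1_lipschitz f L ->
  measurable_fun setT (f : borel_rV k -> R).
Proof.
move=> L0 Lf; pose C := L * k%:R + 1.
have C0 : 0 < C by rewrite ltr_wpDl// mulr_ge0.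
rewrite (_ : f = (fun x => C * (f x / C))); last first.
  by apply/funext => x; rewrite mulrC divfK// gt_eqF.
apply: measurable_funM => //; apply: lipschitz_measurable => x y.
rewrite -mulrBl normrM [X in _ * X]gtr0_norm ?invr_gt0// ler_pdivrMr//.
have := Lf y (x - y); rewrite (addrC y) subrK => /le_trans; apply.
rewrite (@le_trans _ _ (L * (k%:R * enorm (x - y))))//.
  apply: ler_wpM2l => //; rewrite /l1 mulr_natl -[k in _ *+ k]card_ord -sumr_const.
  by apply: ler_sum => i _; exact: coord_le_enorm.
by rewrite mulrA mulrC ler_wpM2l ?enorm_ge0// lerDl.
Qed.

Lemma lipschitz_translate (f : 'rV[R]_k -> R) L s : l1_lipschitz f L -> l1_lipschitz (fun x => f (s + x)) L.
Proof. by move=> Lf x h; rewrite addrA. Qed.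

Lemma semigroup_Rintegral a b c (f : 'rV[R]_k -> R) L s : a ^+ 2 + b ^+ 2 = c ^+ 2 ->
  0 <= L -> l1_lipschitz f L ->
  \int[P]_w f (s + c *: (X w : 'rV_k)) = \int[P]_w1 \int[P]_w2 f (s + a *: (X w1 : 'rV_k) + b *: (X w2 : 'rV_k)).
Proof.
move=> abc L0 Lf; have Lg := lipschitz_translate s Lf.
have mf := l1_lipschitz_measurable L0 Lf; have mg := l1_lipschitz_measurable L0 Lg.
have mZ := measurable_pair_comb a b.
rewrite (@Rintegral_unique _ _ _ _ _ _ P (P \x P)%E (fun w => c *: (X w : 'rV_k)) (pair_comb a b)
  (measurable_scaled c) mZ _ _ (fun x => f (s + x)) mg); last 2 first.
- by move=> e; rewrite mgf_scaled ltry.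
- by move=> e; rewrite mgf_scaled mgf_pair abc.
have mgfZ (e : 'rV[R]_k) : (\int[P \x P]_w (expR (dot e (pair_comb a b w)))%:E < +oo)%E by rewrite mgf_pair ltry.
have eZ : exp_bounded (pair_comb a b) (fun w => f (s + 1 *: (pair_comb a b w : 'rV_k))).
  exact: exp_bounded_lipschitz Lf.
have := exp_bounded_integrable mZ mgfZ eZ; under eq_fun do rewrite /= scale1r.
move=> iZ; rewrite /Rintegral -(integral12_prod_meas1 iZ); congr fine.
apply: eq_integral => w1 _; rewrite /fubini_F /=.
have e2 := exp_bounded_lipschitz mX (s + a *: (X w1 : 'rV_k)) b L0 mf Lf.
rewrite fineK; last exact: integrable_fin_num (exp_bounded_integrable mX mgf_lty e2).
by apply: eq_integral => w2 _; rewrite /pair_comb /= addrA.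
Qed.

Lemma l1_delta (i : 'I_k) (a : R) : l1 (a *: delta_mx 0 i : 'rV[R]_k) = `|a|.
Proof.
rewrite l1Z /l1 (bigD1 i)//= mxE !eqxx normr1 big1 ?addr0 ?mulr1// => j ji.
by rewrite mxE eqxx (negbTE ji) normr0.
Qed.

(** The gradient is chosen pointwise, but its coordinates are limits of difference quotients of f,
    hence measurable and fit to be averaged. *)
Lemma measurable_expansion (f : 'rV[R]_k -> R) L K p i : 0 <= L -> 0 <= K -> l1_lipschitz f L ->
  (forall x, l1_expansion f x (p x) K) -> measurable_fun setT (fun x : borel_rV k => p x 0 i : R).
Proof.
move=> L0 K0 Lf fp; have mf := l1_lipschitz_measurable L0 Lf.
pose e n : 'rV[R]_k := n.+1%:R^-1 *: delta_mx 0 i.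
apply: (@measurable_fun_cvg _ _ _ _ (fun n (x : borel_rV k) => n.+1%:R * (f ((x : 'rV_k) + e n) - f x))).
  move=> n; apply: measurable_funM => //; apply: measurable_funB => //.
  exact: measurableT_comp mf (measurable_translate _).
move=> x _; apply/subr_cvg0/norm_cvg0P.
apply: (@squeeze_cvgr _ _ _ _ (fun=> 0) (fun n => K * expR K * harmonic n)).
- near=> n; rewrite normr_ge0/=.
  have n0 : 0 < n.+1%:R :> R by [].
  have := fp x (e n); rewrite l1_delta dotZr dot_delta (ger0_norm (_ : 0 <= n.+1%:R^-1)) ?invr_ge0// => H.
  rewrite (_ : _ - p x 0 i = n.+1%:R * (f (x + e n) - f x - n.+1%:R^-1 * p x 0 i)); last by field; rewrite gt_eqF.
  rewrite normrM gtr0_norm//; apply: (@le_trans _ _ (n.+1%:R * (K * n.+1%:R^-1 ^+ 2 * expR K))).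
    rewrite ler_wpM2l//; apply: le_trans H _; rewrite ler_wpM2l ?mulr_ge0 ?sqr_ge0//.
    by rewrite ler_expR ler_piMr// invf_le1// ler1n.
  by rewrite le_eqVlt; apply/orP; left; apply/eqP; field; rewrite gt_eqF.
- exact: cvg_cst.
- rewrite -[X in _ --> X](mulr0 (K * expR K)); apply: cvgMr; exact: cvg_harmonic.
Unshelve. all: by end_near.
Qed.

Lemma exp_bounded_norm (g : T -> R) : exp_bounded X g -> exp_bounded X (fun w => `|g w|).
Proof.
move=> [mg [C C0 H]]; split; first exact: measurableT_comp.
by exists C => // w; rewrite normr_id.
Qed.

Lemma exp_bounded_norm_Rintegral_le (g : T -> R) B : exp_bounded X g -> (forall w, `|g w| <= B) ->
  `|\int[P]_w g w| <= B.
Proof.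
move=> eg gB.
apply: le_trans (le_normr_Rintegral measurableT (exp_bounded_integrable mX mgf_lty eg)) _.
rewrite -(Rintegral_cst_prob P B); apply: (exp_bounded_le_Rintegral mX mgf_lty) => //.
- exact: exp_bounded_norm.
- exact: exp_bounded_cst.
Qed.

(** The constants L and K do not deteriorate, which lets the step be iterated any number of times.
    The gradient of the average is the mean gradient. *)
Lemma l1_smooth_average (f : 'rV[R]_k -> R) L K u : 0 <= L -> 0 <= K -> l1_smooth f L K ->
  l1_smooth (fun x => \int[P]_w f (x + u *: (X w : 'rV_k))) L K.
Proof.
move=> L0 K0 [Lf fe]; have mf := l1_lipschitz_measurable L0 Lf.
have ef x : exp_bounded X (fun w => f (x + u *: (X w : 'rV_k))) by exact: exp_bounded_lipschitz Lf.
split.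
  move=> x h; have : exp_bounded X (fun w => f (x + h + u *: (X w : 'rV_k)) - f (x + u *: (X w : 'rV_k))).
    exact: exp_boundedB.
  move=> eB; rewrite [X in X - _](_ : _ = \int[P]_w (f (x + u *: (X w : 'rV_k)) +
     (f (x + h + u *: (X w : 'rV_k)) - f (x + u *: (X w : 'rV_k))))); last first.
    by apply: eq_Rintegral => w _; rewrite [RHS]addrC subrK.
  rewrite (exp_bounded_RintegralD mX mgf_lty)// addrC addKr.
  by apply: exp_bounded_norm_Rintegral_le => // w; rewrite addrAC Lf.
pose p x := sval (cid2 (fe x)).
have pL x : l1 (p x) <= L by rewrite /p; case: cid2.
have pe x : l1_expansion f x (p x) K by rewrite /p; case: cid2.
have mp := measurable_expansion _ L0 K0 Lf pe.
move=> x; pose Y w := x + u *: (X w : 'rV_k).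
have mY : measurable_fun setT (Y : T -> borel_rV k) by exact: measurable_affine.
have ep i : exp_bounded X (fun w => p (Y w) 0 i).
  apply: (exp_bounded_le _ (exp_bounded_cst X L)) => [|w]; first exact: measurableT_comp (mp i) mY.
  exact: le_trans (coord_le_l1 _ _) (pL _).
have eap i : exp_bounded X (fun w => `|p (Y w) 0 i|).
  exact: exp_bounded_norm.
exists (\row_i \int[P]_w p (Y w) 0 i).
  rewrite /l1; apply: (@le_trans _ _ (\sum_i \int[P]_w `|p (Y w) 0 i|)).
    apply: ler_sum => i _; rewrite mxE.
    exact: le_normr_Rintegral measurableT (exp_bounded_integrable mX mgf_lty (ep i)).
  rewrite -(Rintegral_sum_exp_bounded mX mgf_lty)// -(Rintegral_cst_prob P L).
  apply: (exp_bounded_le_Rintegral mX mgf_lty) => [||w]; [exact: exp_bounded_sum|exact: exp_bounded_cst|exact: pL].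
move=> h; pose E w := f (Y w + h) - f (Y w) - dot (p (Y w)) h.
have efh : exp_bounded X (fun w => f (Y w + h)).
  by apply: exp_bounded_ext (ef (x + h)) _ => w; rewrite /Y addrAC.
have ed : exp_bounded X (fun w => dot (p (Y w)) h).
  by apply: exp_bounded_sum => i; apply: exp_bounded_ext (exp_boundedZ (h 0 i) (ep i)) _ => w; rewrite mulrC.
have eE : exp_bounded X E by apply: exp_boundedB => //; apply: exp_boundedB => //; exact: ef.
have -> : \int[P]_w f (x + h + u *: (X w : 'rV_k)) - \int[P]_w f (x + u *: (X w : 'rV_k)) -
    dot (\row_i \int[P]_w p (Y w) 0 i) h = \int[P]_w E w.
  have -> : dot (\row_i \int[P]_w p (Y w) 0 i) h = \int[P]_w dot (p (Y w)) h.
    rewrite /dot (Rintegral_sum_exp_bounded mX mgf_lty); last first.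
      by move=> i; apply: exp_bounded_ext (exp_boundedZ (h 0 i) (ep i)) _ => w; rewrite mulrC.
    apply: eq_bigr => i _; rewrite mxE mulrC -(exp_bounded_RintegralZ mX mgf_lty)//.
    by apply: eq_Rintegral => w _; rewrite mulrC.
  have -> : \int[P]_w f (x + h + u *: (X w : 'rV_k)) =
      \int[P]_w (E w + f (x + u *: (X w : 'rV_k)) + dot (p (Y w)) h).
    by apply: eq_Rintegral => w _; rewrite /E /Y addrAC; ring.
  rewrite (exp_bounded_RintegralD mX mgf_lty)//; last exact: exp_boundedD.
  rewrite (exp_bounded_RintegralD mX mgf_lty)//; ring.
by apply: exp_bounded_norm_Rintegral_le => // w; exact: pe.
Qed.

(* A Gaussian vector satisfies the semigroup law: (a ^+ 2 + b ^+ 2) ^ (1/2) X has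
   the law of a X + b X' with X' an independent copy of X. *)
Lemma exp_moment_iterate L K v : 0 <= L -> 0 <= K -> 0 <= v -> (forall i, \int[P]_w (X w 0 i ^+ 2) <= v) ->
  exists2 C, 0 <= C & forall u, 0 <= u <= 1 -> forall (j : nat) (f : 'rV[R]_k -> R) s,
    l1_smooth f L K ->
    \int[P]_w expR (f (s + (u * Num.sqrt j%:R) *: (X w : 'rV_k))) <=
    (1 + u ^+ 2 * (L ^+ 2 * v / 2) + u ^+ 3 * C) ^+ j *
      expR (\int[P]_w f (s + (u * Num.sqrt j%:R) *: (X w : 'rV_k))).
Proof.
move=> L0 K0 v0 Xv; have [C C0 HC] := exp_moment_step mX mgf_lty L0 K0 v0 Xv.
exists C => // u u01; have /andP[u0 u1] := u01.
set B := 1 + _ + _; have B0 : 0 <= B.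
  by rewrite !addr_ge0// mulr_ge0 ?exprn_ge0// divr_ge0// mulr_ge0 ?exprn_ge0.
elim=> [|j IH] f s [Lf fe].
  rewrite sqrtr0 mulr0 expr0 mul1r.
  under eq_Rintegral do rewrite scale0r addr0.
  under [X in _ <= expR X]eq_Rintegral do rewrite scale0r addr0.
  by have E c := Rintegral_cst_prob P c; rewrite /cst in E; rewrite !E.
have mf := l1_lipschitz_measurable L0 Lf.
pose c := u * Num.sqrt j.+1%:R; pose a := u * Num.sqrt j%:R.
have abc : a ^+ 2 + u ^+ 2 = c ^+ 2.
  by rewrite !exprMn !sqr_sqrtr// -{2}[u ^+ 2]mulr1 -mulrDr -natr1.
pose g x := \int[P]_w f (x + u *: (X w : 'rV_k)).
have sg : l1_smooth g L K by exact: l1_smooth_average.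
have [Lg _] := sg; have mg := l1_lipschitz_measurable L0 Lg.
have eef x r : exp_bounded X (fun w => expR (f (x + r *: (X w : 'rV_k)))) by exact: exp_bounded_exp_lipschitz Lf.
have eeg x r : exp_bounded X (fun w => expR (g (x + r *: (X w : 'rV_k)))) by exact: exp_bounded_exp_lipschitz Lg.
have finE (h : T -> R) : exp_bounded X h -> (\int[P]_w (h w)%:E = (\int[P]_w h w)%:E)%E.
  by move=> eh; rewrite /Rintegral fineK//; exact: integrable_fin_num (exp_bounded_integrable mX mgf_lty eh).
have -> : \int[P]_w f (s + c *: (X w : 'rV_k)) = \int[P]_w g (s + a *: (X w : 'rV_k)).
  exact: semigroup_Rintegral abc L0 Lf.
rewrite -lee_fin -finE; last exact: eef.
pose h (x : borel_rV k) : \bar R := (expR (f (s + (x : 'rV_k))))%:E.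
have mh : measurable_fun setT h.
  apply/measurable_EFinP; apply: measurableT_comp => //.
  exact: l1_lipschitz_measurable (lipschitz_translate s Lf).
rewrite (semigroup_integral (h := h) abc mh); last by move=> x; rewrite lee_fin expR_ge0.
have mZ := measurable_pair_comb a u.
(* The inner integral is one step of size u from a random position. It replaces f by its average g,
   to which the induction hypothesis applies. *)
apply: (@le_trans _ _ (\int[P]_w (B * expR (g (s + a *: (X w : 'rV_k))))%:E)%E).
  apply: ge0_le_integral => //.
  - by move=> w _; apply: integral_ge0 => w' _; rewrite lee_fin expR_ge0.
  - apply: (measurable_fun_fubini_tonelli_F (fun w => h (pair_comb a u w))).
      exact: measurableT_comp mh mZ.
    by move=> w; rewrite lee_fin expR_ge0.
  - apply/measurable_EFinP; apply: measurable_funM => //; by case: (eeg s a).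
  - move=> w _; rewrite (_ : (\int[P]_w2 _)%E =
        (\int[P]_w2 expR (f (s + a *: (X w : 'rV_k) + u *: (X w2 : 'rV_k))))%:E).
      rewrite lee_fin; have [p pL pe] := fe (s + a *: (X w : 'rV_k)).
      by apply: HC u01 mf Lf pL pe _ => i; exact: centered_coord.
    rewrite -finE; last exact: eef.
    by apply: eq_integral => w2 _; rewrite /h /pair_comb /fst /snd addrA.
rewrite finE; last exact: exp_boundedZ.
rewrite (exp_bounded_RintegralZ mX mgf_lty)// lee_fin exprS -mulrA; apply: ler_wpM2l => //.
exact: IH.
Qed.

Lemma gaussian_exp_concentration L K v (f : 'rV[R]_k -> R) : 0 <= L -> 0 <= K -> 0 <= v ->
  (forall i, \int[P]_w (X w 0 i ^+ 2) <= v) -> l1_smooth f L K ->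
  \int[P]_w expR (f (X w)) <= expR (L ^+ 2 * v / 2 + \int[P]_w f (X w)).
Proof.
move=> L0 K0 v0 Xv sf; have [C C0 HC] := exp_moment_iterate L0 K0 v0 Xv.
set A := L ^+ 2 * v / 2; set m := \int[P]_w f (X w); set Y := \int[P]_w expR _.
have A0 : 0 <= A by rewrite divr_ge0// mulr_ge0 ?exprn_ge0.
have H M : Y <= expR (A + C * M.+1%:R^-1 + m).
  pose u : R := M.+1%:R^-1.
  have u0 : 0 <= u by rewrite invr_ge0.
  have u1 : u <= 1 by rewrite invf_le1// ler1n.
  have Mu : M.+1%:R * u = 1 by rewrite mulfV.
  have E1 : u * Num.sqrt (M.+1 ^ 2)%:R = 1 by rewrite natrX sqrtr_sqr ger0_norm// mulrC.
  (* (M + 1)^2 steps of size 1 / (M + 1) have total scale 1, and their cubic errors add up to C / (M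
     + 1). *)
  have := HC u _ (M.+1 ^ 2)%N f 0 sf; rewrite u0 u1 E1 => /(_ isT).
  under eq_Rintegral do rewrite add0r scale1r.
  under [X in _ <= _ * expR X]eq_Rintegral do rewrite add0r scale1r.
  move=> /le_trans; apply; rewrite expRD; apply: ler_wpM2r; first exact: expR_ge0.
  have B0 : 0 <= 1 + u ^+ 2 * A + u ^+ 3 * C.
    by rewrite !addr_ge0// mulr_ge0 ?exprn_ge0.
  apply: (@le_trans _ _ (expR (u ^+ 2 * A + u ^+ 3 * C) ^+ (M.+1 ^ 2))).
    apply: lerXn2r; rewrite ?nnegrE ?expR_ge0//.
    by rewrite -addrA expR_ge1Dx.
  rewrite -expRM_natl ler_expR natrX le_eqVlt; apply/orP; left; apply/eqP.
  rewrite -/u (_ : _ * _ = (M.+1%:R * u) ^+ 2 * A + (M.+1%:R * u) ^+ 2 * u * C); last by ring.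
  by rewrite Mu expr1n !mul1r [u * C]mulrC.
apply: (@le_expR_harmonic _ C) => // M; rewrite addrAC; exact: H.
Qed.

(** Chernoff's bound for soft maxima, with beta tending to infinity. The integrable majorant [G]
    fixes m independently of the number k of coordinates, so that k can later tend to infinity. *)
Lemma gaussian_sup_tail (G : T -> \bar R) (m v u : R) : 0 < v -> m < u ->
  (forall i, \int[P]_w (X w 0 i ^+ 2) <= v) -> P.-integrable setT G ->
  (forall i w, ((X w 0 i)%:E <= G w)%E) -> (\int[P]_w G w <= m%:E)%E ->
  (P [set w | exists i, (u <= X w 0 i)%R] <= (expR (- (u - m) ^+ 2 / (2 * v)))%:E)%E.
Proof.
move=> v0 mu Xv iG XG Gm; have [k0|k0] := posnP k.
  rewrite (_ : [set w | _] = set0) ?measure0 ?lee_fin ?expR_ge0//.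
  by apply/seteqP; split => // w [i _]; have := ltn_ord i; rewrite [X in (_ < X)%N]k0.
set A := [set w | _]; have mA : measurable A.
  rewrite (_ : A = \bigcup_(i in [set: 'I_k]) (fun w => X w 0 i) @^-1` [set` `[u, +oo[]); last first.
    apply/seteqP; split => w; first by case=> i ui; exists i => //=; rewrite in_itv/= ui.
    by case=> i _ /=; rewrite in_itv/= andbT; exists i.
  apply: fin_bigcup_measurable => // i _; rewrite -[X in measurable X]setTI.
  by apply: measurableT_comp (measurable_coord i) mX measurableT _ _; exact: measurable_itv.
(* The minimizer of lam^2 v / 2 - lam (u - m). *)
pose lam := (u - m) / v; have lam0 : 0 < lam by rewrite divr_gt0// subr_gt0.
have l0 := ltW lam0.
have PA : (P A = (fine (P A))%:E)%E by rewrite fineK// fin_num_measure.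
rewrite PA lee_fin; apply: (@le_expR_harmonic _ (lam * ln k%:R)) => [|M].
  by rewrite mulr_ge0// ln_ge0// ler1n.
pose beta : R := M.+1%:R; have b0 : 0 < beta by rewrite ltr0n.
have sm := l1_smooth_softmax k0 l0 b0.
have K0 : 0 <= lam * beta + beta by apply: addr_ge0; [apply: mulr_ge0 => //|]; exact: ltW.
have [Lf _] := sm; have mf := l1_lipschitz_measurable l0 Lf.
have ef : exp_bounded X (fun w => softmax lam beta (X w)).
  by apply: exp_bounded_ext (exp_bounded_lipschitz mX 0 1 l0 mf Lf) _ => w; rewrite add0r scale1r.
have eef : exp_bounded X (fun w => expR (softmax lam beta (X w))).
  by apply: exp_bounded_ext (exp_bounded_exp_lipschitz mX 0 1 l0 mf Lf) _ => w; rewrite add0r scale1r.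
have Em : \int[P]_w softmax lam beta (X w) <= lam * m + lam * ln k%:R / beta.
  have iX := exp_bounded_integrable mX mgf_lty ef.
  have Efin : (\int[P]_w (softmax lam beta (X w))%:E = (\int[P]_w softmax lam beta (X w))%:E)%E.
    by rewrite /Rintegral fineK//; exact: integrable_fin_num iX.
  rewrite -lee_fin -Efin.
  have iG' : P.-integrable setT (fun w => lam%:E * G w)%E by exact: integrableZl.
  have ic : P.-integrable setT (fun w : T => (lam * ln k%:R / beta)%:E).
    exact: finite_measure_integrable_cst.
  apply: (@le_trans _ _ (\int[P]_w (lam%:E * G w + (lam * ln k%:R / beta)%:E))%E).
    apply: le_integral => //; first exact: integrableD.
    move=> w _; have [i Hi] := softmax_le (X w) k0 l0 b0.
    apply: (@le_trans _ _ (lam * X w 0 i + lam * ln k%:R / beta)%:E); first by rewrite lee_fin.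
    by rewrite EFinD EFinM leeD2r// lee_wpmul2l// lee_fin.
  have P1 := @probability_setT _ _ _ P.
  rewrite integralD// integralZl// integral_cst// [X in (_ + _ * X <= _)%E]P1 mule1 EFinD.
  by apply: leeD2r; rewrite (EFinM lam m); apply: lee_wpmul2l => //; rewrite lee_fin.
have H := gaussian_exp_concentration l0 K0 (ltW v0) Xv sm.
apply: (@le_trans _ _ (expR (- (lam * u)) * \int[P]_w expR (softmax lam beta (X w)))).
  have Efin : (\int[P]_w (expR (- (lam * u)) * expR (softmax lam beta (X w)))%:E =
     (expR (- (lam * u)) * \int[P]_w expR (softmax lam beta (X w)))%:E)%E.
    rewrite -(exp_bounded_RintegralZ mX mgf_lty)// /Rintegral fineK//.
    exact: integrable_fin_num (exp_bounded_integrable mX mgf_lty (exp_boundedZ _ eef)).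
  rewrite -lee_fin -PA -Efin -(setIT A) -integral_indic//.
  apply: ge0_le_integral => //.
  - exact/measurable_EFinP.
  - by apply/measurable_EFinP; apply: measurable_funM => //; case: eef.
  move=> w _; rewrite lee_fin indicE; have [|] := boolP (w \in A); last by rewrite mulr_ge0 ?expR_ge0.
  rewrite inE => -[i ui]; rewrite -expRD -expR0 ler_expR addrC subr_ge0.
  by apply: le_trans (le_softmax _ i l0 b0); rewrite ler_wpM2l.
apply: le_trans (ler_wpM2l (expR_ge0 _) H) _; rewrite -expRD ler_expR.
have -> : - (u - m) ^+ 2 / (2 * v) + lam * ln k%:R * M.+1%:R^-1 =
  - (lam * u) + (lam ^+ 2 * v / 2 + (lam * m + lam * ln k%:R / beta)).
  by rewrite /lam /beta; field; rewrite gt_eqF//= gt_eqF// ltr0n.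
by rewrite lerD2l lerD2l.
Qed.

End gaussian_concentration.

(** * Suprema of Gaussian sequences *)

Section gaussian_vector_mgf.
Context {R : realType} {d} {T : measurableType d} {k : nat}.
Variables (P : probability T R) (Y : 'I_k -> T -> R).
Hypothesis mY : forall i, measurable_fun setT (Y i).
Hypothesis gY : gaussian_vector P Y.
Hypothesis EY : forall i, 'E_P[Y i]%E = 0%E.

Definition row_of (w : T) : borel_rV (R:=R) k := \row_i Y i w.

Lemma measurable_row_of : measurable_fun setT row_of.
Proof.
apply: measurable_to_rV => i; rewrite (_ : (fun _ => _) = Y i); first exact: mY.
by apply/funext => w; rewrite mxE.
Qed.

Lemma dot_row_of (c : 'rV[R]_k) w : dot c (row_of w) = \sum_i c 0 i * Y i w.
Proof. by apply: eq_bigr => i _; rewrite mxE. Qed.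

Lemma measurable_dot_row_of (c : 'rV[R]_k) : measurable_fun setT (fun w => dot c (row_of w)).
Proof.
apply: measurable_sum => i; apply: measurable_funM => //.
exact: measurableT_comp (measurable_coord i) measurable_row_of.
Qed.

Lemma dot_row_of_mgf (c : 'rV[R]_k) : exists m s : R, forall a : R,
  (\int[P]_w (expR (a * dot c (row_of w)))%:E = (expR (a * m + a ^+ 2 * s ^+ 2 / 2))%:E)%E.
Proof.
have [m [s H]] := gY (fun i => c 0 i); exists m, s => a.
apply: gaussian_mgf; first exact: measurable_dot_row_of.
by under eq_fun do rewrite dot_row_of.
Qed.

Lemma row_of_mgf_lty (c : 'rV[R]_k) : (\int[P]_w (expR (dot c (row_of w)))%:E < +oo)%E.
Proof.
have [m [s H]] := dot_row_of_mgf c; have := H 1.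
by under eq_integral do rewrite mul1r; move=> ->; rewrite ltry.
Qed.

Lemma mean_dot_row_of (c : 'rV[R]_k) : \int[P]_w dot c (row_of w) = 0.
Proof.
have mX := measurable_row_of; have eX i := exp_bounded_coord mX i.
rewrite (Rintegral_sum_exp_bounded mX row_of_mgf_lty); last by move=> i; exact: exp_boundedZ.
rewrite big1// => i _; rewrite (exp_bounded_RintegralZ mX row_of_mgf_lty)//.
rewrite (_ : \int[P]_w row_of w 0 i = 0) ?mulr0//.
have := EY i; rewrite unlock /Rintegral => H.
by rewrite [X in fine X](_ : _ = 0%E)// -H; apply: eq_integral => w _; rewrite mxE.
Qed.

(** The inequality e^(b Z) >= 1 + b Z for the centered variable Z gives b m + b^2 s^2 / 2 >= 0 for
    every b, which forces m = 0. *)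
Lemma centered_dot_row_of_mgf (c : 'rV[R]_k) : exists s : R, forall a : R,
  (\int[P]_w (expR (a * dot c (row_of w)))%:E = (expR (a ^+ 2 * s ^+ 2 / 2))%:E)%E.
Proof.
have mX := measurable_row_of; have fX := row_of_mgf_lty.
have [m [s H]] := dot_row_of_mgf c; exists s => a.
suff m0 : m = 0 by rewrite H m0 mulr0 add0r.
have pos (b : R) : 0 <= b * m + b ^+ 2 * s ^+ 2 / 2.
  rewrite -ler_expR expR0 -lee_fin -H.
  have ed : exp_bounded row_of (fun w => b * dot c (row_of w)).
    by apply/exp_boundedZ/exp_bounded_sum => i; apply/exp_boundedZ; exact: exp_bounded_coord.
  have <- : (\int[P]_w (1 + b * dot c (row_of w))%:E = 1)%E.
    have e1 : exp_bounded row_of (fun w => 1 + b * dot c (row_of w)).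
      by apply: exp_boundedD => //; exact: exp_bounded_cst.
    rewrite -[LHS]fineK; last exact: integrable_fin_num (exp_bounded_integrable mX fX e1).
    rewrite -/(Rintegral _ _ _) (exp_bounded_RintegralD mX fX)//; last exact: exp_bounded_cst.
    rewrite (exp_bounded_RintegralZ mX fX); last first.
      by apply: exp_bounded_sum => i; apply/exp_boundedZ; exact: exp_bounded_coord.
    by have := Rintegral_cst_prob P 1; rewrite /cst => ->; rewrite mean_dot_row_of mulr0 addr0.
  apply: le_integral => //.
  - apply: (exp_bounded_integrable mX fX); apply: exp_boundedD => //; exact: exp_bounded_cst.
  - have := integrable_expR_dot mX fX (b *: c); under eq_fun do rewrite dotZl; exact.
  - by move=> w _; rewrite lee_fin expR_ge1Dx.
have [s0|s0] := eqVneq s 0.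
  by have := pos 1; have := pos (-1); rewrite s0 expr0n/= !mulr0 mul0r; lra.
(* The minimizer of the quadratic in b. *)
have := pos (- m / s ^+ 2); rewrite [X in 0 <= X](_ : _ = - (m ^+ 2 / (2 * s ^+ 2))); last by field.
rewrite oppr_ge0 => H0; apply/eqP; rewrite -sqrf_eq0 eq_le sqr_ge0 andbT.
by move: H0; rewrite pmulr_lle0// invr_gt0 mulr_gt0// exprn_even_gt0.
Qed.

(** Half the variance of c . Y, read off from the moment generating function rather than from a
    covariance matrix. *)
Definition cumulant (c : 'rV[R]_k) : R := ln (fine (\int[P]_w (expR (dot c (row_of w)))%:E)%E).

Lemma cumulantE (c : 'rV[R]_k) :
  (\int[P]_w (expR (dot c (row_of w)))%:E = (expR (cumulant c))%:E)%E.
Proof.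
have [s H] := centered_dot_row_of_mgf c; have := H 1; rewrite /cumulant.
by under eq_integral do rewrite mul1r; move=> ->; rewrite expRK.
Qed.

Lemma cumulantZ a (c : 'rV[R]_k) : cumulant (a *: c) = a ^+ 2 * cumulant c.
Proof.
have [s H] := centered_dot_row_of_mgf c; have := H 1; have := H a; rewrite /cumulant.
under eq_integral do rewrite -dotZl; move=> ->.
by under eq_integral do rewrite mul1r; move=> ->; rewrite !expRK/=; ring.
Qed.

End gaussian_vector_mgf.

(** * Second moment and positive part of a centered Gaussian variable *)

Section half_moment.
Context {R : realType}.

Let nu : probability (measurableTypeR R) R := normal_prob 0 1.

(** Real variables become vectors of dimension 1, to which the uniqueness of laws applies. *)
Definition singleton_row (x : R) : 'rV[R]_1 := \row_i x.

Lemma dot_singleton (c : 'rV[R]_1) x : dot c (singleton_row x) = c 0 0 * x.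
Proof. by rewrite /dot big_ord1 mxE. Qed.

Lemma measurable_singleton_row d (T : measurableType d) (f : T -> R) : measurable_fun setT f ->
  measurable_fun setT (fun w => singleton_row (f w) : borel_rV 1).
Proof.
move=> mf; apply: measurable_to_rV => i.
by rewrite (_ : (fun _ => _) = f)//; apply/funext => w; rewrite mxE.
Qed.

Lemma std_normal_mgf (a : R) : (\int[nu]_x (expR (a * x))%:E = (expR (a ^+ 2 / 2))%:E)%E.
Proof. by rewrite normal_mgf ?oner_eq0// mulr0 add0r expr1n mulr1. Qed.

Let mZ : measurable_fun setT (fun x : measurableTypeR R => singleton_row x : borel_rV 1).
Proof. exact: measurable_singleton_row. Qed.

Let fZ (c : 'rV[R]_1) : (\int[nu]_x (expR (dot c (singleton_row x)))%:E < +oo)%E.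
Proof. by under eq_integral do rewrite dot_singleton; rewrite std_normal_mgf ltry. Qed.

Let eZ : exp_bounded (fun x : measurableTypeR R => singleton_row x : borel_rV 1) (fun x : measurableTypeR R => x).
Proof. by apply: exp_bounded_ext (exp_bounded_coord mZ 0) _ => x; rewrite mxE. Qed.

Lemma exp_bounded_pos_part d (T : measurableType d) k (X : T -> borel_rV k) (g : T -> R) :
  exp_bounded X g -> exp_bounded X (fun w => Num.max 0 (g w)).
Proof.
move=> eg; have [mg _] := eg; apply: (exp_bounded_le _ (exp_bounded_norm eg)); first exact: measurable_maxr.
by move=> w; case: (leP 0 (g w)) => h; rewrite ?normr0.
Qed.

Definition std_half_moment : R := \int[nu]_x Num.max 0 x.

Definition std_second_moment : R := \int[nu]_x (x ^+ 2).

(* Otherwise, taking expectations in e^z <= 1 + e^4 z^+ + e^-4 e^(2z) would give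
   e^(1/2) <= 1 + e^-2. *)
Lemma std_half_moment_gt0 : 0 < std_half_moment.
Proof.
rewrite lt_neqAle; apply/andP; split; last first.
  by apply: Rintegral_ge0 => x _; rewrite le_max lexx.
apply/eqP => m0.
have e2 : 2 <= expR 1 :> R by have := expR_ge1Dx (1 : R); lra.
(* Three ranges: z <= 0; 0 < z <= 4, where e^z - 1 <= z e^4; and z > 4, where e^z <= e^-4 e^(2
   z). *)
have pt (z : R) : expR z <= 1 + expR 4 * Num.max 0 z + expR (-4) * expR (2 * z).
  have p0 := expR_ge0 (2 * z); have q0 := expR_ge0 (-4 : R).
  have [z0|z0] := leP z 0.
    rewrite mulr0 addr0; apply: ler_wpDr; first exact: mulr_ge0.
    by rewrite -expR0 ler_expR.
  have [z4|z4] := leP z 4.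
    apply: ler_wpDr; first exact: mulr_ge0.
    have : expR z - 1 <= z * expR z.
      have := expR_ge1Dx (- z); rewrite expRN => h.
      have e0 := expR_gt0 z; have : (1 - z) * expR z <= 1 by rewrite -ler_pdivlMr// div1r.
      lra.
    have : z * expR z <= z * expR 4 by rewrite ler_wpM2l ?(ltW z0)// ler_expR.
    lra.
  have : expR z <= expR (-4) * expR (2 * z) by rewrite -expRD ler_expR; lra.
  have : 0 <= expR 4 * z by rewrite mulr_ge0 ?expR_ge0// ltW.
  lra.
have finE (h : R -> R) : exp_bounded (fun x : measurableTypeR R => singleton_row x : borel_rV 1) h ->
    (\int[nu]_w (h w)%:E = (\int[nu]_w h w)%:E)%E.
  by move=> eh; rewrite /Rintegral fineK//; exact: integrable_fin_num (exp_bounded_integrable mZ fZ eh).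
have ee (a : R) : exp_bounded (fun x : measurableTypeR R => singleton_row x : borel_rV 1) (fun x : measurableTypeR R => expR (a * x)).
  split; first by apply: measurableT_comp => //; exact: measurable_funM.
  exists (`|a| + 1); first by rewrite addr_ge0.
  move=> x; rewrite ger0_norm ?expR_ge0// /l1 big_ord1 mxE.
  apply: (@le_trans _ _ (expR ((`|a| + 1) * `|x|))).
    rewrite ler_expR; apply: le_trans (ler_norm _) _; rewrite normrM ler_wpM2r//; lra.
  by rewrite ler_peMl ?expR_ge0// lerDr.
have Ee (a : R) : \int[nu]_x expR (a * x) = expR (a ^+ 2 / 2).
  by apply/EFin_inj; rewrite -finE// std_normal_mgf.
have e1 : exp_bounded (fun x : measurableTypeR R => singleton_row x : borel_rV 1) (fun x : measurableTypeR R => expR x).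
  by apply: exp_bounded_ext (ee 1) _ => x; rewrite mul1r.
have ep := exp_bounded_pos_part eZ.
have h1 : \int[nu]_x expR x = expR (1 / 2).
  by rewrite -[X in X / 2](expr1n _ 2) -Ee; apply: eq_Rintegral => x _; rewrite mul1r.
have : \int[nu]_x expR x <= \int[nu]_x (cst 1 x + expR 4 * Num.max 0 x + expR (-4) * expR (2 * x)).
  apply: (exp_bounded_le_Rintegral mZ fZ) => //.
  by apply: exp_boundedD; [apply: exp_boundedD; [exact: exp_bounded_cst|exact: exp_boundedZ]|exact: exp_boundedZ].
rewrite (exp_bounded_RintegralD mZ fZ); last 2 first.
  by apply: exp_boundedD; [exact: exp_bounded_cst|exact: exp_boundedZ].
  exact: exp_boundedZ.
rewrite (exp_bounded_RintegralD mZ fZ); last 2 first.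
  exact: exp_bounded_cst.
  exact: exp_boundedZ.
rewrite Rintegral_cst_prob !(exp_bounded_RintegralZ mZ fZ)// Ee -/std_half_moment -m0 mulr0 addr0 h1.
rewrite -expRD => H.
have a1 := expR_ge1Dx (1 / 2 : R).
have a2 : expR (-4 + 2 ^+ 2 / 2) <= 1 / 4 :> R.
  rewrite (_ : -4 + 2 ^+ 2 / 2 = - (1 + 1)); last by field.
  rewrite expRN expRD div1r lef_pV2 ?posrE ?mulr_gt0 ?expR_gt0//.
  nra.
lra.
Qed.

(** xi has the law of |s| Z with Z standard normal, as the moment generating functions agree; s = 0
    is included. *)
Lemma gaussian_second_moment d (T : measurableType d) (P : probability T R) (xi : T -> R) (s : R) :
  measurable_fun setT xi ->
  (forall a : R, (\int[P]_w (expR (a * xi w))%:E = (expR (a ^+ 2 * s ^+ 2 / 2))%:E)%E) ->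
  (\int[P]_w (xi w ^+ 2)%:E = (s ^+ 2 * std_second_moment)%:E)%E /\
  (\int[P]_w (Num.max 0 (xi w))%:E = (`|s| * std_half_moment)%:E)%E.
Proof.
move=> mxi H.
have m1 := measurable_singleton_row mxi.
have ms : measurable_fun setT (fun x : measurableTypeR R => `|s| * x) by exact: measurable_funM.
have m2 := measurable_singleton_row ms.
have E1 (c : 'rV[R]_1) : (\int[P]_w (expR (dot c (singleton_row (xi w))))%:E = (expR (c 0 0 ^+ 2 * s ^+ 2 / 2))%:E)%E.
  by under eq_integral do rewrite dot_singleton; exact: H.
have E2 (c : 'rV[R]_1) : (\int[nu]_w (expR (dot c (singleton_row (`|s| * w))))%:E = (expR (c 0 0 ^+ 2 * s ^+ 2 / 2))%:E)%E.
  under eq_integral do rewrite dot_singleton mulrA.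
  by rewrite std_normal_mgf exprMn real_normK ?num_real.
have U (h : R -> R) : measurable_fun setT h -> (forall x, 0 <= h x) ->
    (\int[P]_w (h (xi w))%:E = \int[nu]_x (h (`|s| * x))%:E)%E.
  move=> mh h0; have mh' : measurable_fun setT (fun x : borel_rV 1 => (h (x 0 0))%:E).
    by apply/measurable_EFinP; exact: measurableT_comp mh (measurable_coord 0).
  have := @integral_unique _ _ _ _ _ _ P nu _ _ m1 m2 _ _ _ mh' _.
  under eq_integral do rewrite mxE.
  under [X in _ -> _ -> _ -> _ = X]eq_integral do rewrite mxE.
  apply.
  - by move=> c; rewrite E1 ltry.
  - by move=> c; rewrite E1 E2.
  - by move=> x; rewrite lee_fin.
have finE (h : R -> R) : exp_bounded (fun x : measurableTypeR R => singleton_row x : borel_rV 1) h ->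
    (\int[nu]_w (h w)%:E = (\int[nu]_w h w)%:E)%E.
  by move=> eh; rewrite /Rintegral fineK//; exact: integrable_fin_num (exp_bounded_integrable mZ fZ eh).
have e2 := exp_boundedX 2 eZ; have ep := exp_bounded_pos_part eZ.
split.
  rewrite (U (fun x => x ^+ 2)) => [||x]; [|exact: measurable_funX|exact: sqr_ge0].
  rewrite /std_second_moment -(exp_bounded_RintegralZ mZ fZ)// -finE; last exact: exp_boundedZ.
  by apply: eq_integral => x _; rewrite exprMn real_normK ?num_real.
rewrite (U (fun x => Num.max 0 x)) => [||x]; [|exact: measurable_maxr|by rewrite le_max lexx].
rewrite /std_half_moment -(exp_bounded_RintegralZ mZ fZ)// -finE; last exact: exp_boundedZ.
by apply: eq_integral => x _; rewrite maxr_pMr// mulr0.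
Qed.

End half_moment.

Section countable_supremum.
Context {R : realType} {d} {T : measurableType d}.
Variables (P : probability T R).

(** Starting the maximum from 0 makes the sequence nonnegative, as monotone convergence requires,
    and does not affect the supremum of a path that starts at 0. *)
Definition pos_max (Y : nat -> T -> R) (n : nat) (w : T) : R := \big[Num.max/0]_(i < n) Y i w.

Definition pos_sup (Y : nat -> T -> R) (w : T) : \bar R :=
  ereal_sup (range (fun n => (pos_max Y n w)%:E)).

Lemma pos_max_ge0 Y n w : 0 <= pos_max Y n w.
Proof. exact: bigmax_ge_id. Qed.

Lemma pos_max_ge (Y : nat -> T -> R) n w (i : 'I_n) : Y i w <= pos_max Y n w.
Proof. exact: (le_bigmax _ (fun i : 'I_n => Y i w)). Qed.

Lemma pos_maxS Y n w : pos_max Y n.+1 w = Num.max (pos_max Y n w) (Y n w).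
Proof.
apply/le_anti/andP; split.
  apply: bigmax_le => [|i _]; first by rewrite le_max pos_max_ge0.
  have [->|ni] := eqVneq (i : nat) n; first by rewrite le_max lexx orbT.
  have lt_in : (i < n)%N by rewrite ltn_neqAle ni -ltnS ltn_ord.
  by rewrite le_max (pos_max_ge Y w (Ordinal lt_in)).
rewrite ge_max (pos_max_ge Y w ord_max) andbT; apply: bigmax_le => [|i _]; first exact: pos_max_ge0.
exact: (pos_max_ge Y w (widen_ord (leqnSn n) i)).
Qed.

Lemma nondecreasing_pos_max Y w : nondecreasing_seq (fun n => (pos_max Y n w)%:E).
Proof.
by apply/nondecreasing_seqP => n; rewrite lee_fin pos_maxS le_max lexx.
Qed.

Lemma measurable_pos_max Y n : (forall i, measurable_fun setT (Y i)) ->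
  measurable_fun setT (pos_max Y n).
Proof.
move=> mY; elim: n => [|n IH].
  by rewrite (_ : pos_max Y 0 = cst 0)//; apply/funext => w; rewrite /pos_max big_ord0.
rewrite (_ : pos_max Y n.+1 = (fun w => Num.max (pos_max Y n w) (Y n w))).
  exact: measurable_maxr.
by apply/funext => w; rewrite pos_maxS.
Qed.

Lemma pos_max_cvg Y w : ((pos_max Y n w)%:E @[n --> \oo] --> pos_sup Y w)%E.
Proof. by apply: ereal_nondecreasing_cvgn; exact: nondecreasing_pos_max. Qed.

Lemma measurable_pos_sup Y : (forall i, measurable_fun setT (Y i)) ->
  measurable_fun setT (pos_sup Y).
Proof.
move=> mY; apply: (emeasurable_fun_cvg (fun n w => (pos_max Y n w)%:E)).
  by move=> n; apply/measurable_EFinP; exact: measurable_pos_max.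
by move=> w _; exact: pos_max_cvg.
Qed.

Lemma pos_sup_ge0 Y w : (0 <= pos_sup Y w)%E.
Proof.
apply: (@le_trans _ _ (pos_max Y 0 w)%:E); first by rewrite lee_fin pos_max_ge0.
by apply: ereal_sup_ubound; exists 0%N.
Qed.

Lemma pos_sup_ge Y n w : ((Y n w)%:E <= pos_sup Y w)%E.
Proof.
apply: (@le_trans _ _ (pos_max Y n.+1 w)%:E); last by apply: ereal_sup_ubound; exists n.+1.
by rewrite lee_fin; exact: (pos_max_ge Y w (@ord_max n)).
Qed.

Lemma integral_pos_sup_cvg Y : (forall i, measurable_fun setT (Y i)) ->
  (\int[P]_w (pos_max Y n w)%:E @[n --> \oo] --> \int[P]_w pos_sup Y w)%E.
Proof.
move=> mY.
have := @cvg_monotone_convergence _ _ _ P setT measurableT (fun n w => (pos_max Y n w)%:E).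
rewrite (_ : (fun x => limn _) = pos_sup Y); last first.
  by apply/funext => w; apply: cvg_lim => //; exact: pos_max_cvg.
apply=> [n|n w _|w _].
- by apply/measurable_EFinP; exact: measurable_pos_max.
- by rewrite lee_fin pos_max_ge0.
- exact: nondecreasing_pos_max.
Qed.

Section gaussian_sequence.
Variable Y : nat -> T -> R.
Hypothesis mY : forall i, measurable_fun setT (Y i).
Hypothesis gY : forall n, gaussian_vector P (fun i : 'I_n => Y i).
Hypothesis EY : forall i, 'E_P[Y i]%E = 0%E.

Let row n := row_of (fun i : 'I_n => Y i).
Let mrow n : measurable_fun setT (row n) := measurable_row_of (fun i : 'I_n => mY i).
Let mgf n := cumulantE (fun i : 'I_n => mY i) (@gY n) (fun i : 'I_n => EY i).
Let cumZ n := cumulantZ (fun i : 'I_n => mY i) (@gY n) (fun i : 'I_n => EY i).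

(** Finite maxima of Y and of -Y have the same law, the vectors being centered Gaussian; monotone
    convergence does the rest. *)
Lemma integral_pos_sup_opp :
  (\int[P]_w pos_sup (fun i w => (- Y i w)%R) w = \int[P]_w pos_sup Y w)%E.
Proof.
have c1 := integral_pos_sup_cvg mY.
have mNY i : measurable_fun setT (fun w => - Y i w) by exact: measurableT_comp.
have c2 := integral_pos_sup_cvg mNY.
rewrite -(cvg_lim _ c1)// -(cvg_lim _ c2)//; congr (limn _).
apply/funext => n.
pose h (x : borel_rV n) : \bar R := (\big[Num.max/0]_(i < n) (x : 'rV[R]_n) 0 i)%:E.
have mh : measurable_fun setT h.
  apply/measurable_EFinP.
  suff H (s : seq 'I_n) : measurable_fun setT (fun x : borel_rV n => \big[Num.max/0]_(i <- s) (x : 'rV[R]_n) 0 i).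
    exact: H.
  elim: s => [|i s IH].
    by rewrite (_ : (fun _ => _) = cst 0)//; apply/funext => x; rewrite big_nil.
  rewrite (_ : (fun _ => _) = (fun x : borel_rV n => Num.max (x 0 i) (\big[Num.max/0]_(j <- s) x 0 j))).
    apply: measurable_maxr => //; exact: measurable_coord.
  by apply/funext => x; rewrite big_cons.
have := @integral_unique _ _ _ _ _ _ P P _ _ (measurable_scaled (@mrow n) (-1)) (@mrow n) _ _ h mh.
have E w : h (row n w) = (pos_max Y n w)%:E.
  by congr (_%:E); apply: eq_bigr => i _; rewrite mxE.
have E' w : h (- 1 *: (row n w : 'rV_n)) = (pos_max (fun i w => - Y i w) n w)%:E.
  by congr (_%:E); apply: eq_bigr => i _; rewrite !mxE mulN1r.
under eq_integral do rewrite E'.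
under [X in _ -> _ -> _ -> _ = X]eq_integral do rewrite E.
apply.
- by move=> c; rewrite (mgf_scaled (@mgf n) (@cumZ n)) ltry.
- by move=> c; rewrite (mgf_scaled (@mgf n) (@cumZ n)) mgf sqrrN expr1n mul1r.
- by move=> x; rewrite lee_fin bigmax_ge_id.
Qed.

(** The bounds for finitely many indices share the same m and v, so they pass to the increasing
    union of the events. *)
Lemma pos_sup_tail (m v u : R) : 0 < v -> m < u ->
  (forall i, (\int[P]_w (Y i w ^+ 2)%:E <= v%:E)%E) -> (\int[P]_w pos_sup Y w = m%:E)%E ->
  (P [set w | exists i, (u <= Y i w)%R] <= (expR (- (u - m) ^+ 2 / (2 * v)))%:E)%E.
Proof.
move=> v0 mu Yv Ym.
pose A n := [set w | exists i : 'I_n, u <= Y i w].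
have mA n : measurable (A n).
  rewrite (_ : A n = \bigcup_(i in [set: 'I_n]) (Y i) @^-1` [set` `[u, +oo[]); last first.
    apply/seteqP; split => w; first by case=> i ui; exists i => //=; rewrite in_itv/= ui.
    by case=> i _ /=; rewrite in_itv/= andbT; exists i.
  apply: fin_bigcup_measurable => // i _; rewrite -[X in measurable X]setTI.
  by apply: mY => //; exact: measurable_itv.
have -> : [set w | exists i, u <= Y i w] = \bigcup_n A n.
  apply/seteqP; split => w /=.
    by move=> [i ui]; exists i.+1 => //; exists (@ord_max i).
  by move=> [n _ [i ui]]; exists i.
have mUA : measurable (\bigcup_n A n) by exact: bigcup_measurable.
have ndA : nondecreasing_seq A.
  move=> p q pq; apply/subsetPset => w [i ui].
  by exists (widen_ord pq i).
have c := nondecreasing_cvg_mu (mu := P) mA mUA ndA.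
rewrite -(cvg_lim _ c)//; apply: lime_le; first by apply: cvgP c.
apply: nearW => n /=.
have mps := measurable_pos_sup mY.
rewrite (_ : A n = [set w | exists i, u <= row n w 0 i]); last first.
  by apply/seteqP; split => w [i ui]; exists i; move: ui; rewrite mxE.
apply: (gaussian_sup_tail (@mrow n) (@mgf n) (@cumZ n) (G := pos_sup Y)) => //.
- move=> i; rewrite -lee_fin.
  have e2 := exp_boundedX 2 (exp_bounded_coord (@mrow n) i).
  rewrite /Rintegral fineK; last first.
    apply: integrable_fin_num => //; apply: (exp_bounded_integrable (@mrow n)) e2.
    by move=> c'; rewrite mgf ltry.
  by apply: le_trans (Yv i); rewrite le_eqVlt; apply/orP; left; apply/eqP; apply: eq_integral => w _; rewrite mxE.
- apply/integrableP; split => //.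
  under eq_integral do rewrite gee0_abs ?pos_sup_ge0//.
  by rewrite Ym ltry.
- by move=> i w; rewrite mxE; exact: pos_sup_ge.
- by rewrite Ym.
Qed.

End gaussian_sequence.

End countable_supremum.

(** * Gaussian paths *)

Lemma centered_opp (R : realType) d (T : measurableType d) (P : probability T R) (Y : T -> R) :
  'E_P[Y]%E = 0%E -> 'E_P[fun w => (- Y w)%R]%E = 0%E.
Proof.
rewrite unlock => EY; transitivity (\int[P]_w (- (Y w)%:E))%E.
  by apply: eq_integral => w _; rewrite EFinN.
rewrite integralN ?EY ?oppe0//.
(* As [+oo - +oo] is [-oo], the difference of the integrals of the positive and negative parts can
   vanish only if both are finite. *)
move: EY; rewrite [X in X = _]integralE.
by move: (integral P setT (funepos _)) (integral P setT (funeneg _)) => [a||] [b||].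
Qed.

Section dense_times.
Context {R : realType} {d : nat}.
Implicit Types (w : cadlag_path R d) (j : 'I_d).

Lemma measurable_path_coord (s : R) j : measurable_fun setT (fun w : cadlag_path R d => w s 0 j).
Proof.
have [s' s'01 E] : exists2 s' : R, s' \in `[0, 1] & forall w, w s = w s'.
  have [s0|s0] := leP s 0.
    by exists 0 => [|w]; [rewrite in_itv/= lexx ler01|exact: path_before0].
  have [s1|s1] := leP 1 s.
    by exists 1 => [|w]; [rewrite in_itv/= lexx ler01|exact: path_after1].
  by exists s => //; rewrite in_itv/= !ltW.
move=> _ B mB; rewrite setTI; apply: sub_sigma_algebra; exists s', j, B; split => //.
by apply/seteqP; split => w /=; rewrite E.
Qed.

Lemma path_right_nbhs w (t e : R) : 0 < e ->
  exists2 h, 0 < h & forall s, t <= s -> s < t + h -> enorm (w s - w t) < e.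
Proof.
move=> e0; have : nbhs (w t) (eball (w t) e) by apply/nbhs_eballP; exists e.
move=> /(@path_right_continuous _ _ w t); rewrite /= => H.
have /nbhs_ballP[h /= h0 Hh] : nbhs t (fun s => t < s -> eball (w t) e (w s)) by exact: H.
exists h => // s ts sh; have [->|st] := eqVneq s t; first by rewrite subrr enorm0.
apply: Hh; last by rewrite lt_neqAle eq_sym st.
rewrite /ball/= ltr_norml; lra.
Qed.

(* The rational multiples of t in [0, t], the end point t being one of them. *)
Definition dense_time (t : R) (n : nat) : R :=
  if @unpickle rat n is Some q then t * Num.max 0 (Num.min 1 (ratr q)) else 0.

Lemma dense_time_itv t n : 0 <= t -> 0 <= dense_time t n <= t.
Proof.
move=> t0; rewrite /dense_time; case: unpickle => [q|]; last by rewrite lexx.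
rewrite mulr_ge0 ?le_max ?lexx//= ler_piMr// ge_max ler01/= ge_min lexx//.
Qed.

Lemma dense_time_end t : exists n, dense_time t n = t.
Proof.
exists (pickle (1 : rat)); rewrite /dense_time pickleK rmorph1 minxx max_r// mulr1//.
Qed.

Lemma dense_time_right t s e : 0 <= s < t -> 0 < e -> exists n, s <= dense_time t n < s + e.
Proof.
move=> /andP[s0 st] e0; have t0 : 0 < t by exact: le_lt_trans st.
have [q] : exists q : rat, ratr q \in `](s / t), (Num.min 1 ((s + e) / t))[.
  apply: rat_in_itvoo; rewrite lt_min ltr_pdivrMr// mul1r st/=.
  by rewrite ltr_pM2r ?invr_gt0// ltrDl.
rewrite in_itv/= lt_min => /andP[sq /andP[q1 qe]].
exists (pickle q); rewrite /dense_time pickleK.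
have q0 : 0 <= ratr q :> R by apply: le_trans (ltW sq); rewrite divr_ge0// ltW.
rewrite (min_r (ltW q1)) (max_r q0) mulrC.
by rewrite -ler_pdivrMr// -ltr_pdivlMr// qe (ltW sq).
Qed.

Definition signed_coord (b : bool) j (t : R) (n : nat) w : R := (-1) ^+ b * w (dense_time t n) 0 j.

(** Right continuity extends the bound from the dense times to every s < t. No time of [0, t] lies
    to the right of t, which is why t has to be one of the dense times. *)
Lemma signed_coord_le b j t w c : 0 < t -> (forall n, signed_coord b j t n w <= c) ->
  forall s, 0 <= s <= t -> (-1) ^+ b * w s 0 j <= c.
Proof.
move=> t0 H s /andP[s0 st].
have [->|ns] := eqVneq s t; first by have [n nt] := dense_time_end t; have := H n; rewrite /signed_coord nt.
have lt_st : s < t by rewrite lt_neqAle ns.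
rewrite leNgt; apply/negP => cs.
have e0 : 0 < (-1) ^+ b * w s 0 j - c by rewrite subr_gt0.
have [h h0 Hh] := path_right_nbhs w s e0.
have [n /andP[sn nh]] : exists n, s <= dense_time t n < s + h.
  by apply: dense_time_right => //; rewrite s0.
have := Hh _ sn nh; have := coord_le_enorm (w (dense_time t n) - w s) j.
have := H n; rewrite /signed_coord !mxE => h1 h2 h3.
have : (-1) ^+ b * w s 0 j - (-1) ^+ b * w (dense_time t n) 0 j <= `|w (dense_time t n) 0 j - w s 0 j|.
  rewrite -mulrBr; apply: le_trans (ler_norm _) _.
  by rewrite normrM normr_sign mul1r distrC.
lra.
Qed.

Lemma pos_sup_signed_ge (b : bool) j t s w : 0 < t -> 0 <= s <= t ->
  (((-1) ^+ b * w s 0 j)%:E <= pos_sup (signed_coord b j t) w)%E.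
Proof.
move=> t0 st; have H n := pos_sup_ge (signed_coord b j t) n w.
move: H (pos_sup_ge0 (signed_coord b j t) w).
case: (pos_sup _ w) => [c H _|_ _|//]; last by rewrite leey.
rewrite lee_fin; apply: signed_coord_le st => // n.
Qed.

End dense_times.

Section gaussian_paths.
Context {R : realType} {d : nat}.
Variable P : probability (cadlag_path R d) R.
Implicit Types (w : cadlag_path R d) (j : 'I_d) (t s : R).
Hypothesis X_start : P [set w : cadlag_path R d | w 0 = 0] = 1%E.
Hypothesis X_gaussian : forall j, gaussian_process01 P (fun s w => w s 0 j).
Hypothesis X_centered : forall j s, s \in `[0, 1] -> 'E_P[fun w => (w s 0 j)%R]%E = 0%E.
Hypothesis X_nondegenerate : forall j t, t \in `]0, 1] ->
  (0 < P [set w : cadlag_path R d | w t 0%R j <> 0%R])%E.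

Lemma measurable_signed_coord b j t n : measurable_fun setT (signed_coord b j t n : cadlag_path R d -> R).
Proof. by apply: measurable_funM => //; exact: measurable_path_coord. Qed.

Lemma ae_start : {ae P, forall w, w 0 = 0}.
Proof.
have mA : measurable [set w : cadlag_path R d | w 0 = 0].
  rewrite (_ : [set w | _] = \bigcap_(j in [set: 'I_d]) ((fun w : cadlag_path R d => w 0 0 j) @^-1` [set 0])); last first.
    apply/seteqP; split => w /=; first by move=> w0 j _ /=; rewrite w0 mxE.
    by move=> H; apply/rowP => j; rewrite mxE; exact: H.
  apply: fin_bigcap_measurable => // j _; rewrite -[X in measurable X]setTI.
  by apply: measurable_path_coord.
exists (~` [set w : cadlag_path R d | w 0 = 0]); split => //; first exact: measurableC.
by rewrite probability_setC// X_start subee.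
Qed.

Lemma running_sup_dense j t w : 0 < t ->
  running_sup j t w = ereal_sup (range (fun n => (w (dense_time t n) 0 j)%:E)).
Proof.
move=> t0; apply/le_anti/andP; split.
  apply: ge_ereal_sup => y [s /=]; rewrite in_itv/= => st <-.
  set S := ereal_sup _.
  have H n : ((w (dense_time t n) 0 j)%:E <= S)%E by apply: ereal_sup_ubound; exists n.
  case: S H => [c H||]; last by move=> /(_ 0%N); rewrite leeNy_eq.
    rewrite lee_fin -[w s 0 j]mul1r -(expr0 (-1)); apply: (signed_coord_le (b := false) t0) st => n.
    by rewrite /signed_coord expr0 mul1r -lee_fin.
  by rewrite leey.
apply: ge_ereal_sup => _ [n _ <-]; apply: ereal_sup_ubound; exists (dense_time t n) => //=.
by rewrite in_itv/= dense_time_itv// ltW.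
Qed.

Lemma measurable_running_sup j t : 0 < t -> measurable_fun setT (running_sup j t : cadlag_path R d -> \bar R).
Proof.
move=> t0.
have := @measurable_fun_esups _ (cadlag_path R d) R setT
  (fun n w => (w (dense_time t n) 0 j)%:E) (fun n => _) 0%N.
move=> H; rewrite (_ : running_sup j t = fun w => esups (fun n => (w (dense_time t n) 0 j)%:E) 0).
  by apply: H => n; apply/measurable_EFinP; exact: measurable_path_coord.
apply/funext => w; rewrite running_sup_dense// /esups; congr ereal_sup.
by apply/seteqP; split => x [n _ <-]; exists n.
Qed.

Lemma running_supE j t w : 0 < t -> w 0 = 0 ->
  running_sup j t w = pos_sup (signed_coord false j t) w.
Proof.
move=> t0 w0; apply/le_anti/andP; split.
  apply: ge_ereal_sup => y [s /=]; rewrite in_itv/= => st <-.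
  by have := pos_sup_signed_ge false j w t0 st; rewrite expr0 mul1r.
apply: ge_ereal_sup => _ [n _ <-]; elim: n => [|n IH].
  rewrite /pos_max big_ord0; apply: ereal_sup_ubound; exists 0; last by rewrite w0 mxE.
  by rewrite /= in_itv/= lexx ltW.
rewrite pos_maxS; case: (leP (pos_max (signed_coord false j t) n w)) => // _; rewrite running_sup_dense//; apply: ereal_sup_ubound.
by exists n => //; rewrite /signed_coord expr0 mul1r.
Qed.

Lemma mean_supE j t : 0 < t ->
  (mean_sup P j t = \int[P]_w pos_sup (signed_coord false j t) w)%E.
Proof.
move=> t0; apply: ae_eq_integral => //.
- exact: measurable_running_sup.
- by apply: measurable_pos_sup => n; exact: measurable_signed_coord.
- by apply: filterS ae_start => w w0 _; exact: running_supE.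
Qed.

Lemma mean_sup_ge0 j t : 0 < t -> (0 <= mean_sup P j t)%E.
Proof. by move=> t0; rewrite mean_supE//; apply: integral_ge0 => w _; exact: pos_sup_ge0. Qed.

Lemma gaussian_signed_coord b j t n : 0 < t <= 1 ->
  gaussian_vector P (fun i : 'I_n => signed_coord b j t i : cadlag_path R d -> R).
Proof.
move=> /andP[t0 t1] c.
have H (i : 'I_n) : dense_time t i \in `[0, 1].
  have /andP[u0 u1] := dense_time_itv i (ltW t0).
  by rewrite in_itv/= u0 (le_trans u1).
have [m [s Hms]] := X_gaussian j H (fun i => c i * (-1) ^+ b).
exists m, s => B mB; rewrite -Hms//; congr (P _).
suff -> : (fun w : cadlag_path R d => \sum_i c i * signed_coord b j t i w) =
  (fun w => \sum_i c i * (-1) ^+ b * w (dense_time t i) 0 j) by [].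
by apply/funext => w; apply: eq_bigr => i _; rewrite /signed_coord mulrA.
Qed.

Lemma centered_signed_coord b j t n : 0 < t <= 1 ->
  'E_P[signed_coord b j t n : cadlag_path R d -> R]%E = 0%E.
Proof.
move=> /andP[t0 t1].
have H : dense_time t n \in `[0, 1].
  have /andP[u0 u1] := dense_time_itv n (ltW t0).
  by rewrite in_itv/= u0 (le_trans u1).
case: b; last first.
  rewrite -(X_centered j H); congr ('E_P[_])%E; apply/funext => w.
  by rewrite /signed_coord expr0 mul1r.
rewrite -[RHS](centered_opp (X_centered j H)); congr ('E_P[_])%E; apply/funext => w.
by rewrite /signed_coord expr1 mulN1r.
Qed.

Lemma mean_sup_signed b j t : 0 < t <= 1 ->
  (\int[P]_w pos_sup (signed_coord b j t) w = mean_sup P j t)%E.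
Proof.
move=> t01; have /andP[t0 t1] := t01; rewrite mean_supE//; case: b => //.
rewrite -(integral_pos_sup_opp (fun n => measurable_signed_coord false j t n)
  (fun n => @gaussian_signed_coord false j t n t01) (fun n => @centered_signed_coord false j t n t01)).
apply: eq_integral => w _; congr (pos_sup _ w); apply/funext => n; apply/funext => v.
by rewrite /signed_coord expr1 expr0 mul1r mulN1r.
Qed.

Lemma path_moments j s : s \in `[0, 1] -> exists2 sg : R, 0 <= sg &
  (\int[P]_w (w s 0%R j ^+ 2)%:E = (sg ^+ 2 * std_second_moment)%:E)%E /\
  (\int[P]_w (Num.max 0 (w s 0%R j))%:E = (sg * std_half_moment)%:E)%E.
Proof.
move=> s01; have mX := measurable_path_coord s j.
have gX : gaussian_vector P (fun (_ : 'I_1) w => w s 0 j) := X_gaussian j (fun _ : 'I_1 => s01).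
have [sg H] := centered_dot_row_of_mgf (fun _ : 'I_1 => mX) gX (fun=> X_centered j s01) (const_mx 1).
have {}H (a : R) : (\int[P]_w (expR (a * w s 0%R j))%:E = (expR (a ^+ 2 * sg ^+ 2 / 2))%:E)%E.
  by rewrite -H; apply: eq_integral => w _; rewrite dot_row_of big_ord1 mxE mul1r.
have [h1 h2] := gaussian_second_moment mX H.
by exists `|sg|; [exact: normr_ge0|rewrite h1 h2 real_normK ?num_real].
Qed.

Lemma path_sup_moment j t s (m : R) : 0 < t <= 1 -> 0 <= s <= t -> mean_sup P j t = m%:E ->
  (\int[P]_w (Num.max 0 (w s 0%R j))%:E <= m%:E)%E.
Proof.
move=> t01 st mt; have /andP[t0 t1] := t01; rewrite -mt mean_supE//; apply: ge0_le_integral => //.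
- by move=> w _; rewrite lee_fin le_max lexx.
- by apply/measurable_EFinP; apply: measurable_maxr => //; exact: measurable_path_coord.
- by apply: measurable_pos_sup => n; exact: measurable_signed_coord.
- move=> w _; case: (leP 0 (w s 0 j)) => _; last exact: pos_sup_ge0.
  by have := pos_sup_signed_ge false j w t0 st; rewrite expr0 mul1r.
Qed.

(** The value of E xi^2 / (E xi^+)^2 common to all non-degenerate centered Gaussian variables xi,
    namely 2 pi. *)
Definition moment_ratio : R := @std_second_moment R / @std_half_moment R ^+ 2.

(** The standard deviation at time s is a fixed multiple of the mean of the positive part of X_s,
    and this mean is at most that of the supremum. *)
Lemma var_sup_le j t (m : R) : 0 < t <= 1 -> mean_sup P j t = m%:E ->
  (var_sup P j t <= (moment_ratio * m ^+ 2)%:E)%E.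
Proof.
move=> t01 mt; have /andP[t0 t1] := t01; have h0 := @std_half_moment_gt0 R.
apply: ge_ereal_sup => y [s /=]; rewrite in_itv/= => st <-.
have s01 : s \in `[0, 1].
  by case/andP: st => s0 st; rewrite in_itv/= s0 (le_trans st).
have [sg sg0 [h1 h2]] := path_moments j s01; rewrite unlock h1 lee_fin.
have := path_sup_moment t01 st mt; rewrite h2 lee_fin => H.
rewrite [leRHS](_ : _ = std_second_moment * (m ^+ 2 / std_half_moment ^+ 2)); last first.
  by rewrite /moment_ratio mulrAC mulrA.
rewrite mulrC; apply: ler_wpM2l.
  by apply: Rintegral_ge0 => x _; exact: sqr_ge0.
rewrite ler_pdivlMr ?exprn_gt0// -exprMn ler_sqr ?nnegrE ?mulr_ge0 ?(ltW h0)//.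
by apply: le_trans H; rewrite mulr_ge0// ltW.
Qed.

Lemma second_moment_gt0 j t : t \in `]0, 1] -> (0 < \int[P]_w (w t 0%R j ^+ 2)%:E)%E.
Proof.
move=> t01; have mX := measurable_path_coord t j.
rewrite lt_neqAle; apply/andP; split; last by apply: integral_ge0 => w _; rewrite lee_fin sqr_ge0.
apply/eqP => H; have := X_nondegenerate j t01.
have mf : measurable_fun setT (fun w : cadlag_path R d => (w t 0%R j ^+ 2)%:E).
  by apply/measurable_EFinP; exact: measurable_funX.
have [N [mN N0 sub]] : ae_eq P setT (fun w : cadlag_path R d => (w t 0%R j ^+ 2)%:E) (cst 0%E).
  apply/(ae_eq_integral_abs P measurableT mf); rewrite [RHS]H.
  by apply: eq_integral => w _; rewrite gee0_abs// lee_fin sqr_ge0.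
rewrite ltNge (_ : (_ <= 0)%E)// -N0; apply: le_measure; rewrite ?inE//.
  rewrite (_ : [set w | _] = ~` ((fun w : cadlag_path R d => w t 0 j) @^-1` [set 0])); last first.
    by apply/seteqP; split => w.
  by apply: measurableC; rewrite -[X in measurable X]setTI; exact: mX.
move=> w nw; apply: sub => /= /(_ I) [] /eqP; rewrite sqrf_eq0 => /eqP; exact: nw.
Qed.

Lemma var_sup_gt0 j t : t \in `]0, 1] -> (0 < var_sup P j t)%E.
Proof.
move=> t01; apply: lt_le_trans (second_moment_gt0 j t01) _.
apply: ereal_sup_ubound; exists t; last by rewrite unlock.
by move: t01; rewrite /= !in_itv/= lexx => /andP[/ltW ->].
Qed.

Lemma mean_sup_gt0 j t : t \in `]0, 1] -> (0 < mean_sup P j t)%E.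
Proof.
move=> t01; have t01' := t01; rewrite in_itv/= in t01'; have /andP[t0 t1] := t01'.
case E : (mean_sup P j t) => [m||]; last 2 first.
- by rewrite ltry.
- by have := mean_sup_ge0 j t0; rewrite E.
have tt : 0 <= t <= t by rewrite lexx ltW.
have tc : t \in `[0, 1] by rewrite in_itv/= t1 ltW.
have [sg sg0 [h1 h2]] := path_moments j tc.
have := path_sup_moment t01' tt E; rewrite h2 => /(lt_le_trans _); apply.
rewrite lte_fin mulr_gt0 ?std_half_moment_gt0// lt_neqAle sg0 andbT eq_sym.
apply/eqP => sg1; have := second_moment_gt0 j t01; rewrite h1 sg1 expr0n/= mul0r.
by rewrite ltxx.
Qed.

Lemma path_tail b j t (m u : R) : t \in `]0, 1] -> mean_sup P j t = m%:E -> m < u ->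
  (P [set w | exists n, (u <= signed_coord b j t n w)%R] <=
   (expR (- (u - m) ^+ 2 / (2 * fine (var_sup P j t))))%:E)%E.
Proof.
move=> t01 mt mu; have t01' := t01; rewrite in_itv/= in t01'; have /andP[t0 t1] := t01'.
have vf : var_sup P j t \is a fin_num.
  by rewrite ge0_fin_numE ?(ltW (var_sup_gt0 j t01))//; apply: le_lt_trans (var_sup_le t01' mt) _; rewrite ltry.
apply: (pos_sup_tail (measurable_signed_coord b j t) (fun n => @gaussian_signed_coord b j t n t01')
  (fun n => @centered_signed_coord b j t n t01')) => //.
- by rewrite -lte_fin fineK// var_sup_gt0.
- move=> n; rewrite fineK//; apply: ereal_sup_ubound; exists (dense_time t n).
    by rewrite /= in_itv/= dense_time_itv// ltW.
  by rewrite unlock; apply: eq_integral => w _; rewrite /signed_coord exprMn sqrr_sign mul1r.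
- by rewrite mean_sup_signed.
Qed.

End gaussian_paths.

(** * Heat loss *)

(** The integral of a nonnegative function is a supremum over the simple functions below it, so it
    is monotone for arbitrary functions. This allows the survival probability to be compared with a
    Borel function. *)
Lemma ge0_le_integral_any (R : realType) dT (T : measurableType dT)
    (m : {measure set T -> \bar R}) (A : set T) (f g : T -> \bar R) :
  (forall x, A x -> 0 <= f x)%E -> (forall x, A x -> f x <= g x)%E ->
  (\int[m]_(x in A) f x <= \int[m]_(x in A) g x)%E.
Proof.
move=> f0 fg; rewrite integral_mkcond [leRHS]integral_mkcond.
have fg' x : ((f \_ A) x <= (g \_ A) x)%E.
  by rewrite /patch; case: ifPn => // /set_mem /fg.
have f0' x : (0 <= (f \_ A) x)%E.
  by rewrite /patch; case: ifPn => // /set_mem /f0.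
rewrite !ge0_integralTE//; last by move=> x; exact: le_trans (fg' x).
by apply: ereal_sup_le => _ [h hf <-]; exists h => // x; exact: le_trans (fg' x).
Qed.

Lemma measure_bigU_le (R : realType) dT (T : measurableType dT)
    (m : {measure set T -> \bar R}) (I : Type) (s : seq I) (F : I -> set T) :
  (forall i, measurable (F i)) ->
  (m (\big[setU/set0]_(i <- s) F i) <= \sum_(i <- s) m (F i))%E.
Proof.
move=> mF; elim: s => [|i s IH]; first by rewrite !big_nil measure0.
rewrite !big_cons; apply: le_trans (measureU2 _ _ _) _ => //.
  exact: bigsetU_measurable.
exact: leeD2l.
Qed.

Section exit_estimates.
Context {R : realType} {d : nat}.
Implicit Types (w : cadlag_path R d) (j : 'I_d) (t s : R) (x : 'rV[R]_d).

(** The inequality is strict because D is open and the path right continuous: having been in D up to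
    time t, it stays there a little longer. *)
Lemma exit_time_gt (D : set 'rV[R]_d) x w t : open D -> 0 <= t ->
  (forall s, 0 <= s <= t -> D (w s + x)) -> (t%:E < exit_time D (translate x w))%E.
Proof.
move=> oD t0 H; have Dt : D (w t + x) by apply: H; rewrite t0 lexx.
have [e e0 eD] := (open_eballP D).1 oD _ Dt.
have [h h0 Hh] := path_right_nbhs w t e0.
apply: (@lt_le_trans _ _ (t + h)%:E); first by rewrite lte_fin ltrDl.
apply: le_ereal_inf_tmp => y [s /= [s01 nD] <-]; rewrite lee_fin leNgt; apply/negP => sh.
apply: nD; have [st|ts] := leP s t.
  by apply: H; rewrite st andbT; move: s01; rewrite in_itv/= => /andP[/ltW].
by apply: eD; rewrite /eball/= opprD addrACA subrr addr0; apply: Hh => //; exact: ltW.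
Qed.

Lemma law_from_ge (P : probability (cadlag_path R d) R) (D : set 'rV[R]_d) x t (A : set (cadlag_path R d)) :
  open D -> 0 <= t -> measurable A ->
  (forall w, A w -> forall s, 0 <= s <= t -> D (w s + x)) ->
  (P A <= law_from P x [set w | t%:E < exit_time D w])%E.
Proof.
move=> oD t0 mA H; rewrite -(measurable_mu_extE P mA); apply: le_mu_ext => w Aw.
by apply: exit_time_gt => //; exact: H.
Qed.

Lemma law_from_ge0 (P : probability (cadlag_path R d) R) x F : (0 <= law_from P x F)%E.
Proof. exact: mu_ext_ge0. Qed.

Definition path_range t w : \bar R :=
  (\sum_(j < d) (pos_sup (signed_coord false j t) w + pos_sup (signed_coord true j t) w))%E.

Lemma measurable_path_range t : measurable_fun setT (path_range t).
Proof.
by apply: emeasurable_sum => j; apply: emeasurable_funD; apply: measurable_pos_sup => n;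
  exact: measurable_signed_coord.
Qed.

Lemma path_range_ge0 t w : (0 <= path_range t w)%E.
Proof. by apply: sume_ge0 => j _; apply: adde_ge0; exact: pos_sup_ge0. Qed.

Lemma path_range_ge t s w : 0 < t -> 0 <= s <= t -> ((enorm (w s))%:E <= path_range t w)%E.
Proof.
move=> t0 st; apply: (@le_trans _ _ (\sum_(j < d) `|w s 0 j|)%:E).
  by rewrite lee_fin enorm_le_sum.
rewrite -sumEFin; apply: lee_sum => j _.
have h1 := pos_sup_signed_ge false j w t0 st; have h2 := pos_sup_signed_ge true j w t0 st.
rewrite expr0 mul1r in h1; rewrite expr1 mulN1r in h2.
have [x0|x0] := leP 0 (w s 0 j).
  by rewrite ger0_norm//; apply: le_trans h1 _; rewrite leeDl ?pos_sup_ge0.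
by rewrite ltr0_norm//; apply: le_trans h2 _; rewrite leeDr ?pos_sup_ge0.
Qed.

Definition escapes t r : set (cadlag_path R d) :=
  \big[setU/set0]_(j < d) ([set w | exists n, r <= signed_coord false j t n w] `|`
                           [set w | exists n, r <= signed_coord true j t n w]).

Lemma measurable_signed_exceeds b j t r :
  measurable [set w : cadlag_path R d | exists n, r <= signed_coord b j t n w].
Proof.
rewrite (_ : [set w | _] = \bigcup_n (signed_coord b j t n) @^-1` [set` `[r, +oo[]); last first.
  apply/seteqP; split => w; first by case=> n rn; exists n => //=; rewrite in_itv/= rn.
  by case=> n _ /=; rewrite in_itv/= andbT; exists n.
apply: bigcup_measurable => n _; rewrite -[X in measurable X]setTI.
by apply: measurable_signed_coord => //; exact: measurable_itv.
Qed.

Lemma measurable_escapes t r : measurable (escapes t r).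
Proof.
by apply: bigsetU_measurable => j _; apply: measurableU; exact: measurable_signed_exceeds.
Qed.

Lemma not_escapes t r w : 0 < t -> 0 <= r -> ~ escapes t r w ->
  forall s, 0 <= s <= t -> enorm (w s) <= r * Num.sqrt d%:R.
Proof.
move=> t0 r0 ne s st; apply: enorm_le_max => // j.
have H (b : bool) : (-1) ^+ b * w s 0 j <= r.
  apply: (signed_coord_le (b := b) t0) st => n; rewrite leNgt; apply/negP => rn.
  apply: ne; rewrite /escapes (bigD1 j)//=; left.
  by case: b rn => rn; [right|left]; exists n; exact: ltW.
have := H false; have := H true; rewrite expr0 expr1 mul1r mulN1r ler_norml; lra.
Qed.

End exit_estimates.

Section heat_loss.
Context {R : realType} {k : nat}.
Local Notation d := k.+1.
Variables (D : set 'rV[R]_d) (Rad : R) (P : probability (cadlag_path R d) R).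
Hypotheses (oD : open D) (bD : bounded_set D) (D0 : D !=set0).
Hypothesis cD : characteristic_radius D Rad.

Let k0 : (0 < d)%N := isT.
Let mD : measurable (D : set (borel_rV d)) := open_measurable_rV oD.

Lemma lebesgue_domain_lty : (lebesgue_rV (D : set (borel_rV d)) < +oo)%E.
Proof.
have [M [_ HM]] := bD; apply: (@lebesgue_rV_bounded _ _ _ (`|M| + 1)) => // x i Dx.
apply: le_trans (mx_norm_ge_coord x i) _; apply: HM => //.
by have := ler_norm M; lra.
Qed.

Lemma measurable_inner_part a : measurable (inner_part D a : set (borel_rV d)).
Proof.
rewrite (_ : inner_part D a = D `\` layer D a).
  by apply: measurableD => //; exact: measurable_layer.
apply/seteqP; split => x /= [Dx].
  by move=> ax; split => // -[_]; rewrite leNgt ax.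
by move=> nl; split => //; rewrite ltNge; apply/negP => xa; exact: nl.
Qed.

Definition reach (a t : R) : set (borel_rV d * cadlag_path R d) :=
  [set p | layer D a p.1 /\ ((boundary_dist D p.1)%:E <= path_range t p.2)%E].

Lemma measurable_reach a t : measurable (reach a t).
Proof.
rewrite (_ : reach a t = (layer D a `*` setT) `&`
    [set p | ((boundary_dist D p.1)%:E <= path_range t p.2)%E]); last first.
  by apply/seteqP; split => -[x w] /=; [move=> [? ?]|move=> [[? _] ?]].
apply: measurableI; first by apply: measurableX => //; exact: measurable_layer.
rewrite -[X in measurable X]setTI; apply: measurable_lee => //.
  apply/measurable_EFinP; apply: measurableT_comp measurable_fst.
  exact: measurable_boundary_dist.
exact: measurableT_comp (measurable_path_range t) measurable_snd.
Qed.

Lemma surface_area_ge0 : (0 <= surface_area D)%E.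
Proof.
have [Rad0 _] := cD; rewrite leNgt; apply/negP => H0.
have R2 : 0 < Rad / 2 <= Rad / 2 by rewrite lexx divr_gt0.
have := lebesgue_layer oD bD D0 cD R2; apply/negP; rewrite -ltNge.
apply: (@lt_le_trans _ _ 0%E) => //; rewrite mule_gt0_lt0//.
by rewrite lte_fin mulr_gt0 ?exprn_gt0// divr_gt0.
Qed.

(** For a path of range r the section lies in the layer of depth min(a, r). Range 0 gives the empty
    set, as boundary distances are positive in D; an infinite range gives depth a. *)
Lemma reach_ysection_le a t w : 0 < a <= Rad / 2 ->
  (lebesgue_rV (ysection (reach a t) w) <= ((2 ^+ k)%:E * surface_area D) * path_range t w)%E.
Proof.
move=> a0R; have /andP[a0 aR] := a0R.
have H0 := surface_area_ge0.
have key (u : R) : 0 < u <= Rad / 2 -> (u%:E <= path_range t w)%E ->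
    ysection (reach a t) w `<=` layer D u ->
    (lebesgue_rV (ysection (reach a t) w) <= ((2 ^+ k)%:E * surface_area D) * path_range t w)%E.
  move=> uR uw sub; have /andP[u0 _] := uR.
  apply: (@le_trans _ _ ((2 ^+ k * u)%:E * surface_area D)%E).
    apply: le_trans (lebesgue_layer oD bD D0 cD uR); apply: le_measure; rewrite ?inE//.
      by apply: measurable_ysection; exact: measurable_reach.
    exact: measurable_layer.
  rewrite EFinM muleAC; apply: lee_wpmul2l => //.
  by apply: mule_ge0 => //; rewrite lee_fin exprn_ge0.
case E : (path_range t w) => [r||].
- have r0 : 0 <= r by rewrite -lee_fin -E path_range_ge0.
  have [r00|rn0] := eqVneq r 0.
    rewrite (_ : ysection _ _ = set0) ?measure0; first by rewrite r00 mule0.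
    apply/seteqP; split => // x /ysectionP [/= [Dx _]]; rewrite E lee_fin r00.
    by have := boundary_dist_gt0 oD bD D0 k0 Dx; lra.
  rewrite -E; apply: (key (Num.min a r)).
  + by rewrite lt_min a0 lt_neqAle eq_sym rn0 r0/= ge_min aR.
  + by rewrite E lee_fin ge_min lexx orbT.
  + move=> x /ysectionP [/= [Dx xa]]; rewrite E lee_fin => xr; split => //.
    by rewrite le_min xa.
- rewrite -E; apply: (key a) => //; first by rewrite E leey.
  by move=> x /ysectionP [].
- by have := path_range_ge0 t w; rewrite E.
Qed.

(* A path started at distance delta <= a from the boundary survives if its range
   is less than delta; integrating over the starting point first, the loss is the
   expected volume of a layer whose width is the range. A path started deeper
   survives unless one coordinate reaches a / sqrt d. *)
Lemma heat_loss_le (a t : R) : 0 < t -> 0 < a <= Rad / 2 ->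
  (lebesgue_rV D - heat_content P D t <=
   ((2 ^+ k)%:E * surface_area D) * \int[P]_w path_range t w +
   P (escapes t (a / Num.sqrt d%:R)%R) * lebesgue_rV (inner_part D a))%E.
Proof.
move=> t0 a0R; have /andP[a0 aR] := a0R.
have mr := measurable_reach a t.
pose r := a / Num.sqrt d%:R; have r0 : 0 <= r by rewrite divr_ge0 ?sqrtr_ge0// ltW.
have rd : r * Num.sqrt d%:R = a by rewrite divfK// gt_eqF// sqrtr_gt0 ltr0n.
pose E : set (cadlag_path R d) := escapes t r; have mE : measurable E by exact: measurable_escapes.
(* [e1] bounds the loss from a shallow start and vanishes on deep ones, [e2] the reverse; 1 - (e1 +
   e2), named [stay], is the Borel lower bound of the survival probability. *)
pose e1 x := P (xsection (reach a t) x).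
have me1 : measurable_fun setT (e1 : borel_rV d -> \bar R) by exact: measurable_fun_xsection.
pose e2 (x : borel_rV d) := (P E * (\1_(inner_part D a : set (borel_rV d)) x)%:E)%E.
have mI := measurable_inner_part a.
have me2 : measurable_fun setT e2.
  by apply: measurable_funeM; apply/measurable_EFinP; exact: measurable_indic.
have e10 x : (0 <= e1 x)%E by exact: measure_ge0.
have e20 x : (0 <= e2 x)%E by apply: mule_ge0; rewrite ?measure_ge0// lee_fin.
pose stay x := (1 - (e1 x + e2 x))%E.
have ms : measurable_fun setT stay.
  by apply: emeasurable_funB => //; exact: emeasurable_funD.
have st x : D x -> (0 <= stay x /\ stay x <= law_from P x [set w | t%:E < exit_time D w])%E /\
    (stay x + (e1 x + e2 x) = 1)%E.
  move=> Dx; have [xa|ax] := leP (boundary_dist D x) a.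
    have e2x : e2 x = 0%E.
      by rewrite /e2 indicE memNset ?mule0//= => -[_]; rewrite ltNge xa.
    rewrite /stay e2x adde0.
    have mx : measurable (xsection (reach a t) x) by exact: measurable_xsection.
    have xf : e1 x \is a fin_num by exact: fin_num_measure.
    rewrite subeK//; split => //; rewrite -probability_setC// measure_ge0; split => //.
    apply: law_from_ge => //; [exact: ltW|exact: measurableC|] => w /= nw s st.
    apply: (boundary_dist_sub oD Dx); rewrite opprD addrCA subrr addr0 enormN.
    rewrite -lte_fin; apply: le_lt_trans (path_range_ge w t0 st) _.
    by rewrite ltNge; apply/negP => h; apply: nw; apply/xsectionP.
  have e1x : e1 x = 0%E.
    rewrite /e1 (_ : xsection _ _ = set0) ?measure0//.
    by apply/seteqP; split => // w /xsectionP [/= [_]]; rewrite leNgt ax.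
  have e2x : e2 x = P E by rewrite /e2 indicE mem_set// mule1.
  have xf : P E \is a fin_num by exact: fin_num_measure.
  rewrite /stay e1x e2x add0e subeK//; split => //; rewrite -probability_setC// measure_ge0; split => //.
  apply: law_from_ge => //; [exact: ltW|exact: measurableC|] => w /= nw s st.
  apply: (boundary_dist_sub oD Dx); rewrite opprD addrCA subrr addr0 enormN.
  by apply: le_lt_trans (not_escapes t0 r0 nw st) _; rewrite rd.
have Q0 : (0 <= heat_content P D t)%E.
  by apply: integral_ge0 => x _; exact: law_from_ge0.
have Qs : (\int[@lebesgue_rV R d]_(x in D) stay x <= heat_content P D t)%E.
  by apply: ge0_le_integral_any => x /st[[]].
have mS (f : borel_rV d -> \bar R) : measurable_fun setT f -> measurable_fun (D : set (borel_rV d)) f.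
  exact: measurable_funTS.
(* The volume is split as a sum; subtraction in the extended reals is left to the last step. *)
have tot : (lebesgue_rV D = \int[@lebesgue_rV R d]_(x in D) stay x +
    \int[@lebesgue_rV R d]_(x in D) (e1 x + e2 x))%E.
  rewrite -ge0_integralD//.
  - rewrite -[LHS]mul1e -integral_cst//; apply: eq_integral => x /set_mem /st[_ ->] //.
  - by move=> x /st[[]].
  - exact: mS.
  - by move=> x _; exact: adde_ge0.
  - by apply: mS; exact: emeasurable_funD.
have loss : (\int[@lebesgue_rV R d]_(x in D) (e1 x + e2 x) <=
   ((2 ^+ k)%:E * surface_area D) * \int[P]_w path_range t w + P E * lebesgue_rV (inner_part D a))%E.
  rewrite ge0_integralD//; [|exact: mS|exact: mS].
  apply: leeD.
    apply: (@le_trans _ _ (\int[@lebesgue_rV R d]_x e1 x)%E).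
      by apply: ge0_subset_integral.
    rewrite (fubini_sections _ _ mr) -ge0_integralZl//.
    - apply: ge0_le_integral_any => w _; first exact: measure_ge0.
      exact: reach_ysection_le.
    - exact: measurable_path_range.
    - by move=> w _; exact: path_range_ge0.
    - by apply: mule_ge0; [rewrite lee_fin exprn_ge0|exact: surface_area_ge0].
  rewrite ge0_integralZl//.
  - rewrite integral_indic//; apply: lee_wpmul2l; first exact: measure_ge0.
    apply: le_measure; rewrite ?inE//; exact: measurableI.
  - apply: mS; apply/measurable_EFinP; exact: measurable_indic.
apply: le_trans loss.
have := tot; have := lebesgue_domain_lty.
case: (heat_content P D t) Q0 Qs => [q _ Qs|_ _|//].
  move=> _ ->; rewrite leeBlDr// addeC leeD2l//.
(* An infinite heat content would make the left side [-oo]. *)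
move=> lt _.
have -> : (lebesgue_rV D - +oo = -oo)%E.
  by case: (lebesgue_rV D) lt.
exact: leNye.
Qed.

End heat_loss.

Section small_times.
Context {R : realType} {d : nat}.
Implicit Types (w : cadlag_path R d) (j : 'I_d) (t s : R).

Lemma pos_sup_le (Y : nat -> cadlag_path R d -> R) w (c : \bar R) : (0 <= c)%E ->
  (forall n, ((Y n w)%:E <= c)%E) -> (pos_sup Y w <= c)%E.
Proof.
move=> c0 Yc; apply: ge_ereal_sup => _ [n _ <-]; elim: n => [|n IH].
  by rewrite /pos_max big_ord0.
by rewrite pos_maxS; case: (leP (pos_max Y n w)).
Qed.

Lemma pos_sup_signed_mono b j s t w : 0 < s -> s <= t ->
  (pos_sup (signed_coord b j s) w <= pos_sup (signed_coord b j t) w)%E.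
Proof.
move=> s0 st; apply: pos_sup_le; first exact: pos_sup_ge0.
move=> n; apply: pos_sup_signed_ge; first exact: lt_le_trans st.
by have /andP[-> /le_trans -> //] := dense_time_itv n (ltW s0).
Qed.

(** Right continuity at 0 makes the path uniformly small on a short interval. *)
Lemma pos_sup_signed_cvg0 b j t w : 0 < t -> w 0 = 0 ->
  (pos_sup (signed_coord b j (t / n.+1%:R)) w @[n --> \oo] --> 0)%E.
Proof.
move=> t0 w0.
have key e : 0 < e -> \forall n \near \oo, (0 <= pos_sup (signed_coord b j (t / n.+1%:R)) w <= e%:E)%E.
  move=> e0; have [h h0 Hh] := path_right_nbhs w 0 e0.
  near=> n; rewrite pos_sup_ge0/=; apply: pos_sup_le; first by rewrite lee_fin ltW.
  move=> i; rewrite lee_fin; set u := t / n.+1%:R.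
  have u0 : 0 < u by rewrite divr_gt0.
  have /andP[s0 su] := dense_time_itv i (ltW u0).
  have uh : u < h.
    rewrite /u ltr_pdivrMr// mulrC -ltr_pdivrMr//.
    near: n; exists (Num.truncn (t / h)) => // n /= hn.
    by apply: lt_le_trans (truncnS_gt _) _; rewrite ler_nat.
  have := Hh _ s0; rewrite add0r => /(_ (le_lt_trans su uh)).
  rewrite w0 subr0 => H; apply: le_trans (ler_norm _) _.
  rewrite /signed_coord normrM normr_sign mul1r; apply: le_trans (ltW H).
  exact: coord_le_enorm.
apply/fine_cvgP; split.
  near=> n; have /andP[n0 n1] : (0 <= pos_sup (signed_coord b j (t / n.+1%:R)) w <= 1%:E)%E.
    by near: n; exact: key.
  by rewrite ge0_fin_numE//; apply: le_lt_trans n1 _; rewrite ltry.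
apply/cvgrPdist_le => e e0; near=> n.
have /andP[n0 n1] : (0 <= pos_sup (signed_coord b j (t / n.+1%:R)) w <= e%:E)%E.
  by near: n; exact: key.
have nf : pos_sup (signed_coord b j (t / n.+1%:R)) w \is a fin_num.
  by rewrite ge0_fin_numE//; apply: le_lt_trans n1 _; rewrite ltry.
rewrite sub0r normrN ger0_norm; last by rewrite /= -lee_fin fineK.
by rewrite /= -lee_fin fineK.
Unshelve. all: by end_near.
Qed.

End small_times.

Section gaussian_heat_loss.
Context {R : realType} {k : nat}.
Local Notation d := k.+1.
Variables (D : set 'rV[R]_d) (Rad : R) (P : probability (cadlag_path R d) R).
Hypotheses (oD : open D) (bD : bounded_set D) (D0 : D !=set0).
Hypothesis cD : characteristic_radius D Rad.
Hypothesis X_start : P [set w : cadlag_path R d | w 0 = 0] = 1%E.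
Hypothesis X_gaussian : forall j, gaussian_process01 P (fun s (w : cadlag_path R d) => w s 0 j).
Hypothesis X_centered : forall j s, s \in `[0, 1] ->
  'E_P[fun w : cadlag_path R d => (w s 0 j)%R]%E = 0%E.
Hypothesis X_nondegenerate : forall j t, t \in `]0, 1] ->
  (0 < P [set w : cadlag_path R d | w t 0%R j <> 0%R])%E.

Lemma mean_sup_mono j s t : 0 < s -> s <= t -> (mean_sup P j s <= mean_sup P j t)%E.
Proof.
move=> s0 st; rewrite !(mean_supE X_start)//; last exact: lt_le_trans st.
apply: ge0_le_integral_any => w _; first exact: pos_sup_ge0.
exact: pos_sup_signed_mono.
Qed.

(** Dominated convergence, with the supremum over [0, t] as integrable majorant. *)
Lemma mean_sup_cvg0 j t : 0 < t -> (mean_sup P j t < +oo)%E ->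
  (mean_sup P j (t / n.+1%:R) @[n --> \oo] --> 0)%E.
Proof.
move=> t0 mt; have mY n := fun i => measurable_signed_coord false j (t / n.+1%:R) i.
have mY0 := fun i => measurable_signed_coord false j t i.
have tn n : 0 < t / n.+1%:R by rewrite divr_gt0.
have tn' n : t / n.+1%:R <= t by rewrite ler_piMr ?(ltW t0)// invf_le1// ler1n.
have c0 : {ae P, forall w, setT w ->
    (pos_sup (signed_coord false j (t / n.+1%:R)) w @[n --> \oo] --> cst 0 w)%E}.
  by apply: filterS (ae_start X_start) => w w0 _; exact: pos_sup_signed_cvg0.
have ig : P.-integrable setT (pos_sup (signed_coord false j t)).
  apply/integrableP; split; first exact: measurable_pos_sup.
  under eq_integral do rewrite gee0_abs ?pos_sup_ge0//.
  by rewrite -(mean_supE X_start).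
have dom : {ae P, forall w n, setT w ->
    (`|pos_sup (signed_coord false j (t / n.+1%:R)) w| <= pos_sup (signed_coord false j t) w)%E}.
  by apply: aeW => w n _; rewrite gee0_abs ?pos_sup_ge0//; exact: pos_sup_signed_mono.
have [_ _] := dominated_convergence measurableT (fun n => measurable_pos_sup (mY n)) (measurable_cst _) c0 ig dom.
by rewrite integral0; under eq_fun do rewrite -(mean_supE X_start)//.
Qed.

Lemma mean_sup_small t e : 0 < t -> (forall j, (mean_sup P j t < +oo)%E) -> 0 < e ->
  exists2 t1, 0 < t1 <= t & forall s, 0 < s <= t1 -> forall j, (mean_sup P j s <= e%:E)%E.
Proof.
move=> t0 mt e0.
have H : \forall n \near \oo, forall j, (mean_sup P j (t / n.+1%:R) <= e%:E)%E.
  apply: filter_forall => j.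
  have /fine_cvgP[nf /cvgrPdist_le /(_ e e0) ne] := mean_sup_cvg0 t0 (mt j).
  near=> n; have h1 : mean_sup P j (t / n.+1%:R) \is a fin_num by near: n.
  rewrite -(fineK h1) lee_fin; apply: le_trans (ler_norm _) _.
  by rewrite -normrN -sub0r; near: n.
have [n _ /(_ n (leqnn n)) Hn] := H.
exists (t / n.+1%:R).
  by rewrite divr_gt0//= ler_piMr ?(ltW t0)// invf_le1// ler1n.
by move=> s /andP[s0 st] j; apply: le_trans (Hn j); exact: mean_sup_mono.
Unshelve. all: by end_near.
Qed.

Lemma integral_path_range t : 0 < t <= 1 ->
  (\int[P]_w path_range t w = \sum_(j < d) mean_sup P j t + \sum_(j < d) mean_sup P j t)%E.
Proof.
move=> t01; have mS b j : measurable_fun setT (pos_sup (signed_coord b j t) : cadlag_path R d -> _).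
  by apply: measurable_pos_sup => n; exact: measurable_signed_coord.
rewrite /path_range ge0_integral_sum//; last 2 first.
- by move=> j; exact: emeasurable_funD.
- by move=> j w _; apply: adde_ge0; exact: pos_sup_ge0.
rewrite -big_split; apply: eq_bigr => j _; rewrite ge0_integralD//.
- by rewrite !(mean_sup_signed X_start X_gaussian X_centered).
- by move=> w _; exact: pos_sup_ge0.
- by move=> w _; exact: pos_sup_ge0.
Qed.

Lemma escapes_le t r : t \in `]0, 1] -> (forall j, (mean_sup P j t < r%:E)%E) ->
  (P (escapes t r) <= (2 * \sum_(j < d)
     expR (- (r - fine (mean_sup P j t)) ^+ 2 / (2 * fine (var_sup P j t))))%:E)%E.
Proof.
move=> t01 mr; have t01' := t01; rewrite in_itv/= in t01'; have /andP[t0 t1] := t01'.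
apply: le_trans (measure_bigU_le _ _ _) _.
  by move=> j; apply: measurableU; exact: measurable_signed_exceeds.
rewrite mulr_sumr -sumEFin; apply: lee_sum => j _.
apply: le_trans (measureU2 _ _ _) _; [exact: measurable_signed_exceeds|exact: measurable_signed_exceeds|].
have mf : mean_sup P j t = (fine (mean_sup P j t))%:E.
  rewrite fineK// ge0_fin_numE ?(mean_sup_ge0 X_start)//.
  by apply: lt_le_trans (mr j) _; rewrite leey.
have tail b := path_tail X_start X_gaussian X_centered X_nondegenerate b t01 mf.
rewrite mulr_natl mulr2n EFinD; apply: leeD; apply: tail; by rewrite -lte_fin -mf.
Qed.

(** In [heat_loss_le] the mean range is 2 d times the average mean supremum, so the first constant
    is 2^k * 2 d = d 2^d <= d^(3/2) 2^d; the tails of X^j and of -X^j give 2 <= 4 d. *)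
Lemma heat_loss_bound t a : t \in `]0, 1] -> a \in `]0, Rad / 2] ->
  (forall j, (mean_sup P j t < (a / Num.sqrt d%:R)%:E)%E) ->
  (lebesgue_rV D - heat_content P D t <=
    (d%:R `^ (3 / 2) * 2 ^+ d)%:E * surface_area D * mean_sup_avg P t +
    (4 * d%:R)%:E * lebesgue_rV (inner_part D a) *
    (\sum_(j < d)
       expR (- (a / Num.sqrt d%:R - fine (mean_sup P j t)) ^+ 2 /
             (2 * fine (var_sup P j t))))%:E)%E.
Proof.
move=> t01 aR ma; have t01' := t01; rewrite in_itv/= in t01'; have /andP[t0 t1] := t01'.
rewrite in_itv/= in aR.
apply: le_trans (heat_loss_le P oD bD D0 cD t0 aR) _; apply: leeD.
  have mf j : mean_sup P j t \is a fin_num.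
    rewrite ge0_fin_numE ?(mean_sup_ge0 X_start)//.
    by apply: lt_le_trans (ma j) _; rewrite leey.
  have [s s0 Es] : exists2 s, 0 <= s & (\sum_(j < d) mean_sup P j t = s%:E)%E.
    exists (fine (\sum_(j < d) mean_sup P j t)%E).
      by rewrite fine_ge0// sume_ge0// => j _; rewrite (mean_sup_ge0 X_start).
    rewrite fineK// ge0_fin_numE; last by apply: sume_ge0 => j _; rewrite (mean_sup_ge0 X_start).
    by apply: lte_sum_pinfty => j _; rewrite ltey_eq mf.
  rewrite integral_path_range// /mean_sup_avg Es -EFinD -EFinM.
  rewrite muleAC [leRHS]muleAC -!EFinM; apply: lee_wpmul2r; first exact: surface_area_ge0 oD bD D0 cD.
  rewrite lee_fin (_ : 2 ^+ k * (s + s) = 1 * 2 ^+ d * s); last by rewrite exprS; ring.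
  rewrite mulrA; apply: ler_wpM2r => //; rewrite mulrAC; apply: ler_wpM2r; first exact: exprn_ge0.
  rewrite ler_pdivlMr ?ltr0n// mul1r -[leLHS]powRr1 ?ler0n//.
  by apply: ler_powR; rewrite ?ler1n//; lra.
apply: (@le_trans _ _ ((2 * \sum_(j < d) expR (- (a / Num.sqrt d%:R - fine (mean_sup P j t)) ^+ 2 /
             (2 * fine (var_sup P j t))))%:E * lebesgue_rV (inner_part D a))%E).
  by apply: lee_wpmul2r => //; exact: escapes_le.
rewrite muleAC; apply: lee_wpmul2r => //; rewrite -EFinM lee_fin; apply: ler_wpM2r.
  by apply: sumr_ge0 => j _; exact: expR_ge0.
have : 1 <= d%:R :> R by rewrite ler1n.
by move: (d%:R : R) => z; lra.
Qed.

Lemma expR_opp_le (x : R) : 0 < x -> expR (- x) <= x^-1.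
Proof.
move=> x0; rewrite expRN lef_pV2 ?posrE ?expR_gt0//.
by have := expR_ge1Dx x; lra.
Qed.

(** At the fixed depth a = Rad / 2, the inequality e^(-x) <= 1 / x bounds each exponential by a
    multiple of the variance, hence of the square of a mean supremum, which is negligible against
    the mean supremum itself. *)
Lemma heat_loss_ratio_le (h eps t0 : R) : surface_area D = h%:E -> t0 \in `]0, 1] ->
  (forall j, (mean_sup P j t0 < +oo)%E) -> 0 < eps ->
  exists2 t1, 0 < t1 <= 1 & forall t, 0 < t <= t1 ->
    ((lebesgue_rV D - heat_content P D t) / mean_sup_avg P t <=
     (d%:R `^ (3 / 2) * 2 ^+ d * h + eps)%:E)%E.
Proof.
move=> Dh t01 mt0 eps0; move: t01; rewrite in_itv/= => /andP[t00 t01].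
have [Rad0 _] := cD.
pose a := Rad / 2; have a0 : 0 < a by rewrite divr_gt0.
pose b := a / Num.sqrt d%:R; have b0 : 0 < b by rewrite divr_gt0// sqrtr_gt0 ltr0n.
pose kap := @moment_ratio R.
have kap0 : 0 <= kap.
  by rewrite divr_ge0 ?sqr_ge0//; apply: Rintegral_ge0 => x _; exact: sqr_ge0.
have mI := measurable_inner_part oD bD D0 a.
have LI : (lebesgue_rV (inner_part D a) < +oo)%E.
  apply: le_lt_trans (lebesgue_domain_lty oD bD); apply: le_measure; rewrite ?inE//.
    exact: open_measurable_rV.
  by move=> x [].
pose L := fine (lebesgue_rV (inner_part D a)).
have LE : (lebesgue_rV (inner_part D a) = L%:E)%E by rewrite fineK// ge0_fin_numE.
have L0 : 0 <= L by rewrite fine_ge0.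
(* 8 kap / b^2 comes from (b / 2)^-2 * 2 v with v <= kap m^2; the last d turns the average of the
   means into their sum. *)
pose M := 4 * d%:R * L * (8 * kap / b ^+ 2) * d%:R.
have M0 : 0 <= M.
  by do 2 (apply: mulr_ge0 => //); [apply: mulr_ge0 => //|rewrite divr_ge0 ?sqr_ge0// mulr_ge0].
(* e <= b / 2 keeps b - m at least b / 2, and e <= eps / (M + 1) makes M e at most eps. *)
pose e := Num.min (b / 2) (eps / (M + 1)).
have e0 : 0 < e by rewrite lt_min !divr_gt0// ltr_wpDl.
have eb : e <= b / 2 by rewrite ge_min lexx.
have eM : M * e <= eps.
  have M1 : 0 < M + 1 by rewrite ltr_wpDl.
  have : e * (M + 1) <= eps by rewrite -ler_pdivlMr// ge_min lexx orbT.
  by rewrite mulrDr mulr1 mulrC; move: e0; lra.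
have [t1 /andP[t10 t1t] small] := mean_sup_small t00 mt0 e0.
exists t1; first by rewrite t10 (le_trans t1t).
move=> t /andP[tp tt1]; have t11 : t \in `]0, 1] by rewrite in_itv/= tp (le_trans tt1 (le_trans t1t t01)).
have t11' : 0 < t <= 1 by move: t11; rewrite in_itv.
have me j : (mean_sup P j t <= e%:E)%E by apply: small; rewrite tp.
have mf j : mean_sup P j t = (fine (mean_sup P j t))%:E.
  rewrite fineK// ge0_fin_numE ?(mean_sup_ge0 X_start)//.
  by apply: le_lt_trans (me j) _; rewrite ltry.
pose m j := fine (mean_sup P j t).
have m0 j : 0 < m j by rewrite -lte_fin -mf (mean_sup_gt0 X_start X_gaussian X_centered X_nondegenerate).
have mle j : m j <= e by rewrite -lee_fin -mf.
pose s := \sum_j m j; have s0 : 0 < s.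
  by rewrite /s (bigD1 ord0)//= ltr_pwDl// sumr_ge0// => j _; exact: ltW.
have avgE : (mean_sup_avg P t = (s / d%:R)%:E)%E.
  rewrite /mean_sup_avg mulrC EFinM; congr (_ * _)%E; rewrite -sumEFin.
  by apply: eq_bigr => j _; exact: mf.
have mu0 : 0 < s / d%:R by rewrite divr_gt0// ltr0n.
rewrite avgE inver gt_eqF// lee_pdivrMr//.
have mb j : (mean_sup P j t < b%:E)%E.
  apply: le_lt_trans (me j) _; rewrite lte_fin; apply: le_lt_trans eb _.
  by rewrite ltr_pdivrMr// ltr_pMr// ltr1n.
have aR : a \in `]0, Rad / 2] by rewrite in_itv/= a0 lexx.
apply: le_trans (heat_loss_bound t11 aR mb) _.
rewrite Dh avgE LE -!EFinM -EFinD lee_fin [leRHS]mulrDl lerD2l.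
have term j : expR (- (b - m j) ^+ 2 / (2 * fine (var_sup P j t))) <= 8 * kap / b ^+ 2 * e * m j.
  have vle := var_sup_le X_start X_gaussian X_centered t11' (mf j).
  have vgt := var_sup_gt0 X_nondegenerate j t11.
  have vf : var_sup P j t \is a fin_num.
    by rewrite ge0_fin_numE ?(ltW vgt)//; apply: le_lt_trans vle _; rewrite ltry.
  move: vle vgt; rewrite -(fineK vf) lee_fin lte_fin /=.
  set v := fine (var_sup P j t) => vle v0.
  have bm : b / 2 <= b - m j by have := mle j; lra.
  have b2 : 0 < b / 2 by rewrite divr_gt0.
  have x0 : 0 < (b - m j) ^+ 2 / (2 * v).
    by apply: divr_gt0; [apply: exprn_gt0; lra|exact: mulr_gt0].
  rewrite mulNr; apply: le_trans (expR_opp_le x0) _; rewrite invfM invrK.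
  apply: (@le_trans _ _ ((b / 2) ^- 2 * (2 * v))).
    apply: ler_wpM2r; first by rewrite mulr_ge0// ltW.
    by rewrite lef_pV2 ?posrE ?exprn_gt0// ?ler_sqr ?nnegrE; lra.
  rewrite (_ : _ * _ = 8 / b ^+ 2 * v); last by field; rewrite gt_eqF.
  rewrite (_ : 8 * kap / b ^+ 2 * e * m j = 8 / b ^+ 2 * (kap * (e * m j))); last by field; rewrite gt_eqF.
  apply: ler_wpM2l; first by rewrite divr_ge0// sqr_ge0.
  apply: le_trans vle _; apply: ler_wpM2l => //.
  by rewrite expr2; apply: ler_wpM2r; [exact: ltW (m0 j)|exact: mle j].
apply: (@le_trans _ _ (4 * d%:R * L * (8 * kap / b ^+ 2 * e * s))).
  apply: ler_wpM2l; first by rewrite !mulr_ge0.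
  by rewrite /s mulr_sumr; apply: ler_sum => j _; exact: term.
rewrite (_ : _ * _ = M * e * (s / d%:R)).
  by apply: ler_wpM2r => //; exact: ltW.
by rewrite /M; field; rewrite gt_eqF//= gt_eqF// ltr0n.
Qed.

Lemma heat_loss_limsup :
  (limf_esup (fun t : R => (lebesgue_rV D - heat_content P D t) / mean_sup_avg P t)%E (0 : R)^'+
     <= (d%:R `^ (3 / 2) * 2 ^+ d)%:E * surface_area D)%E.
Proof.
set c := d%:R `^ (3 / 2) * 2 ^+ d.
have c0 : 0 < c by rewrite mulr_gt0 ?powR_gt0 ?exprn_gt0// ltr0n.
have H0 := surface_area_ge0 oD bD D0 cD.
set F := fun t : R => _.
have upper (t1 : R) (y : \bar R) : 0 < t1 -> (forall t, 0 < t <= t1 -> (F t <= y)%E) ->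
    (limf_esup F (0 : R)^'+ <= y)%E.
  move=> t10 Fy; rewrite limf_esupE.
  apply: (@le_trans _ _ (ereal_sup (F @` [set t | 0 < t <= t1]))).
    apply: ereal_inf_lbound; exists [set t | 0 < t <= t1] => //.
    near=> t; apply/andP; split; near: t; [exact: nbhs_right_gt|exact: nbhs_right_le].
  by apply: ge_ereal_sup => _ [t tt <-]; exact: Fy.
(* Either the mean suprema are all finite at some time, hence at all earlier ones, or at every time
   one of them is infinite. *)
have [[t0 t01 mt0]|nt] := pselect (exists2 t0, t0 \in `]0, 1] & forall j, (mean_sup P j t0 < +oo)%E).
  case E : (surface_area D) => [h||]; last 2 first.
  - by rewrite gt0_muley ?leey// lte_fin.
  - by move: H0; rewrite E.
  rewrite -EFinM; apply/lee_addgt0Pr => e e0.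
  have [t1 /andP[t10 _] Ht1] := heat_loss_ratio_le E t01 mt0 e0.
  by apply: (upper t1) => // t tt; rewrite -EFinD; exact: Ht1.
(* The averages are +oo, and dividing by +oo gives 0. *)
apply: (@le_trans _ _ 0%E); last by apply: mule_ge0 => //; rewrite lee_fin ltW.
apply: (upper 1) => // t tt.
have t01 : t \in `]0, 1] by rewrite in_itv.
have /andP[tp _] := tt.
have [j mj] : exists j, mean_sup P j t = +oo%E.
  apply: contrapT => nj; apply: nt; exists t => // j; rewrite ltey; apply/eqP => mj.
  by apply: nj; exists j.
have avgE : mean_sup_avg P t = +oo%E.
  rewrite /mean_sup_avg (_ : (\sum_j _)%E = +oo%E).
    by rewrite gt0_muley// lte_fin invr_gt0 ltr0n.
  apply/eqP; rewrite esum_eqy; first by apply/existsP; exists j; rewrite mj.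
  by move=> i _; rewrite -ltNye; apply: lt_le_trans (mean_sup_ge0 X_start i tp); rewrite ltNyr.
by rewrite /F avgE invey mule0.
Unshelve. all: by end_near.
Qed.

End gaussian_heat_loss.

Theorem proposition4p3 (R : realType) (d : nat) (d_ge2 : (2 <= d)%N)
    (D : set 'rV[R]_d) (Rad : R) (P : probability (cadlag_path R d) R)
    (D_nonempty : D !=set0) (D_bounded : bounded_set D)
    (D_connected : connected D) (D_open : open D) (D_C11 : C11_domain D)
    (D_radius : characteristic_radius D Rad)
    (X_start : P [set w : cadlag_path R d | w 0 = 0] = 1%E)
    (X_gaussian : forall j : 'I_d,
       gaussian_process01 P (fun s w => w s 0 j))
    (X_centered : forall (j : 'I_d) (s : R), s \in `[0, 1] ->
       'E_P[fun w => (w s 0 j)%R]%E = 0%E)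
    (X_sup_finite : forall (j : 'I_d) (t : R), t \in `]0, 1] ->
       {ae P, forall w, (running_sup j t w < +oo)%E})
    (X_nondegenerate : forall (j : 'I_d) (t : R), t \in `]0, 1] ->
       (0 < P [set w : cadlag_path R d | w t 0%R j <> 0%R])%E) :
  (forall t a : R, t \in `]0, 1] -> a \in `]0, Rad / 2] ->
     (\big[maxe/-oo%E]_(j < d) mean_sup P j t < (a / Num.sqrt d%:R)%:E)%E ->
     (lebesgue_rV D - heat_content P D t <=
        (d%:R `^ (3 / 2) * 2 ^+ d)%:E * surface_area D * mean_sup_avg P t +
        (4 * d%:R)%:E * lebesgue_rV (inner_part D a) *
        (\sum_(j < d)
           expR (- (a / Num.sqrt d%:R - fine (mean_sup P j t)) ^+ 2 /
                 (2 * fine (var_sup P j t))))%:E)%E) /\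
  (limf_esup (fun t : R =>
       (lebesgue_rV D - heat_content P D t) / mean_sup_avg P t)%E (0 : R)^'+
     <= (d%:R `^ (3 / 2) * 2 ^+ d)%:E * surface_area D)%E.
Proof.
case: d d_ge2 D P D_nonempty D_bounded D_connected D_open D_C11 D_radius X_start X_gaussian
  X_centered X_sup_finite X_nondegenerate => // k _ D P D0 bD _ oD _ cD Xs Xg Xc _ Xn.
split; last exact: heat_loss_limsup oD bD D0 cD Xs Xg Xc Xn.
move=> t a t01 aR ma; apply: (heat_loss_bound oD bD D0 cD Xs Xg Xc Xn t01 aR) => j.
exact: le_lt_trans (le_bigmax _ _ j) ma.
Qed.
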